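(* Let $d\ge2$, $k\ge0$ be integers, $\Omega=[0,1]^d$, $T>0$, and let $\mathbf A=(A_1,\dots,A_d)$ be a smooth vector field on $[0,T]\times\Omega$ with no $A_i$ vanishing anywhere (so each $A_i$ has constant sign), and with $\|\mathbf A\|_{L^\infty}<\infty$ and $\|\nabla\cdot\mathbf A\|_{L^\infty}<\infty$. Consider the semi-discrete sparse grid central discontinuous Galerkin scheme (defined in the context), with parameter $\tau_{\max}>0$ and mesh level $N\ge1$, for $u_t+\nabla\cdot(\mathbf A u)=0$. (i) Periodic case. Assume moreover that $\mathbf A$ is periodic in $\mathbf x$. There is a constant $C$, independent of $N$, such that for every $N\geq 1$ the numerical solutions $u_h,v_h$ of the periodic scheme satisfy, for all $t\in[0,T]$, $$\|u_h(t,\cdot)\|_{L^2(\Omega)}^2+\|v_h(t,\cdot)\|_{L^2(\Omega)}^2\le C\left(\|u_h(0,\cdot)\|_{L^2(\Omega)}^2+\|v_h(0,\cdot)\|_{L^2(\Omega)}^2\right).$$ (ii) Non-periodic case. There are constants $c>0$ and $C$, independent of $N$, such that for every $N\geq 1$, if $\tau_{\max}\le c\,h_N/\|\mathbf A\|_1$ with $h_N=2^{-N}$, then the numerical solutions $u_h,v_h$ of the non-periodic scheme with inflow data $g_1,\dots,g_d$ satisfy, for all $t\in[0,T]$, $$\|u_h(t,\cdot)\|_{L^2(\Omega)}^2+\|v_h(t,\cdot)\|_{L^2(\Omega)}^2\le C\left(\|u_h(0,\cdot)\|_{L^2(\Omega)}^2+\|v_h(0,\cdot)\|_{L^2(\O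mega)}^2+\int_0^T\sum_{i=1}^d\int_{\partial\Omega_{x_i^{in}}}|A_i|\,g_i^2\,ds\,dt\right).$$
   Context: One-dimensional spaces. For an interval $[a,b]$ and $n\ge0$, let $V_n^k([a,b])$ be the space of functions that are polynomials of degree at most $k$ on each of the $2^n$ cells of the uniform partition of $[a,b]$ into cells of length $2^{-n}(b-a)$. Set $W_0^k([a,b])=V_0^k([a,b])$ and, for $n\ge1$, let $W_n^k([a,b])$ be the $L^2$-orthogonal complement of $V_{n-1}^k([a,b])$ in $V_n^k([a,b])$. Sparse spaces. $\hat{\mathbf V}_N^k([a,b]^d)=\bigoplus_{\mathbf l\in\mathbb N_0^d,\ l_1+\cdots+l_d\le N}W_{l_1}^k([a,b])\otimes\cdots\otimes W_{l_d}^k([a,b])$. With $h_N=2^{-N}$: the primal space is $\hat{\mathbf V}_{N,P}^k=\hat{\mathbf V}_N^k([0,1]^d)$; the periodic dual space $\hat{\mathbf V}_{N,D}^k$ consists of the $1$-periodic extensions (in each variable) of functions in $\hat{\mathbf V}_N^k([-\frac{h_N}2,1-\frac{h_N}2]^d)$, restricted to $[0,1]^d$. Non-periodic dual space. For $0\le l\le N$ let $h_l=2^{-l}$ and let $V_{l,N,D}^k$ be the functions that are polynomials of degree at most $k$ on each of the cells $[0,h_l-\frac{h_N}2]$, $[jh_l-\frac{h_N}2,(j+1)h_l-\frac{h_N}2]$ ($1\le j\le2^l-1$), $[1-\frac{h_N}2,1]$. Put $W_{0,N,D}^k=V_{0,N,D}^k$ and, for $1\le l\le N$, let $W_{l,N,D}^k$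 be the restrictions to $[0,1]$ of functions in $W_l^k([-\frac{h_N}2,1-\frac{h_N}2])$, extended by zero on $(1-\frac{h_N}2,1]$. Then $\hat{\tilde{\mathbf V}}_{N,D}^k=\bigoplus_{\mathbf l\in\mathbb N_0^d,\ l_1+\cdots+l_d\le N}W_{l_1,N,D}^k\otimes\cdots\otimes W_{l_d,N,D}^k$. Meshes and jumps. The primal mesh $\Omega_{N,P}$ is the uniform tensor mesh of $[0,1]^d$ with cells of side $h_N$. The dual mesh $\Omega_{N,D}$ has cell faces on the hyperplanes $x_i=(j-\frac12)h_N$, $1\le j\le2^N$; in the periodic case cells are understood modulo periodicity (uniform cells of side $h_N$ on the torus), and in the non-periodic case the cells adjacent to $\partial\Omega$ are cut by $\partial\Omega$. For $G\in\{P,D\}$, $\Gamma_{N,G}$ denotes the set of faces of the mesh $\Omega_{N,G}$, with opposite boundary faces identified in the periodic case. On an interior face $e$ shared by cells $T_\pm$ with outward unit normals $\boldsymbol n^\pm$, the jump of a scalar function is $[q]=q^-\boldsymbol n^-+q^+\boldsymbol n^+$. Gradients of piecewise polynomials are taken cell by cell. (Primal functions have well-defined traces a.e. on dual interior faces and vice versa.) Periodic scheme. Find $u_h(t)\in\hat{\mathbf V}_{N,P}^k$, $v_h(t)\in\hat{\mathbf V}_{N,D}^k$, continuously differentiable in $t\in[0,T]$, such that for all $\varphi_h\in\hat{\mathbf V}_{N,P}^k$, $\psi_h\in\hat{\mathbf V}_{N,D}^k$, $$\int_\Omega(u_h)_t\varphi_h\,d\mathbf x=\frac1{\tau_{\max}}\int_\Omega(v_h-u_h)\varphi_h\,d\mathbf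 x+\int_\Omega v_h\mathbf A\cdot\nabla\varphi_h\,d\mathbf x-\sum_{e\in\Gamma_{N,P}}\int_e v_h\mathbf A\cdot[\varphi_h]\,ds,$$ $$\int_\Omega(v_h)_t\psi_h\,d\mathbf x=\frac1{\tau_{\max}}\int_\Omega(u_h-v_h)\psi_h\,d\mathbf x+\int_\Omega u_h\mathbf A\cdot\nabla\psi_h\,d\mathbf x-\sum_{e\in\Gamma_{N,D}}\int_e u_h\mathbf A\cdot[\psi_h]\,ds.$$ Non-periodic scheme. The inflow boundary in direction $i$ is $\partial\Omega_{x_i^{in}}=\{\mathbf x\in\Omega: x_i=0\}$ if $A_i>0$ and $\{x_i=1\}$ if $A_i<0$; the outflow boundary $\partial\Omega_{x_i^{out}}$ is the opposite face. The boundary condition is $u=g_i$ on $\partial\Omega_{x_i^{in}}$, with given square-integrable data $g_i$ (functions of $t$ and of the variables $x_j$, $j\ne i$). The scheme is the same pair of equations with $\hat{\mathbf V}_{N,D}^k$ replaced by $\hat{\tilde{\mathbf V}}_{N,D}^k$ (for both $v_h$ and $\psi_h$), where the face sums also include the faces contained in $\partial\Omega$: on such a face, with $\mathbf n$ the outward unit normal of $\Omega$, one uses $[\varphi_h]=\varphi_h\mathbf n$ and $[\psi_h]=\psi_h\mathbf n$, the value of $v_h$ (in the first equation) and of $u_h$ (in the second) multiplying $\mathbf A\cdot[\cdot]$ is replaced by $g_i$ on $\partial\Omega_{x_i^{in}}$, and is the interior trace of $v_h$, respectively $u_h$, on $\partial\Omega_{x_i^{out}}$. Norm of $\mathbf A$: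 $\|\mathbf A\|_1=\sum_{i=1}^d\|A_i\|_{L^\infty([0,T]\times\Omega)}$; $\|\nabla\cdot\mathbf A\|_{L^\infty}$ is the supremum over $[0,T]\times\Omega$. Constants $C$ and $c$ may depend on $d,k,T$ and $\mathbf A$, but not on $N$, the numerical solutions, or the data $g_i$. *)

(* Defs.v *)
From HB Require Import structures.
From mathcomp Require Import all_boot all_order all_algebra.
From mathcomp Require Import all_classical all_reals all_analysis.
Set Implicit Arguments.
Unset Strict Implicit.
Unset Printing Implicit Defensive.
Import Order.TTheory GRing.Theory Num.Theory.
Import numFieldNormedType.Exports.
Local Open Scope classical_set_scope.
Local Open Scope ring_scope.

Definition rV_display : measure_display.
Proof. exact. Qed.

Section rV_measurable.
Context {R : realType} (n : nat).

Let coord (i : 'I_n) (x : 'rV[R]_n) : measurableTypeR R := x ord0 i.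

Let rV_set0 : g_sigma_preimage coord set0.
Proof. exact: sigma_algebra0. Qed.

Let rV_setC A : g_sigma_preimage coord A -> g_sigma_preimage coord (~` A).
Proof. exact: sigma_algebraC. Qed.

Let rV_bigcup (F : (set 'rV[R]_n)^nat) :
  (forall i, g_sigma_preimage coord (F i)) ->
  g_sigma_preimage coord (\bigcup_i (F i)).
Proof. exact: sigma_algebra_bigcup. Qed.

HB.instance Definition _ := @isMeasurable.Build rV_display 'rV[R]_n
  (g_sigma_preimage coord) rV_set0 rV_setC rV_bigcup.

End rV_measurable.

(** [insx i s y] is the point with [i]-th coordinate [s] and remaining
    coordinates [y], in order. *)
Definition insx {T : Type} {n : nat} (i : 'I_n) (s : T) (y : 'rV[T]_n.-1) :
  'rV[T]_n := \row_j oapp (y ord0) s (unlift i j).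

Section cons_measure.
Context {R : realType} (n : nat).

Definition consx (p : measurableTypeR R * 'rV[R]_n) : 'rV[R]_n.+1 :=
  insx ord0 p.1 p.2.

Lemma measurable_coord m (i : 'I_m) :
  measurable_fun setT (fun x : 'rV[R]_m => x ord0 i : measurableTypeR R).
Proof.
move=> _ Y mY; rewrite setTI; apply: sub_sigma_algebra => /=.
rewrite -bigcup_seq/=; exists i => /=; first by rewrite mem_index_enum.
by exists Y => //; rewrite setTI.
Qed.

Lemma measurable_rVP d (T : measurableType d) m (f : T -> 'rV[R]_m) :
  (forall i, measurable_fun setT (fun x => f x ord0 i : measurableTypeR R)) ->
  measurable_fun setT f.
Proof.
move=> mf.
pose P := [set A : set 'rV[R]_m | measurable (f @^-1` A)].
suff H : measurable `<=` P by move=> _ Y mY; rewrite setTI; exact: H.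
apply: smallest_sub.
  split.
  - by rewrite /P /= preimage_set0.
  - by move=> A PA; rewrite /P /= setTD preimage_setC; exact: measurableC.
  - by move=> F PF; rewrite /P /= preimage_bigcup; exact: bigcupT_measurable.
rewrite -bigcup_seq => A [i _ /= [B mB <-]].
rewrite /P /= setTI -[X in measurable X]setTI.
exact: (mf i measurableT B mB).
Qed.

Lemma measurable_consx : measurable_fun setT consx.
Proof.
apply: measurable_rVP => i; rewrite /consx /insx.
case: (unliftP ord0 i) => [j|] ->.
  rewrite (_ : (fun _ => _) = (fun x : 'rV[R]_n => x ord0 j) \o snd).
    exact: (measurableT_comp (measurable_coord j) measurable_snd).
  by apply/funext => p /=; rewrite mxE liftK.
rewrite (_ : (fun _ => _) = fst); first exact: measurable_fst.
by apply/funext => p /=; rewrite mxE unlift_none.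
Qed.

Definition unconsx (x : 'rV[R]_n.+1) : measurableTypeR R * 'rV[R]_n :=
  (x ord0 ord0, \row_j x ord0 (lift ord0 j)).

Lemma measurable_unconsx : measurable_fun setT unconsx.
Proof.
apply: measurable_fun_pair => /=; first exact: measurable_coord.
apply: measurable_rVP => i.
rewrite (_ : (fun _ => _) = fun x : 'rV[R]_n.+1 => x ord0 (lift ord0 i)).
  exact: measurable_coord.
by apply/funext => x; rewrite mxE.
Qed.

Lemma consxK : cancel consx unconsx.
Proof.
move=> [s y]; rewrite /unconsx /consx /insx; congr pair.
  by rewrite /= mxE unlift_none.
by apply/rowP => j; rewrite !mxE liftK.
Qed.

Variable m : {sigma_finite_measure set 'rV[R]_n -> \bar R}.

Definition cons_measure : set 'rV[R]_n.+1 -> \bar R :=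
  pushforward (lebesgue_measure \x m)%E consx.

Let cons0 : cons_measure set0 = 0%E.
Proof. by rewrite /cons_measure /pushforward preimage_set0 measure0. Qed.

Let cons_ge0 A : (0 <= cons_measure A)%E.
Proof. exact: (measure_ge0 (lebesgue_measure \x m)%E). Qed.

Let cons_sigma_additive : semi_sigma_additive cons_measure.
Proof.
have mp X : measurable X -> measurable (consx @^-1` X).
  by move=> mX; rewrite -[X in measurable X]setTI; exact: measurable_consx.
move=> F mF tF mUF; rewrite /cons_measure /pushforward preimage_bigcup.
apply: measure_semi_sigma_additive.
- by move=> i; exact: mp.
- apply/trivIsetP => /= i j _ _ ij; rewrite -preimage_setI.
  by move/trivIsetP : tF => /(_ _ _ _ _ ij) ->//; rewrite preimage_set0.
- by rewrite -preimage_bigcup; exact: mp.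
Qed.

HB.instance Definition _ := isMeasure.Build _ _ _ cons_measure
  cons0 cons_ge0 cons_sigma_additive.

Let cons_sigma_finite : sigma_finite setT cons_measure.
Proof.
have /sigma_finiteP[F [TF ndF Foo]] := sigma_finiteT (@lebesgue_measure R).
have /sigma_finiteP[G [TG ndG Goo]] := sigma_finiteT m.
exists (fun i => unconsx @^-1` (F i `*` G i)).
  apply/esym; rewrite -subTset => x _.
  have [i _ Fi] : (\bigcup_i F i) (unconsx x).1 by rewrite -TF.
  have [j _ Gj] : (\bigcup_i G i) (unconsx x).2 by rewrite -TG.
  exists (maxn i j) => //; split.
  - by move: Fi; exact/subsetPset/ndF/leq_maxl.
  - by move: Gj; exact/subsetPset/ndG/leq_maxr.
move=> i; have [mF Fi] := Foo i; have [mG Gi] := Goo i; split.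
  rewrite -[X in measurable X]setTI.
  by apply: measurable_unconsx => //; exact: measurableX.
rewrite /cons_measure /pushforward -comp_preimage.
rewrite (_ : unconsx \o consx = id); last by apply/funext; exact: consxK.
by rewrite preimage_id product_measure1E// lte_mul_pinfty// ge0_fin_numE.
Qed.

HB.instance Definition _ := Measure_isSigmaFinite.Build _ _ _ cons_measure
  cons_sigma_finite.

End cons_measure.

(** Coordinates generate the sigma-algebra on ['rV[R]_n], and the measure is the
    iterated product of one-dimensional Lebesgue measures. *)
Fixpoint lebesgue_rV (R : realType) (n : nat) :
    {sigma_finite_measure set 'rV[R]_n -> \bar R} :=
  match n with
  | 0 => \d_(0 : 'rV[R]_0)
  | n'.+1 => cons_measure (lebesgue_rV R n')
  end.

Section geometry.
Context {R : realType} {d : nat}.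

Definition cube : set 'rV[R]_d := [set x | forall i, 0 <= x ord0 i <= 1].

Definition dirv (i : 'I_d) : 'rV[R]_d := delta_mx ord0 i.

Definition dotv (u v : 'rV[R]_d) : R := \sum_(i < d) u ord0 i * v ord0 i.

Definition int_cube (f : 'rV[R]_d -> R) : R :=
  (\int[lebesgue_rV R d]_(x in cube) f x)%R.

Definition L2sq (f : 'rV[R]_d -> R) : R := int_cube (fun x => f x ^+ 2).

End geometry.
Arguments cube : clear implicits.

(** A piecewise polynomial is represented by its right-continuous
    representative, which vanishes outside the half-open interval it lives on.
    This picks exactly one function in each L^2 class, so that the spaces below
    are finite dimensional; endpoint values are always taken as one-sided
    limits. *)
Section one_dim.
Context {R : realType}.

Definition meshsize (N : nat) : R := 2 ^- N.

Definition pwpoly (k : nat) (s : seq R) : set (R -> R) :=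
  [set f | (forall i, (i.+1 < size s)%N ->
              exists2 p : {poly R}, (size p <= k.+1)%N &
                forall x, s`_i <= x < s`_i.+1 -> f x = p.[x])
         /\ (forall x, ~~ (head 0 s <= x < last 0 s) -> f x = 0)].

Definition ugrid (n : nat) (a b : R) : seq R :=
  [seq a + j%:R * ((b - a) / 2 ^+ n) | j <- iota 0 (2 ^ n).+1].

Definition Vspace (k n : nat) (a b : R) : set (R -> R) :=
  pwpoly k (ugrid n a b).

Definition Wspace (k n : nat) (a b : R) : set (R -> R) :=
  match n with
  | 0 => Vspace k 0 a b
  | n'.+1 =>
    [set f | Vspace k n'.+1 a b f /\
       forall g, Vspace k n' a b g ->
         (\int[lebesgue_measure]_(x in `[a, b]) (f x * g x))%R = 0]
  end.

(** 0, h_l - h_N/2, 2 h_l - h_N/2, ..., 1 - h_N/2, 1 *)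
Definition dgrid (l N : nat) : seq R :=
  0 :: rcons [seq j%:R * meshsize l - meshsize N / 2 | j <- iota 1 (2 ^ l)] 1.

Definition VspaceD (k N l : nat) : set (R -> R) := pwpoly k (dgrid l N).

Definition WspaceD (k N l : nat) : set (R -> R) :=
  match l with
  | 0 => VspaceD k N 0
  | _ => [set f | exists2 F,
            Wspace k l (- (meshsize N / 2)) (1 - meshsize N / 2) F &
            f = fun x => if 0 <= x < 1 then F x else 0]
  end.

End one_dim.

Section sparse.
Context {R : realType} {d : nat}.

Definition lin_span (S : set ('rV[R]_d -> R)) : set ('rV[R]_d -> R) :=
  [set F | exists n (c : 'I_n -> R) (s : 'I_n -> 'rV[R]_d -> R),
     (forall j, S (s j)) /\ F = fun x => \sum_(j < n) c j * s j x].

Definition tensor (f : 'I_d -> R -> R) : 'rV[R]_d -> R :=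
  fun x => \prod_(i < d) f i (x ord0 i).

(** The sum over |l|_1 <= N of W_{l_1} (x) ... (x) W_{l_d} *)
Definition sparse_space (N : nat) (W : nat -> set (R -> R)) :
    set ('rV[R]_d -> R) :=
  lin_span [set F | exists l : 'I_d -> nat, (\sum_(i < d) l i <= N)%N /\
    exists f : 'I_d -> R -> R, (forall i, W (l i) (f i)) /\ F = tensor f].

(** 1-periodic extension, in each variable, of a function on [a, a + 1)^d *)
Definition perext (a : R) (F : 'rV[R]_d -> R) : 'rV[R]_d -> R :=
  fun x => F (\row_i (x ord0 i - (Num.floor (x ord0 i - a))%:~R)).

Definition restrict_cube (F : 'rV[R]_d -> R) : 'rV[R]_d -> R :=
  fun x => if [forall i, 0 <= x ord0 i < 1] then F x else 0.

Definition primal_space (k N : nat) : set ('rV[R]_d -> R) :=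
  sparse_space N (fun l => Wspace k l 0 1).

Definition periodic_dual_space (k N : nat) : set ('rV[R]_d -> R) :=
  let a := - (meshsize N / 2) in
  [set v | exists2 F, sparse_space N (fun l => Wspace k l a (a + 1)) F &
                      v = restrict_cube (perext a F)].

Definition dual_space (k N : nat) : set ('rV[R]_d -> R) :=
  sparse_space N (WspaceD k N).

End sparse.

Section mesh.
Context {R : realType}.

(** A tensor mesh is given by its one-dimensional mesh: the face positions and
    the cells in one coordinate. *)
Record mesh1d := Mesh1d { planes : seq R ; cells : seq (set R) }.

(** Cells [a + j h, a + (j+1) h) of the circle R/Z, seen in [0, 1); the face
    positions 0 and 1 are the same point of the circle. *)
Definition torus_mesh (N : nat) (a : R) : mesh1d :=
  Mesh1d
    [seq a + j%:R * meshsize N | j <- iota 0 (2 ^ N)]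
    [seq [set x | 0 <= x < 1 /\ exists m : int,
            a + j%:R * meshsize N <= x + m%:~R < a + j.+1%:R * meshsize N]
       | j <- iota 0 (2 ^ N)].

Definition interval_mesh (s : seq R) : mesh1d :=
  Mesh1d s [seq [set` `[s`_j, s`_j.+1]] | j <- iota 0 (size s).-1].

Context {d : nat}.

(** A face is given by its normal direction [i], its position [s] in that
    direction, and one cell for each of the other directions. The integrand
    receives [i], [s] and the coordinates [y] within the face. *)
Definition face_sum (M : mesh1d) (F : 'I_d -> R -> 'rV[R]_d.-1 -> R) : R :=
  \sum_(i < d) \sum_(s <- planes M)
    \sum_(c : {ffun 'I_d.-1 -> 'I_(size (cells M))})
      (\int[lebesgue_rV R d.-1]_(y in
          [set y | forall m, nth set0 (cells M) (c m) (y ord0 m)]) F i s y)%R.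

Implicit Types (q : 'rV[R]_d -> R) (x : 'rV[R]_d) (i : 'I_d).

Definition trace_lo i q x : R := lim (q (x - s *: dirv i) @[s --> 0^'+]).
Definition trace_hi i q x : R := lim (q (x + s *: dirv i) @[s --> 0^'+]).

(** [q^- n^- + q^+ n^+]: the outward normal of the lower cell is [dirv i]. *)
Definition jump i q x : 'rV[R]_d :=
  trace_lo i q x *: dirv i + trace_hi i q x *: - dirv i.

(** Cellwise gradient: since representatives are right-continuous, the right
    partial derivative at any point is that of the polynomial on its cell. *)
Definition cell_grad q x : 'rV[R]_d :=
  \row_i lim ((q (x + s *: dirv i) - q x) / s @[s --> 0^'+]).

End mesh.

Section schemes.
Context {R : realType} {d : nat}.
Variables (T : R) (A : R -> 'rV[R]_d -> 'rV[R]_d).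
Implicit Types (u v w phi psi : 'rV[R]_d -> R).

(** [ut] is the time derivative of [u] on [0, T] (one-sided at the endpoints),
    and is continuous. Pointwise in [x] is the same as in norm for the
    finite-dimensional spaces above. *)
Definition C1_in_time (u ut : R -> 'rV[R]_d -> R) : Prop :=
  forall x,
    (forall t, t \in `[0, T] ->
       (u s x - u t x) / (s - t) @[s --> within `[0, T] t^'] --> ut t x) /\
    {within `[0, T], continuous (fun t => ut t x)}.

Definition volume_terms (tau : R) (t : R) w1 w2 phi : R :=
  tau^-1 * int_cube (fun x => (w2 x - w1 x) * phi x)
  + int_cube (fun x => w2 x * dotv (A t x) (cell_grad phi x)).

(** [perext 0 phi] makes the lower trace at s = 0 the one at s = 1, as required
    for the identified boundary faces. *)
Definition torus_flux (t : R) w phi (i : 'I_d) (s : R) (y : 'rV[R]_d.-1) : R :=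
  let x := insx i s y in w x * dotv (A t x) (jump i (perext 0 phi) x).

Definition periodic_solution (k N : nat) (tau : R)
    (u v : R -> 'rV[R]_d -> R) : Prop :=
  (forall t, t \in `[0, T] ->
     primal_space k N (u t) /\ periodic_dual_space k N (v t)) /\
  exists ut vt, [/\ C1_in_time u ut, C1_in_time v vt &
    forall t, t \in `[0, T] ->
      (forall phi, primal_space k N phi ->
         int_cube (fun x => ut t x * phi x) =
         volume_terms tau t (u t) (v t) phi
         - face_sum (torus_mesh N 0) (torus_flux t (v t) phi)) /\
      (forall psi, periodic_dual_space k N psi ->
         int_cube (fun x => vt t x * psi x) =
         volume_terms tau t (v t) (u t) psi
         - face_sum (torus_mesh N (meshsize N / 2))
                    (torus_flux t (u t) psi))].

Definition inflow (i : 'I_d) : R :=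
  if `[< forall t x, t \in `[0, T] -> cube R d x -> 0 < A t x ord0 i >]
  then 0 else 1.

Variable g : 'I_d -> R -> 'rV[R]_d.-1 -> R.

Definition boundary_flux (t : R) w phi (i : 'I_d) (s : R)
    (y : 'rV[R]_d.-1) : R :=
  let x := insx i s y in
  if s == 0 then
    (if s == inflow i then g i t y else trace_hi i w x)
    * dotv (A t x) (trace_hi i phi x *: - dirv i)
  else if s == 1 then
    (if s == inflow i then g i t y else trace_lo i w x)
    * dotv (A t x) (trace_lo i phi x *: dirv i)
  else w x * dotv (A t x) (jump i phi x).

Definition nonperiodic_solution (k N : nat) (tau : R)
    (u v : R -> 'rV[R]_d -> R) : Prop :=
  (forall t, t \in `[0, T] ->
     primal_space k N (u t) /\ dual_space k N (v t)) /\
  exists ut vt, [/\ C1_in_time u ut, C1_in_time v vt &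
    forall t, t \in `[0, T] ->
      (forall phi, primal_space k N phi ->
         int_cube (fun x => ut t x * phi x) =
         volume_terms tau t (u t) (v t) phi
         - face_sum (interval_mesh (ugrid N 0 1))
                    (boundary_flux t (v t) phi)) /\
      (forall psi, dual_space k N psi ->
         int_cube (fun x => vt t x * psi x) =
         volume_terms tau t (v t) (u t) psi
         - face_sum (interval_mesh (dgrid N N))
                    (boundary_flux t (u t) psi))].

Definition square_integrable_data : Prop :=
  forall i,
    let D := [set` `[0, T]] `*` cube R d.-1 in
    measurable_fun D (fun z : measurableTypeR R * 'rV[R]_d.-1 =>
      g i z.1 z.2 : measurableTypeR R) /\
    (lebesgue_measure \x lebesgue_rV R d.-1)%E.-integrable D
      (fun z => (g i z.1 z.2 ^+ 2)%:E).

Definition data_norm : R :=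
  (\int[lebesgue_measure]_(t in `[0%R, T]) \sum_(i < d)
     (\int[lebesgue_rV R d.-1]_(y in cube R d.-1)
        (`|A t (insx i (inflow i) y) ord0 i| * g i t y ^+ 2))%R)%R.

End schemes.

Section field.
Context {R : realType}.

Fixpoint Cn_on {V W : normedModType R} (U : set V) (n : nat) (f : V -> W) :
    Prop :=
  match n with
  | 0 => forall z, U z -> {for z, continuous f}
  | n'.+1 => (forall z, U z ->
                {for z, continuous f} /\ forall v, derivable f z v) /\
             forall v, Cn_on U n' ('D_v f)
  end.

Context {d : nat}.
Variables (T : R) (A : R -> 'rV[R]_d -> 'rV[R]_d).

(** Smoothness on a closed set: on some open neighbourhood of it. The values
    of [A] away from [0, T] x Omega are never used. *)
Definition smooth_field : Prop :=
  exists2 U : set (R * 'rV[R]_d),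
    open U /\ (forall t x, t \in `[0, T] -> cube R d x -> U (t, x)) &
    forall n, Cn_on U n (fun z => A z.1 z.2).

Definition divergence (t : R) (x : 'rV[R]_d) : R :=
  \sum_(i < d) 'D_(dirv i) (fun y => A t y ord0 i) x.

Definition absvals (f : R -> 'rV[R]_d -> R) : set R :=
  [set r | exists t x, [/\ t \in `[0, T], cube R d x & r = `|f t x|]].

(** [A] is continuous and T > 0, so the supremum is the essential supremum. *)
Definition norm1 : R := \sum_(i < d) sup (absvals (fun t x => A t x ord0 i)).

(** Equal values on opposite faces: exactly what makes the 1-periodic extension
    of a field on the closed cube well defined. *)
Definition periodic_field : Prop :=
  forall t i y, t \in `[0, T] -> cube R d.-1 y ->
    A t (insx i 0 y) = A t (insx i 1 y).

End field.

(* Main.v *)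
Require Import Defs.
From mathcomp Require Import all_boot all_order all_algebra.
From mathcomp Require Import all_classical all_reals all_analysis.
From mathcomp Require Import measurable_realfun ring lra zify.
Import Order.TTheory GRing.Theory Num.Theory.
Import numFieldNormedType.Exports.
Local Open Scope classical_set_scope.
Local Open Scope ring_scope.

(** Energy method.  Testing with [phi = u] and [psi = v], everything reduces to
    one-dimensional integrations by parts along the coordinate lines.  Put the
    primal and dual meshes together into the mesh of side [h_N / 2]: a primal
    function is continuous across its odd nodes, a dual one across its even
    nodes, so the product [A_i u v] jumps exactly as prescribed by the two
    central fluxes.  The volume and face terms telescope, leaving
    [- int (d_i A_i) u v], the penalty [- |u - v|^2 / tau_max], and, in the
    non-periodic case, boundary terms.  The latter are bounded by the inflow
    data plus [|A_i| (u - v)^2 / 2] on the two faces [x_i = 0, 1]; an inverse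
    trace inequality on the cells of side [h_N / 2] absorbs them into the
    penalty as soon as [tau_max <= c h_N / |A|_1].  Gronwall's lemma concludes.
    The inflow data are only square integrable, hence the energy inequality is
    only available for almost every [t]. *)

(** Each equation is tested with its own unknown, so what the argument extracts from the sparse
    spaces is regularity: each space is embedded in a span of tensor products of one-dimensional
    functions that are polynomial on cells of side h_N/2 and left continuous at the odd, or at the
    even, nodes. These conditions are linear, hence they survive restriction to a line parallel to
    an axis, where all other factors are constants. Two difficulties lie beside this main line. The
    unknowns are differentiable in time only pointwise in x; since the spaces are finite
    dimensional, values at finitely many well-chosen points serve as coordinates, and the L^2 norms
    become quadratic forms in these values. Row vectors carry the sigma-algebra generated by the
    coordinates; traces and gradients are measurable for it because on each line they reduce to
    finite sums of products, and the smooth field because it is a limit of its values at dyadic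
    points. *)

Set Implicit Arguments.
Unset Strict Implicit.
Unset Printing Implicit Defensive.

(** * Bounded measurable functions *)

Section bounded_measurable.
Context d (X : measurableType d) (R : realType).
Implicit Types (D : set X) (f g : X -> R).

(** Bounded measurable functions form an algebra and are integrable on sets of finite measure. This
    one predicate discharges nearly all integrability conditions; only the inflow data fall outside
    it. *)
Definition bmf D f :=
  measurable_fun D f /\ exists M : R, forall x, D x -> `|f x| <= M.

Lemma bmf_cst D c : bmf D (fun=> c).
Proof. by split; [exact: measurable_cst|exists `|c|]. Qed.

Lemma bmfD D f g : bmf D f -> bmf D g -> bmf D (fun x => f x + g x).
Proof.
move=> [mf [M fM]] [mg [L gL]]; split; first exact: measurable_funD.
by exists (M + L) => x Dx; rewrite (le_trans (ler_normD _ _))// lerD ?fM ?gL.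
Qed.

Lemma bmfM D f g : bmf D f -> bmf D g -> bmf D (fun x => f x * g x).
Proof.
move=> [mf [M fM]] [mg [L gL]]; split; first exact: measurable_funM.
by exists (M * L) => x Dx; rewrite normrM ler_pM ?fM ?gL.
Qed.

Lemma bmfZ D c f : bmf D f -> bmf D (fun x => c * f x).
Proof. by apply: bmfM; exact: bmf_cst. Qed.

Lemma bmfN D f : bmf D f -> bmf D (fun x => - f x).
Proof.
by move=> /(bmfZ (-1)); congr bmf; apply/funext => x; rewrite mulN1r.
Qed.

Lemma bmfB D f g : bmf D f -> bmf D g -> bmf D (fun x => f x - g x).
Proof. by move=> mf /bmfN; exact: bmfD. Qed.

Lemma eq_bmf D f g : (forall x, D x -> f x = g x) -> bmf D f -> bmf D g.
Proof.
move=> fg [mf [M fM]]; split.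
  by apply: eq_measurable_fun mf => x /set_mem/fg.
by exists M => x Dx; rewrite -fg ?fM.
Qed.

Lemma bmfX D f n : bmf D f -> bmf D (fun x => f x ^+ n).
Proof.
move=> mf; elim: n => [|n IHn]; first exact: bmf_cst.
by apply: eq_bmf (bmfM mf IHn) => x _; rewrite exprS.
Qed.

Lemma bmf_sum D I (s : seq I) (P : pred I) (F : I -> X -> R) :
  (forall i, P i -> bmf D (F i)) -> bmf D (fun x => \sum_(i <- s | P i) F i x).
Proof.
move=> mF; elim: s => [|i s IHs].
  by apply: eq_bmf (bmf_cst D 0) => x _; rewrite big_nil.
case: (boolP (P i)) => Pi.
  by apply: eq_bmf (bmfD (mF _ Pi) IHs) => x _; rewrite big_cons Pi.
by apply: eq_bmf IHs => x _; rewrite big_cons (negbTE Pi).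
Qed.

Lemma bmf_prod D I (s : seq I) (P : pred I) (F : I -> X -> R) :
  (forall i, P i -> bmf D (F i)) -> bmf D (fun x => \prod_(i <- s | P i) F i x).
Proof.
move=> mF; elim: s => [|i s IHs].
  by apply: eq_bmf (bmf_cst D 1) => x _; rewrite big_nil.
case: (boolP (P i)) => Pi.
  by apply: eq_bmf (bmfM (mF _ Pi) IHs) => x _; rewrite big_cons Pi.
by apply: eq_bmf IHs => x _; rewrite big_cons (negbTE Pi).
Qed.

Lemma bmf_integrable (mu : {measure set X -> \bar R}) D f : measurable D ->
  (mu D < +oo)%E -> bmf D f -> mu.-integrable D (EFin \o f).
Proof.
move=> mD muD [mf [M fM]]; apply: measurable_bounded_integrable => //.
exists M; split; first exact: num_real.
by move=> y My x /fM /le_trans; apply; exact: ltW.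
Qed.

Lemma Rintegral_sum (mu : {measure set X -> \bar R}) D I (s : seq I) (P : pred I)
    (F : I -> X -> R) : measurable D ->
  (forall i, P i -> mu.-integrable D (EFin \o F i)) ->
  \int[mu]_(x in D) (\sum_(i <- s | P i) F i x) =
  \sum_(i <- s | P i) \int[mu]_(x in D) F i x.
Proof.
move=> mD mF; elim: s => [|i s IHs].
  rewrite big_nil; under eq_Rintegral do rewrite big_nil.
  by rewrite Rintegral_cst// mul0r.
rewrite big_cons; under eq_Rintegral do rewrite big_cons.
case: ifPn => // Pi; rewrite RintegralD ?IHs ?mF//.
have -> : EFin \o (fun x => \sum_(i <- s | P i) F i x) =
    (fun x => \sum_(i <- s | P i) (F i x)%:E)%E.
  by apply/funext => x /=; rewrite sumEFin.
exact: integrable_sum.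
Qed.

Lemma ae_eq_Rintegral (mu : {measure set X -> \bar R}) D f g : measurable D ->
  measurable_fun D f -> measurable_fun D g ->
  {ae mu, forall x, D x -> f x = g x} ->
  \int[mu]_(x in D) f x = \int[mu]_(x in D) g x.
Proof.
move=> mD mf mg fg; congr fine; apply: ae_eq_integral => //.
- exact/measurable_EFinP.
- exact/measurable_EFinP.
- by apply: filterS fg => x /[apply] ->.
Qed.

End bounded_measurable.

Lemma bmf_comp d1 d2 (X : measurableType d1) (Y : measurableType d2)
    (R : realType) (D : set X) (E : set Y) (f : Y -> R) (h : X -> Y) :
  measurable E -> measurable_fun D h -> (forall x, D x -> E (h x)) ->
  bmf E f -> bmf D (fun x => f (h x)).
Proof.
move=> mE mh hDE [mf [M fM]]; split.
  by apply: (measurable_comp mE _ mf mh) => _ [x /hDE + <-].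
by exists M => x /hDE; exact: fM.
Qed.

(** * Lebesgue measure on row vectors *)

Section lebesgue_rV_theory.
Context {R : realType}.
Local Notation mR := (measurableTypeR R).

Lemma insxE_same (U : Type) n (i : 'I_n) (s : U) (y : 'rV[U]_n.-1) :
  insx i s y ord0 i = s.
Proof. by rewrite mxE unlift_none. Qed.

Lemma insxE_lift (U : Type) n (i : 'I_n) (s : U) (y : 'rV[U]_n.-1) m :
  insx i s y ord0 (lift i m) = y ord0 m.
Proof. by rewrite mxE liftK. Qed.

Lemma insxP (U : Type) n (i : 'I_n) (x : 'rV[U]_n) :
  insx i (x ord0 i) (\row_m x ord0 (lift i m)) = x.
Proof.
by apply/rowP => j; rewrite mxE; case: unliftP => [m|] -> //=; rewrite mxE.
Qed.

Lemma lift_lift0 n (i : 'I_n.+1) (m : 'I_n) :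
  lift (lift ord0 i) (lift ord0 m) = lift ord0 (lift i m).
Proof. by apply/val_inj => /=; rewrite /bump /= !add1n !ltnS; case: leqP. Qed.

Lemma insx_consx n (i : 'I_n.+1) (a s : R) (y : 'rV[R]_n) :
  insx (lift ord0 i) s (consx (a, y)) = consx (a, insx (n := n.+1) i s y).
Proof.
apply/rowP => j; case: (unliftP (lift ord0 i) j) => [m|] ->; last first.
  by rewrite insxE_same insxE_lift insxE_same.
rewrite insxE_lift; case: (unliftP ord0 m) => [m'|] ->; last first.
  rewrite insxE_same (_ : lift _ _ = ord0) ?insxE_same//.
  by apply/val_inj.
by rewrite insxE_lift /= lift_lift0 insxE_lift insxE_lift.
Qed.

Lemma measurable_insx n (i : 'I_n.+1) :
  measurable_fun setT (fun p : mR * 'rV[R]_n => insx (n := n.+1) i p.1 p.2).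
Proof.
apply: measurable_rVP => j; case: (unliftP i j) => [m|] ->.
  rewrite (_ : (fun _ => _) = (fun x : 'rV[R]_n => x ord0 m) \o snd).
    exact: (measurableT_comp (measurable_coord m) measurable_snd).
  by apply/funext => p /=; rewrite insxE_lift.
rewrite (_ : (fun _ => _) = fst); first exact: measurable_fst.
by apply/funext => p /=; rewrite insxE_same.
Qed.

Lemma lebesgue_rV_consx n (X : set 'rV[R]_n.+1) :
  lebesgue_rV R n.+1 X =
  (\int[lebesgue_measure]_a
     lebesgue_rV R n [set y | X (consx (a : mR, y))])%E.
Proof.
rewrite -[LHS]/(\int[lebesgue_measure]_a
  lebesgue_rV R n (xsection (@consx R n @^-1` X) a))%E.
apply: eq_integral => a _; congr (lebesgue_rV R n _).
by apply/seteqP; split => y; rewrite /xsection /= inE.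
Qed.

Lemma product_lebesgue_rV n (X : set (mR * 'rV[R]_n)) :
  (lebesgue_measure \x lebesgue_rV R n)%E X =
  (\int[lebesgue_measure]_a lebesgue_rV R n [set y | X (a, y)])%E.
Proof.
rewrite -[LHS]/(\int[lebesgue_measure]_a lebesgue_rV R n (xsection X a))%E.
apply: eq_integral => a _; congr (lebesgue_rV R n _).
by apply/seteqP; split => y; rewrite /xsection /= inE.
Qed.

(* The iterated product measure does not depend on which coordinate is
   integrated first. *)
Lemma lebesgue_rV_insx n (i : 'I_n.+1) (X : set 'rV[R]_n.+1) : measurable X ->
  lebesgue_rV R n.+1 X =
  (lebesgue_measure \x lebesgue_rV R n)%E
    [set p : mR * 'rV[R]_n | X (insx (n := n.+1) i p.1 p.2)].
Proof.
elim: n i X => [|n IHn] i X mX.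
  by rewrite (ord1 i) lebesgue_rV_consx product_lebesgue_rV.
case: (unliftP ord0 i) => [i'|] ->; last first.
  by rewrite lebesgue_rV_consx product_lebesgue_rV.
rewrite lebesgue_rV_consx product_lebesgue_rV.
(* The first coordinate [a] and the inserted coordinate [s] must change places. Tonelli is applied
   to the measure of the slices in the remaining [n] variables, as a function of the pair (a, s). *)
pose h (q : mR * mR * 'rV[R]_n) : 'rV[R]_n.+2 :=
  insx (lift ord0 i') q.1.2 (consx (q.1.1, q.2)).
have mh : measurable_fun setT h.
  apply: (measurableT_comp (measurable_insx (lift ord0 i'))
    (g := fun q : mR * mR * 'rV[R]_n => (q.1.2, consx (q.1.1, q.2)))).
  apply: measurable_fun_pair.
    exact: (measurableT_comp measurable_snd measurable_fst).
  apply: (measurableT_comp (measurable_consx (R := R) (n := n))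
    (g := fun q : mR * mR * 'rV[R]_n => (q.1.1, q.2))).
  apply: measurable_fun_pair; last exact: measurable_snd.
  exact: (measurableT_comp measurable_fst measurable_fst).
have mZ : measurable (h @^-1` X) by rewrite -[X in measurable X]setTI; exact: mh.
have mphi := measurable_fun_xsection (lebesgue_rV R n) mZ.
pose phi := (lebesgue_rV R n \o xsection (h @^-1` X)).
have phiE a s : phi (a, s) = lebesgue_rV R n [set y | X (h (a, s, y))].
  rewrite /phi /=; congr (lebesgue_rV R n _).
  by apply/seteqP; split => y; rewrite /xsection /= inE.
have := fubini_tonelli (m1 := @lebesgue_measure R) (m2 := @lebesgue_measure R)
  phi mphi (fun=> measure_ge0 _ _).
rewrite /fubini_F /fubini_G => H.
transitivity (\int[@lebesgue_measure R]_x \int[@lebesgue_measure R]_y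
  phi (x, y))%E.
  apply: eq_integral => a _.
  rewrite (IHn i'); last first.
    pose g (z : 'rV[R]_n.+1) : 'rV[R]_n.+2 := consx (a : mR, z).
    have mg : measurable_fun setT g.
      apply: (measurableT_comp (measurable_consx (R := R) (n := n.+1))
        (g := fun z : 'rV[R]_n.+1 => (a : mR, z))).
      by apply: measurable_fun_pair; [exact: measurable_cst|exact: measurable_id].
    by rewrite -[X in measurable X]setTI; exact: mg.
  rewrite product_lebesgue_rV; apply: eq_integral => s _.
  rewrite phiE; congr (lebesgue_rV R n _).
  by apply/funext => y; rewrite /mkset /h /= insx_consx.
rewrite H; apply: eq_integral => s _.
rewrite lebesgue_rV_consx; apply: eq_integral => a _.
by rewrite phiE.
Qed.

Lemma cubeE n (i : 'I_n.+1) s (y : 'rV[R]_n) :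
  cube R n.+1 (insx i s y) <-> `[0, 1]%classic s /\ cube R n y.
Proof.
rewrite /cube /=; split => [H|[Hs Hy] j].
  split; first by have := H i; rewrite insxE_same in_itv.
  by move=> m; have := H (lift i m); rewrite insxE_lift.
case: (unliftP i j) => [m|] ->; first by rewrite insxE_lift.
by rewrite insxE_same; move: Hs; rewrite in_itv.
Qed.

Lemma measurable_cube n : measurable (cube R n).
Proof.
rewrite (_ : cube R n = \bigcap_(i in [set: 'I_n])
   ((fun x : 'rV[R]_n => x ord0 i) @^-1` `[0, 1])); last first.
  by apply/seteqP; split => x /= H i; have := H i; rewrite /= in_itv//=; exact.
apply: fin_bigcap_measurable => // i _.
by rewrite -[X in measurable X]setTI; apply: (measurable_coord i).
Qed.

Lemma lebesgue_cube n : lebesgue_rV R n (cube R n) = 1%E.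
Proof.
elim: n => [|n IHn].
  by rewrite /= diracE mem_set//= => -[].
rewrite (lebesgue_rV_insx ord0); last exact: measurable_cube.
rewrite (_ : [set p | _] = `[0, 1]%classic `*` cube R n); last first.
  by apply/seteqP; split => p /= /cubeE.
rewrite product_measure1E//; last exact: measurable_cube.
rewrite IHn mule1; have := lebesgue_measure_itv (R := R) `[0, 1].
by rewrite /= lte01 oppr0 adde0 => <-.
Qed.

Lemma lebesgue_cube_lty n : (lebesgue_rV R n (cube R n) < +oo)%E.
Proof. by rewrite lebesgue_cube ltry. Qed.

End lebesgue_rV_theory.

(** * Fubini for real-valued integrals over rectangles *)

Section fubini_rectangle.
Context d1 d2 (X : measurableType d1) (Y : measurableType d2) (R : realType).

(** An integrable function is finite almost everywhere, so [fine] changes it only on a null set.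
    Partial integrals are of this kind: they may be infinite on a null set of sections. *)
Lemma Rintegral_fine d (Z : measurableType d) (mu : {measure set Z -> \bar R})
    (D : set Z) (F : Z -> \bar R) : measurable D -> mu.-integrable D F ->
  mu.-integrable D (EFin \o (fine \o F)) /\
  \int[mu]_(x in D) fine (F x) = fine (\int[mu]_(x in D) F x)%E.
Proof.
move=> mD iF; have mF := measurable_int mu iF.
have mfF : measurable_fun D (EFin \o (fine \o F)).
  by apply/measurable_EFinP; exact: (measurableT_comp (fine_measurable measurableT)).
split.
  apply: le_integrable mfF _ iF => // x _ /=.
  by case: (F x) => [r| |] //=; rewrite normr0 ?leey.
congr fine; apply: ae_eq_integral => //.
by apply: filterS (integrable_ae mD iF) => x /[apply] /= ?; rewrite fineK.
Qed.

Variables (m1 : {sigma_finite_measure set X -> \bar R}).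
Variables (m2 : {sigma_finite_measure set Y -> \bar R}).

Lemma integrable_fubini_G (g : X * Y -> \bar R) :
  (m1 \x m2)%E.-integrable setT g -> m2.-integrable setT (fubini_G m1 g).
Proof.
move=> ig; have mg := measurable_int _ ig; apply/integrableP; split.
  exact: measurable_fubini_G ig.
apply: le_lt_trans ((integrable21ltyP m1 m2 mg).1 ig).
have mag : measurable_fun setT (abse \o g) by exact: measurableT_comp.
apply: ge0_le_integral => //.
- by apply: measurableT_comp => //; apply: measurable_fubini_G ig.
- by apply: (measurable_fun_fubini_tonelli_G (abse \o g)) => // x; exact: abse_ge0.
- move=> y _; apply: le_abse_integral => //.
  exact: (measurableT_comp mg (pair2_measurable y)).
Qed.

Variables (D1 : set X) (D2 : set Y) (f : X * Y -> R).
Hypotheses (mD1 : measurable D1) (mD2 : measurable D2).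
Hypothesis intf : (m1 \x m2)%E.-integrable (D1 `*` D2) (EFin \o f).

(** Extension by zero, so that Fubini on the whole product space applies to the rectangle. *)
Let g : X * Y -> \bar R := (EFin \o f) \_ (D1 `*` D2).
Let ig : (m1 \x m2)%E.-integrable setT g.
Proof. by apply/(integrable_mkcond (EFin \o f)) => //; exact: measurableX. Qed.

Lemma Rintegrable_fubini1 :
  m1.-integrable D1 (fun x => (\int[m2]_(y in D2) f (x, y))%:E).
Proof.
have iF := integrableS measurableT mD1 (@subsetT _ _) (integrable_fubini_F ig).
apply: eq_integrable (Rintegral_fine mD1 iF).1 => // x /set_mem Dx.
rewrite /= /Rintegral /fubini_F [in RHS]integral_mkcond; do 2 congr (_ _).
apply: eq_integral => y _; rewrite /g !patchE in_setX.
by rewrite (mem_set Dx).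
Qed.

Lemma ae_integrable_fubini1 :
  {ae m1, forall x, D1 x -> m2.-integrable D2 (fun y => (f (x, y))%:E)}.
Proof.
apply: filterS (ae_integrable1 ig) => x ix Dx.
have := integrableS measurableT mD2 (@subsetT _ _) ix.
by apply: eq_integrable => // y Dy; rewrite /g patchE in_setX (mem_set Dx) Dy.
Qed.

Lemma Rintegrable_fubini2 :
  m2.-integrable D2 (fun y => (\int[m1]_(x in D1) f (x, y))%:E).
Proof.
have iF := integrableS measurableT mD2 (@subsetT _ _) (integrable_fubini_G ig).
apply: eq_integrable (Rintegral_fine mD2 iF).1 => // y /set_mem Dy.
rewrite /= /Rintegral /fubini_G [in RHS]integral_mkcond; do 2 congr (_ _).
apply: eq_integral => x _; rewrite /g !patchE in_setX.
by rewrite (mem_set Dy) andbT.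
Qed.

Lemma Rintegral_fubini2 :
  \int[m2]_(y in D2) \int[m1]_(x in D1) f (x, y) =
  \int[(m1 \x m2)%E]_(z in D1 `*` D2) f z.
Proof.
have iT := integrable_fubini_G ig.
have iF := integrableS measurableT mD2 (@subsetT _ _) iT.
rewrite [RHS]/Rintegral integral_mkcond -[in RHS]integral21_prod_meas1//.
transitivity (\int[m2]_(y in D2) fine (fubini_G m1 g y)).
  apply: eq_Rintegral => y Dy.
  rewrite /Rintegral /fubini_G [in LHS]integral_mkcond; congr fine.
  by apply: eq_integral => x _; rewrite /g !patchE in_setX Dy andbT.
rewrite (Rintegral_fine mD2 iF).2; congr fine.
rewrite integral_mkcond; apply: eq_integral => y _; rewrite patchE.
case: ifPn => // Dy; rewrite /fubini_G integral0_eq// => x _.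
by rewrite /g patchE in_setX (negbTE Dy) andbF.
Qed.

End fubini_rectangle.

Section fubini_cube.
Context {R : realType} (n : nat).
Local Notation mR := (measurableTypeR R).
Implicit Types (i : 'I_n.+1) (f : 'rV[R]_n.+1 -> R).

Let slab : set (mR * 'rV[R]_n) := `[0, 1]%classic `*` cube R n.

Let mslab : measurable slab.
Proof. by apply: measurableX => //; exact: measurable_cube. Qed.

Lemma bmf_insx i f : bmf (cube R n.+1) f ->
  bmf slab (fun p => f (insx (n := n.+1) i p.1 p.2)).
Proof.
apply: bmf_comp; first exact: measurable_cube.
  exact: measurable_funTS (measurable_insx i).
by move=> p Dp; apply/cubeE.
Qed.

Let slab_lty : ((lebesgue_measure \x lebesgue_rV R n) slab < +oo)%E.
Proof.
rewrite product_measure1E//; last exact: measurable_cube.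
rewrite [X in (_ * X)%E](lebesgue_cube n) mule1.
have := lebesgue_measure_itv (R := R) `[0, 1].
by rewrite /= lte01 oppr0 adde0 => H; rewrite (le_lt_trans _ (ltry 1))// -[leRHS]H.
Qed.

Let int_slab i f : bmf (cube R n.+1) f ->
  (lebesgue_measure \x lebesgue_rV R n)%E.-integrable slab
    (EFin \o (fun p => f (insx (n := n.+1) i p.1 p.2))).
Proof. by move=> /(bmf_insx i) bf; exact: bmf_integrable. Qed.

Lemma Rintegrable_cube_insx i f : bmf (cube R n.+1) f ->
  (lebesgue_rV R n).-integrable (cube R n)
    (fun y => (\int[lebesgue_measure]_(s in `[0%R, 1%R]) f (insx i s y))%:E).
Proof.
move=> /(int_slab i) /Rintegrable_fubini2; apply => //.
exact: measurable_cube.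
Qed.

(** Lebesgue measure is the image of the product measure under insertion at any coordinate, so every
    direction can be made the inner one. Volume integrals thereby reduce to integrals along
    lines. *)
Lemma Rintegral_cube_insx i f : bmf (cube R n.+1) f ->
  int_cube f =
  \int[lebesgue_rV R n]_(y in cube R n)
    \int[lebesgue_measure]_(s in `[0%R, 1%R]) f (insx i s y).
Proof.
move=> bf; have mC := @measurable_cube R n.
rewrite (Rintegral_fubini2 _ _ (int_slab i bf))//.
rewrite /int_cube /Rintegral; congr fine.
pose phi (p : mR * 'rV[R]_n) : 'rV[R]_n.+1 := insx (n := n.+1) i p.1 p.2.
have mphi : measurable_fun setT phi by exact: measurable_insx.
rewrite (eq_measure_integral (pushforward (lebesgue_measure \x lebesgue_rV R n)%E
   phi)); last first.
  by move=> X mX _; exact: (lebesgue_rV_insx i mX).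
have slabE : phi @^-1` (cube R n.+1) = slab.
  by apply/seteqP; split => p Hp; exact/(cubeE i p.1 p.2).
rewrite integral_mkcond.
have mg : measurable_fun setT ((fun x => (f x)%:E) \_ (cube R n.+1)).
  apply: (measurable_restrictT (EFin \o f) (@measurable_cube R n.+1)).1.
  by apply/measurable_EFinP; case: bf.
rewrite integral_pushforward//; last first.
  rewrite preimage_setT; have := (integrable_mkcond _ mslab).1 (int_slab i bf).
  congr (_.-integrable _ _).
  by apply/funext => p /=; rewrite !patchE -slabE.
rewrite preimage_setT [in RHS]integral_mkcond; apply: eq_integral => p _ /=.
by rewrite !patchE -/slab -slabE.
Qed.

End fubini_cube.

(** * Face sums *)

Section face_integrals.
Context {R : realType}.
Local Notation mR := (measurableTypeR R).

Lemma measurable_coord_preimage n (i : 'I_n) (E : set R) : measurable E ->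
  measurable [set y : 'rV[R]_n | E (y ord0 i)].
Proof.
by move=> mE; rewrite -[X in measurable X]setTI; exact: (measurable_coord i).
Qed.

Lemma lebesgue_hyperplane n (i : 'I_n.+1) (s : R) :
  lebesgue_rV R n.+1 [set y : 'rV[R]_n.+1 | y ord0 i = s] = 0%E.
Proof.
rewrite (lebesgue_rV_insx i); last first.
  exact: (measurable_coord_preimage i (measurable_set1 s)).
rewrite (_ : [set p | _] = [set s] `*` setT); last first.
  by apply/seteqP; split => p /=; rewrite insxE_same; tauto.
rewrite product_measure1E//.
rewrite (_ : (_ [set s]) = 0%E) ?mul0e//; exact: (lebesgue_measure_set1 s).
Qed.

Lemma ae_off_hyperplanes n (B : seq R) :
  {ae lebesgue_rV R n, forall y : 'rV[R]_n, forall m, y ord0 m \notin B}.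
Proof.
apply: filter_forall => m; elim: B => [|b B IHB].
  by apply: filterE => y; rewrite in_nil.
have Hb : {ae lebesgue_rV R n, forall y : 'rV[R]_n, y ord0 m != b}.
  case: n m {IHB} => [|n] m; first by case: m.
  exists [set y : 'rV[R]_n.+1 | y ord0 m = b]; split.
  - exact: (measurable_coord_preimage m (measurable_set1 b)).
  - exact: lebesgue_hyperplane.
  - by move=> y /= /negP; rewrite negbK => /eqP.
apply: filterS2 IHB Hb => y yB yb.
by rewrite inE negb_or yb yB.
Qed.

(** One notion for the closed cells of an interval, which overlap at the mesh points, and for the
    half-open cells of the circle, which miss the endpoint 1. [B] lists the coordinates where the
    indicators may fail to add up to 1. *)
Definition unit_cells (cl : seq (set R)) (B : seq R) :=
  [/\ forall j, measurable (nth set0 cl j : set mR),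
      forall j, nth set0 cl j `<=` `[0, 1]%classic &
      forall x, 0 <= x <= 1 -> x \notin B ->
        \sum_(j < size cl) \1_(nth set0 cl j) x = 1 :> R].

(** Expanding the product over the coordinates of the sums of indicators yields the sum of the
    indicators of all product cells. It equals 1 off finitely many hyperplanes, which are null
    sets. *)
Lemma sum_cells n (cl : seq (set R)) (B : seq R) (F : 'rV[R]_n -> R) :
  unit_cells cl B -> (lebesgue_rV R n).-integrable (cube R n) (EFin \o F) ->
  \sum_(c : {ffun 'I_n -> 'I_(size cl)})
    \int[lebesgue_rV R n]_(y in
       [set y | forall m, nth set0 cl (c m) (y ord0 m)]) F y =
  \int[lebesgue_rV R n]_(y in cube R n) F y.
Proof.
move=> [mcl cl01 clP] iF.
pose E (c : {ffun 'I_n -> 'I_(size cl)}) :=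
  [set y : 'rV[R]_n | forall m, nth set0 cl (c m) (y ord0 m)].
have mC := @measurable_cube R n.
have mE c : measurable (E c).
  rewrite (_ : E c = \bigcap_(m in [set: 'I_n])
    [set y : 'rV[R]_n | nth set0 cl (c m) (y ord0 m)]); last first.
    by apply/seteqP; split => y /= H m; [move=> _|]; exact: H.
  by apply: fin_bigcap_measurable => // m _; exact: (measurable_coord_preimage m (mcl (c m))).
have EC c : cube R n `&` E c = E c.
  apply/setIidPr => y Ey m; have := cl01 _ _ (Ey m).
  by rewrite /= in_itv.
have iE c : (lebesgue_rV R n).-integrable (cube R n) (EFin \o (F \_ (E c))).
  rewrite -restrict_EFin; apply/integrable_restrict => //.
  by apply: integrableS iF => //; exact: measurableI.
transitivity (\sum_c \int[lebesgue_rV R n]_(y in cube R n) (F \_ (E c)) y).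
  by apply: eq_bigr => c _; rewrite -Rintegral_mkcondr EC.
rewrite -Rintegral_sum//; apply: ae_eq_Rintegral => //.
- apply: measurable_sum => c.
  by apply/measurable_EFinP; exact: measurable_int (iE c).
- by apply/measurable_EFinP; exact: measurable_int iF.
apply: filterS (ae_off_hyperplanes n B) => y yB Cy.
have -> : \sum_c (F \_ (E c)) y =
    F y * \sum_(c : {ffun 'I_n -> 'I_(size cl)})
       \prod_m \1_(nth set0 cl (c m)) (y ord0 m).
  rewrite mulr_sumr; apply: eq_bigr => c _; rewrite patchE.
  case: ifPn => [/set_mem Ey|Ey].
    by rewrite big1 ?mulr1// => m _; rewrite indicE mem_set//; exact: Ey.
  rewrite (_ : \prod_m _ = 0) ?mulr0//; apply/eqP/prodf_eq0.
  have /existsNP[m Hm] : ~ E c y by apply: contraNnot Ey => Ey; exact: mem_set.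
  by exists m => //; rewrite indicE memNset.
rewrite -(bigA_distr_bigA (fun m (j : 'I_(size cl)) =>
   \1_(nth set0 cl j) (y ord0 m))).
by rewrite big1 ?mulr1// => m _; apply: clP => //; exact: yB.
Qed.

Lemma face_sumE n (M : @mesh1d R) (B : seq R)
    (F : 'I_n.+1 -> R -> 'rV[R]_n -> R) :
  unit_cells (cells M) B ->
  (forall i s, s \in planes M ->
     (lebesgue_rV R n).-integrable (cube R n) (EFin \o F i s)) ->
  @face_sum R n.+1 M F = \sum_(i < n.+1) \sum_(s <- planes M)
    \int[lebesgue_rV R n]_(y in cube R n) F i s y.
Proof.
move=> clB iF; apply: eq_bigr => i _; apply: eq_big_seq => s sM.
by rewrite -(sum_cells clB)//; exact: iF.
Qed.

(** By monotonicity each summand is a difference of the indicators of two half-lines, and the sum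
    telescopes. *)
Lemma sum_itv_indicator (a : nat -> R) (K : nat) x :
  (forall j, (j < K)%N -> a j <= a j.+1) ->
  \sum_(j < K) ((a j <= x < a j.+1)%R%:R : R) = (a 0 <= x)%R%:R - (a K <= x)%R%:R.
Proof.
elim: K => [|K IHK] aS; first by rewrite big_ord0 subrr.
rewrite big_ord_recr /= IHK; last by move=> j jK; apply: aS; exact: ltnW.
rewrite ltNge; case: (leP (a K) x) => aKx; case: (leP (a K.+1) x) => aKx' /=.
- by rewrite addr0.
- by rewrite subr0 subrK.
- by have := aS _ (ltnSn K); rewrite leNgt (le_lt_trans aKx' aKx).
- by rewrite addr0.
Qed.

Lemma interval_mesh_unit_cells (s : seq R) : (0 < size s)%N ->
  nth 0 s 0 = 0 -> nth 0 s (size s).-1 = 1 ->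
  (forall j, (j.+1 < size s)%N -> nth 0 s j <= nth 0 s j.+1) ->
  unit_cells (cells (interval_mesh s)) s.
Proof.
move=> s0 sa sb sS; have mono j j' : (j <= j' < size s)%N -> nth 0 s j <= nth 0 s j'.
  move=> /andP[]; elim: j' => [|j' IH]; first by rewrite leqn0 => /eqP ->.
  rewrite leq_eqVlt => /predU1P[->//|]; rewrite ltnS => jj' js.
  by rewrite (le_trans (IH jj' (ltnW js)))// sS.
have nthE j : (j < (size s).-1)%N -> nth set0 (cells (interval_mesh s)) j =
    [set` `[nth 0 s j, nth 0 s j.+1]].
  by move=> js; rewrite (nth_map 0%N) ?size_iota// nth_iota.
have szE' : size (cells (interval_mesh s)) = (size s).-1.
  by rewrite /= size_map size_iota.
split.
- move=> j; have [js|js] := ltnP j (size s).-1; first by rewrite nthE.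
  by rewrite nth_default ?szE'.
- move=> j; have [js|js] := ltnP j (size s).-1; last by rewrite nth_default ?szE'.
  rewrite nthE// => x /=; rewrite !in_itv/= => /andP[jx xj].
  have j1 : (j.+1 < size s)%N by rewrite -(prednK s0) ltnS.
  apply/andP; split.
    by rewrite (le_trans _ jx)// -[leLHS]sa mono//; lia.
  by rewrite (le_trans xj)// -[leRHS]sb mono//; lia.
- move=> x /andP[x0 x1] xs.
  have xsP j : (j < size s)%N -> nth 0 s j != x.
    by move=> js; apply: contraNneq xs => <-; exact: mem_nth.
  (* Off the mesh points closed cells may be replaced by half-open ones. *)
  rewrite szE'; transitivity
     (\sum_(j < (size s).-1) ((nth 0 s j <= x < nth 0 s j.+1)%R%:R : R)).
    apply: eq_bigr => j _; rewrite nthE// indicE; congr (_%:R); congr nat_of_bool.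
    apply/idP/idP; rewrite inE /= in_itv /=.
      move=> /andP[-> /=]; rewrite le_eqVlt eq_sym (negbTE (xsP _ _))//.
      by have := ltn_ord j; lia.
    by move=> /andP[-> /ltW].
  rewrite (sum_itv_indicator (a := nth 0 s)); last first.
    by move=> j js; rewrite sS//; lia.
  rewrite sa sb x0 leNgt lt_neqAle x1 andbT eq_sym -[X in X != _]sb xsP ?subr0//.
  by lia.
Qed.

Lemma torus_mesh_unit_cells (N : nat) (a : R) : 0 <= a < 1 ->
  unit_cells (cells (torus_mesh N a)) [:: 1].
Proof.
move=> /andP[a0 a1]; set cl := cells _.
have szE : size cl = (2 ^ N)%N by rewrite /cl /= size_map size_iota.
have nthE j : (j < 2 ^ N)%N -> nth set0 cl j = [set x | 0 <= x < 1 /\ exists m : int,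
   a + j%:R * meshsize N <= x + m%:~R < a + j.+1%:R * meshsize N].
  by move=> jN; rewrite (nth_map 0%N) ?size_iota// nth_iota.
have h0 : 0 < meshsize N :> R by rewrite invr_gt0 exprn_gt0.
have hN : (2 ^ N)%:R * meshsize N = 1 :> R.
  by rewrite natrX divff// expf_neq0.
split.
- move=> j; have [jN|jN] := ltnP j (2 ^ N)%N; last first.
    by rewrite nth_default ?szE.
  rewrite nthE// (_ : [set x | _] = \bigcup_(m : int) (`[0, 1[%classic `&`
     `[a + j%:R * meshsize N - m%:~R, a + j.+1%:R * meshsize N - m%:~R[%classic)).
    apply: countable_bigcupT_measurable; first exact: countableP.
    by move=> m; exact: measurableI.
  apply/seteqP; split => x /=.
    by move=> [x01 [m xm]]; exists m => //=; rewrite !in_itv/= lerBlDr ltrBrDr.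
  by move=> [m _ /=]; rewrite !in_itv/= lerBlDr ltrBrDr => -[? ?]; split => //; exists m.
- move=> j; have [jN|jN] := ltnP j (2 ^ N)%N; last by rewrite nth_default ?szE.
  by rewrite nthE// => x /= [/andP[x0 /ltW x1] _]; rewrite in_itv/= x0.
- move=> x /andP[x0 x1]; rewrite inE => xn1; have {xn1}x1 : x < 1.
    by rewrite lt_neqAle xn1.
  have int_eq (p q : int) : -1 < p - q -> p - q < 1 -> p = q by lia.
  (* The cells, before reduction modulo 1, tile [a, a + 1), so [x] can enter a cell only through its
     unique translate in that interval. *)
  have [m0 /andP[am0 m0a]] : exists m0 : int, a <= x + m0%:~R < a + 1.
    have [ax|xa] := leP a x.
      by exists 0; rewrite addr0 ax/=; lra.
    by exists 1; rewrite (_ : 1%:~R = 1 :> R)// ltrD2r xa andbT; lra.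
  rewrite szE; transitivity (\sum_(j < 2 ^ N)
    ((a + j%:R * meshsize N <= x + m0%:~R < a + j.+1%:R * meshsize N)%R%:R : R)).
    apply: eq_bigr => j _; rewrite nthE// indicE; congr (_%:R); congr nat_of_bool.
    apply/idP/idP; rewrite inE /=; last by move=> H; split; [rewrite x0|exists m0].
    move=> [_ [m /andP[H1 H2]]]; suff -> : m0 = m by rewrite H1.
    have jh : 0 <= j%:R * meshsize N :> R by rewrite mulr_ge0// ltW.
    have jh1 : j.+1%:R * meshsize N <= 1 :> R.
      by rewrite -[leRHS]hN ler_pM2r// ler_nat.
    have : (m0 - m)%:~R < 1%:~R :> R by rewrite intrB; lra.
    have : (- 1)%:~R < (m0 - m)%:~R :> R by rewrite intrB; lra.
    by rewrite !ltr_int; exact: int_eq.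
  rewrite (sum_itv_indicator (a := fun j => a + j%:R * meshsize N)); last first.
    by move=> j _; rewrite lerD2l ler_pM2r// ler_nat.
  by rewrite mul0r addr0 am0 hN leNgt m0a subr0.
Qed.

End face_integrals.

(** Each approximant factors through a countable type with measurable fibres, hence is measurable
    whatever [f] is, and measurability passes to the pointwise limit. This yields measurability of
    continuous functions without relating the sigma-algebra to open sets. *)
Lemma measurable_fun_countable_approx d (X : measurableType d) (R : realType)
    (C : countType) (D : set X) (f : X -> R) (c : nat -> X -> C)
    (e : nat -> C -> X) : measurable D ->
  (forall m a, measurable (c m @^-1` [set a])) ->
  (forall x, D x -> f (e m (c m x)) @[m --> \oo] --> f x) ->
  measurable_fun D f.
Proof.
move=> mD mc cf; apply: measurable_fun_cvg cf => m.
apply: measurable_funTS => _ Y mY; rewrite setTI.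
rewrite (_ : _ @^-1` Y =
    \bigcup_a (c m @^-1` [set a] `&` [set _ | Y (f (e m a))])).
  apply: countable_bigcupT_measurable => // a.
  have [Ya|Ya] := pselect (Y (f (e m a))).
    by rewrite (_ : [set _ | _] = setT) ?setIT//; apply/seteqP; split.
  by rewrite (_ : [set _ | _] = set0) ?setI0//; apply/seteqP; split.
by apply/seteqP; split => [x /= Yx|x [a _ [/= <-]]//]; exists (c m x).
Qed.

(** * Smooth fields *)

Section smooth_components.
Context {R : realType}.
Local Notation mR := (measurableTypeR R).

Lemma dyadic_floor (m : nat) (x : R) :
  x - 2 ^- m < (Num.floor (2 ^+ m * x))%:~R / 2 ^+ m <= x.
Proof.
have p0 : 0 < 2 ^+ m :> R by rewrite exprn_gt0.
have /andP[f1 f2] := floor_itv (2 ^+ m * x).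
rewrite ler_pdivrMr// [x * _]mulrC f1 andbT ltr_pdivlMr// mulrBl mulVf ?gt_eqF//.
by rewrite ltrBlDr mulrC; move: f2; rewrite intrD.
Qed.

Lemma cvg_dyadic_floor (x : R) :
  (Num.floor (2 ^+ m * x))%:~R / 2 ^+ m @[m --> \oo] --> x.
Proof.
have c0 : (fun m => (2^-1 : R) ^+ m) @ \oo --> (0 : R).
  by apply: cvg_expr; rewrite ger0_norm ?invf_lt1 ?ltr1n.
apply: (@squeeze_cvgr _ _ _ _ (fun m => x - 2^-1 ^+ m) (fun=> x)).
- by apply: nearW => m; have /andP[/ltW] := dyadic_floor m x; rewrite exprVn => -> ->.
- by rewrite -[X in _ --> X]subr0; apply: cvgB => //; exact: cvg_cst.
- exact: cvg_cst.
Qed.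

Lemma cvg_rV (n : nat) (F : set_system nat) {FF : Filter F}
    (x : nat -> 'rV[R]_n) (l : 'rV[R]_n) :
  (forall i, x m ord0 i @[m --> F] --> l ord0 i) -> x m @[m --> F] --> l.
Proof.
move=> H; apply/cvg_ballP => e e0.
have : \forall m \near F, forall i, ball (l ord0 i) e (x m ord0 i).
  by apply: filter_forall => i; have /cvg_ballP/(_ e e0) := H i.
by apply: filterS => m Hm; split => // i j; rewrite ord1.
Qed.

Definition spacetime (T : R) n : set (mR * 'rV[R]_n) :=
  `[0, T]%classic `*` cube R n.
Arguments spacetime : clear implicits.

Lemma measurable_spacetime (T : R) n : measurable (spacetime T n).
Proof. by apply: measurableX => //; exact: measurable_cube. Qed.

Lemma continuous_measurable_spacetime (T : R) n (f : R * 'rV[R]_n -> R) :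
  (forall z, spacetime T n z -> {for z, continuous f}) ->
  measurable_fun (spacetime T n) (f : mR * 'rV[R]_n -> R).
Proof.
(* Every coordinate is rounded down to a multiple of 2^-m: [c] records the integer numerators and
   [e] rebuilds the grid point from them. *)
move=> cf; pose fl m (s : R) := Num.floor (2 ^+ m * s).
pose c m (z : mR * 'rV[R]_n) : int * 'rV[int]_n :=
  (fl m z.1, \row_i fl m (z.2 ord0 i)).
pose e m (a : int * 'rV[int]_n) : mR * 'rV[R]_n :=
  (a.1%:~R / 2 ^+ m, \row_i ((a.2 ord0 i)%:~R / 2 ^+ m)).
apply: (@measurable_fun_countable_approx _ _ _ _ _ _ c e).
- exact: measurable_spacetime.
- have mfl m (a : int) : measurable [set s : R | fl m s = a].
    rewrite (_ : mkset _ = `[a%:~R / 2 ^+ m, (a + 1)%:~R / 2 ^+ m[%classic)//.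
    have p0 : 0 < 2 ^+ m :> R by rewrite exprn_gt0.
    apply/seteqP; split => s /=; rewrite in_itv /= ler_pdivrMr// ltr_pdivlMr//.
      by move=> /eqP; rewrite /fl floor_eq ![s * _]mulrC.
    by rewrite ![s * _]mulrC => H; apply/eqP; rewrite /fl floor_eq.
  move=> m [a b]; rewrite (_ : _ @^-1` _ = [set s : R | fl m s = a] `*`
      \bigcap_(i in [set: 'I_n])
        [set x : 'rV[R]_n | fl m (x ord0 i) = b ord0 i]); last first.
    apply/seteqP; split => -[s x] /=; rewrite /c /=.
      by move=> [<- <-]; split => // i _; rewrite mxE.
    move=> [-> H]; congr pair; apply/rowP => i; rewrite mxE; exact: H.
  apply: measurableX; first exact: mfl.
  apply: fin_bigcap_measurable => // i _.
  exact: (measurable_coord_preimage i (mfl m (b ord0 i))).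
- move=> [s x] Dz.
  apply: (@cvg_comp _ _ _ (fun m => e m (c m (s, x)) : R * 'rV[R]_n) f \oo
    (nbhs ((s, x) : R * 'rV[R]_n)) (nbhs (f (s, x))) _ (cf _ Dz)).
  have H : (\row_i ((fl m (x ord0 i))%:~R / 2 ^+ m) : 'rV[R]_n) @[m --> \oo] --> x.
    apply: cvg_rV => i; rewrite [X in X @ _ --> _](_ : _ =
      fun m => (fl m (x ord0 i))%:~R / 2 ^+ m); first exact: cvg_dyadic_floor.
    by apply/funext => m; rewrite mxE.
  apply: cvg_trans (cvg_pair (@cvg_dyadic_floor s) H).
  apply: near_eq_cvg; apply: nearW => m /=.
  by rewrite /e /c /=; congr pair; apply/rowP => i; rewrite !mxE.
Qed.

Lemma continuous_bmf_spacetime (T : R) n (f : R * 'rV[R]_n -> R) :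
  (forall z, spacetime T n z -> {for z, continuous f}) ->
  bmf (spacetime T n) (f : mR * 'rV[R]_n -> R).
Proof.
move=> cf; split; first exact: continuous_measurable_spacetime.
have : compact (f @` (`[0, T]%classic `*` cube R n)).
  apply: continuous_compact.
    by apply: continuous_in_subspaceT => z /set_mem /cf.
  apply: compact_setX; first exact: segment_compact.
  have := @rV_compact R n (fun=> `[0, 1]%classic) (fun=> @segment_compact R 0 1).
  by congr compact; apply/seteqP; split => x H i; have := H i; rewrite /= in_itv.
move=> /compact_bounded [M [_ HM]]; exists (M + 1) => z Dz.
by apply: (HM (M + 1)); [rewrite ltrDl|exists z].
Qed.

Section components.
Context (n : nat) (T : R) (A : R -> 'rV[R]_n.+1 -> 'rV[R]_n.+1).
Hypothesis A_smooth : smooth_field T A.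
Local Notation st := (spacetime T n.+1).

(** The partial derivative of A_i in x_i, written as a derivative in the space-time direction (0,
    e_i). In this form its joint continuity in (t, x), and so a bound uniform in t, comes directly
    from [smooth_field]. *)
Definition dcomp (i : 'I_n.+1) (z : R * 'rV[R]_n.+1) : R :=
  'D_((0, dirv i)) (fun z => A z.1 z.2) z ord0 i.

Let cmp (i : 'I_n.+1) (z : R * 'rV[R]_n.+1) : R := A z.1 z.2 ord0 i.

Let A_cont z : st z ->
  [/\ {for z, continuous (fun z => A z.1 z.2)},
      forall i, {for z, continuous ('D_(0, dirv i) (fun z => A z.1 z.2))} &
      forall v, derivable (fun z => A z.1 z.2) z v].
Proof.
have [U [_ UD] AC] := A_smooth => -[Tz Cz].
have Uz : U z by rewrite (surjective_pairing z); exact: UD.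
have /= [H1 H2] := AC 1%N; have [c1 d1] := H1 z Uz.
by split; [exact: c1|move=> i; exact: (H2 _ z Uz)|exact: d1].
Qed.

Lemma comp_continuous i z : st z -> {for z, continuous (cmp i)}.
Proof.
move=> /A_cont[cA _ _].
apply: (@continuous_comp _ _ _ (fun z : R * 'rV[R]_n.+1 => A z.1 z.2)
  (fun M : 'rV[R]_n.+1 => M ord0 i) z cA).
exact: coord_continuous.
Qed.

Lemma dcomp_continuous i z : st z -> {for z, continuous (dcomp i)}.
Proof.
move=> /A_cont[_ cA _].
apply: (@continuous_comp _ _ _ ('D_(0, dirv i) (fun z => A z.1 z.2))
  (fun M : 'rV[R]_n.+1 => M ord0 i) z (cA i)).
exact: coord_continuous.
Qed.

Lemma comp_derive i t s y : st (t, insx i s y) ->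
  is_derive s 1 (fun s => A t (insx i s y) ord0 i) (dcomp i (t, insx i s y)).
Proof.
move=> /A_cont[_ _ /(_ (0, dirv i)) dA].
have H : (fun h : R => h^-1 *: (((fun s => A t (insx i s y) ord0 i) \o shift s)
    (h *: 1) - A t (insx i s y) ord0 i)) @ 0^' --> dcomp i (t, insx i s y).
  rewrite /dcomp /derive.
  have /(cvg_comp _ _ dA) : (fun M : 'rV[R]_n.+1 => M ord0 i) @
     nbhs ('D_(0, dirv i) (fun z => A z.1 z.2) (t, insx i s y)) -->
     ('D_(0, dirv i) (fun z => A z.1 z.2) (t, insx i s y)) ord0 i.
    exact: coord_continuous.
  apply: cvg_trans; apply: near_eq_cvg; apply: nearW => h /=.
  rewrite !mxE; congr (_ * (A _ _ _ _ - _)).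
    by rewrite scaler0 add0r.
  apply/rowP => j; rewrite !mxE.
  case: (unliftP i j) => [m|] -> /=.
    by rewrite eq_sym (negbTE (neq_lift i m)) ?andbF mulr0 add0r.
  by rewrite !eqxx/= mulr1 /shift /= [h%:A]mulr1.
by split; [apply/cvg_ex; eexists; exact: H|exact/cvg_lim].
Qed.

Lemma bmf_comp_field i : bmf st (fun z => A z.1 z.2 ord0 i).
Proof. by apply: continuous_bmf_spacetime => z Dz; exact: comp_continuous. Qed.

Lemma bmf_dcomp i : bmf st (fun z => dcomp i z).
Proof. by apply: continuous_bmf_spacetime => z Dz; exact: dcomp_continuous. Qed.

Hypothesis A_nonzero : forall t x i, t \in `[0, T] -> cube R n.+1 x ->
  A t x ord0 i != 0.

(** The domain is convex: if the sign changed, the intermediate value theorem on the space-time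
    segment between the two points would give a zero of A_i. *)
Lemma comp_sign i t0 x0 : t0 \in `[0, T] -> cube R n.+1 x0 ->
  A t0 x0 ord0 i < 0 ->
  forall t x, t \in `[0, T] -> cube R n.+1 x -> A t x ord0 i < 0.
Proof.
move=> t0T x0C A0 t x tT xC; rewrite ltNge; apply/negP => A1.
pose p (r : R) : R * 'rV[R]_n.+1 := (t0 + r * (t - t0), x0 + r *: (x - x0)).
have pst r : r \in `[0, 1] -> st (p r).
  rewrite in_itv /= => /andP[r0 r1]; split => /=.
    move: t0T tT; rewrite !in_itv/= => /andP[? ?] /andP[? ?].
    by apply/andP; split; nra.
  move=> j; rewrite !mxE; have /andP[? ?] := x0C j; have /andP[? ?] := xC j.
  by apply/andP; split; nra.
have cp : continuous (p : R -> R * 'rV[R]_n.+1).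
  move=> r.
  have H1 : t0 + s * (t - t0) @[s --> r] --> t0 + r * (t - t0).
    apply: cvgD; first exact: cvg_cst.
    by apply: cvgM; [exact: cvg_id|exact: cvg_cst].
  have H2 : x0 + s *: (x - x0) @[s --> r] --> x0 + r *: (x - x0).
    by apply: cvgD; [exact: cvg_cst|apply: cvgZr_tmp; exact: cvg_id].
  exact: (cvg_pair H1 H2).
have [||r r01 Ar] := @IVT R (cmp i \o p) 0 1 0 ler01.
- apply: continuous_in_subspaceT => r /set_mem r01.
  by apply: continuous_comp; [exact: cp|exact/comp_continuous/pst].
- rewrite /cmp /p /= !mul0r !scale0r !addr0 !mul1r !scale1r.
  rewrite ![_ + (_ - _)]addrC !subrK.
  by rewrite ge_min (ltW A0) le_max A1 orbT.
- have [Tr Cr] := pst r r01.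
  by have := A_nonzero i Tr Cr; rewrite [A _ _ _ _]Ar eqxx.
Qed.

End components.
End smooth_components.
Arguments spacetime {R} T n _.

(** * Piecewise polynomials on an interval *)

Section piecewise_polynomials.
Context {R : realType}.
Implicit Types (f g : R -> R) (p q : nat -> {poly R}).

Definition node (M j : nat) : R := j%:R / M%:R.

Lemma node_le M i j : (i <= j)%N -> node M i <= node M j.
Proof. by move=> ij; rewrite ler_wpM2r ?invr_ge0// ler_nat. Qed.

Lemma node_lt M i j : (0 < M)%N -> (i < j)%N -> node M i < node M j.
Proof. by move=> M0 ij; rewrite ltr_pM2r ?invr_gt0 ?ltr0n// ltr_nat. Qed.

Lemma node0 M : node M 0 = 0. Proof. by rewrite /node mul0r. Qed.

Lemma nodeM M : (0 < M)%N -> node M M = 1.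
Proof. by move=> M0; rewrite /node divff// pnatr_eq0 -lt0n. Qed.

Lemma node_cell M x : (0 < M)%N -> 0 <= x < 1 ->
  exists2 j, (j < M)%N & node M j <= x < node M j.+1.
Proof.
move=> M0 /andP[x0 x1]; have M0r : 0 < M%:R :> R by rewrite ltr0n.
have y0 : 0 <= x * M%:R by rewrite mulr_ge0.
have /andP[h1 h2] := truncn_itv y0.
exists (Num.truncn (x * M%:R)).
  by rewrite -(ltr_nat R) (le_lt_trans h1)// gtr_pMl.
by rewrite /node ler_pdivrMr// h1 ltr_pdivlMr.
Qed.

(** Keeping the polynomial of every cell explicit lets one-sided traces and derivatives at nodes be
    read off from [p]. *)
Definition glue M p x : R :=
  \sum_(j < M) if node M j <= x < node M j.+1 then (p j).[x] else 0.

Lemma glueE M p j x : (j < M)%N -> node M j <= x < node M j.+1 ->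
  glue M p x = (p j).[x].
Proof.
move=> jM /andP[jx xj]; rewrite /glue (bigD1 (Ordinal jM))//= jx xj /= big1 ?addr0//.
move=> i; rewrite -val_eqE /= => ij; case: ifPn => // /andP[ix xi].
have := ij; rewrite neq_ltn => /orP[] lt_ij.
  by have := le_lt_trans (le_trans (node_le M lt_ij) jx) xi; rewrite ltxx.
by have := le_lt_trans (le_trans (node_le M lt_ij) ix) xj; rewrite ltxx.
Qed.

Lemma glue_out M p x : ~~ (0 <= x < 1) -> glue M p x = 0.
Proof.
move=> x01; rewrite /glue big1// => j _; case: ifPn => // /andP[jx xj].
have M0 : (0 < M)%N by rewrite (leq_ltn_trans _ (ltn_ord j)).
move/negP : x01; case; rewrite (le_trans _ jx) ?divr_ge0//=.
by rewrite (lt_le_trans xj)// -(nodeM M0) node_le.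
Qed.

Lemma glue_lin M p q c x :
  glue M p x + c * glue M q x = glue M (fun j => p j + c *: q j) x.
Proof.
rewrite /glue mulr_sumr -big_split /=; apply: eq_bigr => j _.
by case: ifP => _; rewrite ?hornerE ?mulr0 ?addr0.
Qed.

Definition ppoly k M : set (R -> R) :=
  [set f | exists2 p : nat -> {poly R}, (forall j, (size (p j) <= k.+1)%N) & f = glue M p].

Lemma ppolyP k M f :
  (forall j, (j < M)%N -> exists2 p : {poly R}, (size p <= k.+1)%N &
     forall x, node M j <= x < node M j.+1 -> f x = p.[x]) ->
  (forall x, ~~ (0 <= x < 1) -> f x = 0) -> (0 < M)%N -> ppoly k M f.
Proof.
move=> H f0 M0.
have /choice[p pP] : forall j, exists p : {poly R}, (size p <= k.+1)%N /\
    ((j < M)%N -> forall x, node M j <= x < node M j.+1 -> f x = p.[x]).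
  move=> j; have [jM|jM] := ltnP j M; last by exists 0; rewrite size_poly0.
  by have [p ps pf] := H j jM; exists p.
exists p => [j|]; first by have [] := pP j.
apply/funext => x; have [x01|x01] := boolP (0 <= x < 1).
  have [j jM jx] := node_cell M0 x01.
  by rewrite (glueE p jM jx) (pP j).2.
by rewrite glue_out// f0.
Qed.

Lemma ppoly_lin k M f g c : ppoly k M f -> ppoly k M g ->
  ppoly k M (fun x => f x + c * g x).
Proof.
move=> [p ps ->] [q qs ->]; exists (fun j => p j + c *: q j).
  move=> j; rewrite (leq_trans (size_polyD _ _))// geq_max ps.
  by rewrite (leq_trans (size_scale_leq _ _)).
by apply/funext => x; rewrite glue_lin.
Qed.

Lemma bmf_horner01 (p : {poly R}) (D : set R) : D `<=` `[0, 1]%classic ->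
  bmf D (fun x => p.[x]).
Proof.
move=> D01; split.
  by apply: measurable_funTS; apply: continuous_measurable_fun;
     exact: continuous_horner.
exists (\sum_(i < size p) `|p`_i|) => x /D01; rewrite /= in_itv/= => /andP[x0 x1].
rewrite horner_coef (le_trans (ler_norm_sum _ _ _))// ler_sum// => i _.
by rewrite normrM ler_piMr// normrX ger0_norm// exprn_ile1.
Qed.

Lemma bmf_glue M p (D : set R) : bmf D (glue M p).
Proof.
apply: bmf_sum => j _; pose I := `[node M j, node M j.+1[%classic.
have M0 : (0 < M)%N by rewrite (leq_ltn_trans _ (ltn_ord j)).
have [m [b hb]] : bmf I (fun x => (p j).[x]).
  apply: bmf_horner01 => x; rewrite /I /= !in_itv/= => /andP[jx xj].
  rewrite (le_trans _ jx) ?divr_ge0//=.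
  by rewrite ltW// (lt_le_trans xj)// -(nodeM M0) node_le.
split.
  apply: measurable_funTS.
  rewrite (_ : (fun x => _) = (fun x => (p j).[x]) \_ I).
    by apply: (measurable_restrictT _ (measurable_itv _)).1.
  by apply/funext => x; rewrite patchE /I mem_setE in_itv /=.
exists `|b| => x _; case: ifPn => jx; last by rewrite normr0.
by rewrite (le_trans _ (ler_norm _))// hb//= /I /= in_itv.
Qed.

Lemma cvg_at0r (h : R -> R) (l e : R) : 0 < e -> {for 0, continuous h} ->
  h 0 = l -> forall f, (forall s, 0 < s < e -> f s = h s) ->
  f s @[s --> 0^'+] --> l.
Proof.
move=> e0 ch <- f fh.
have : h s @[s --> 0^'+] --> h 0 by exact: cvg_at_right_filter.
apply: cvg_trans; apply: near_eq_cvg; near=> s.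
by rewrite fh//; apply/andP; split; near: s;
  [exact: nbhs_right_gt|exact: nbhs_right_lt].
Unshelve. all: by end_near. Qed.

Let cont_hornerB (p : {poly R}) x : {for 0, continuous (fun s => p.[x - s])}.
Proof.
apply: continuous_comp; last exact: continuous_horner.
by apply: cvgB; [exact: cvg_cst|exact: cvg_id].
Qed.

Let cont_hornerD (p : {poly R}) x : {for 0, continuous (fun s => p.[x + s])}.
Proof.
apply: continuous_comp; last exact: continuous_horner.
by apply: cvgD; [exact: cvg_cst|exact: cvg_id].
Qed.

Lemma poly_left_cvg f (p : {poly R}) a x : a < x ->
  (forall y, a <= y < x -> f y = p.[y]) -> f (x - s) @[s --> 0^'+] --> p.[x].
Proof.
move=> ax fp; apply: (@cvg_at0r (fun s => p.[x - s]) _ (x - a)).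
- by rewrite subr_gt0.
- exact: cont_hornerB.
- by rewrite /= subr0.
- by move=> s /andP[s0 sa]; rewrite fp//; apply/andP; split; lra.
Qed.

Lemma poly_right_cvg f (p : {poly R}) x b : x < b ->
  (forall y, x <= y < b -> f y = p.[y]) -> f (x + s) @[s --> 0^'+] --> p.[x].
Proof.
move=> xb fp; apply: (@cvg_at0r (fun s => p.[x + s]) _ (b - x)).
- by rewrite subr_gt0.
- exact: cont_hornerD.
- by rewrite /= addr0.
- by move=> s /andP[s0 sa]; rewrite fp//; apply/andP; split; lra.
Qed.

Lemma poly_right_derive f (p : {poly R}) x b : x < b ->
  (forall y, x <= y < b -> f y = p.[y]) ->
  (f (x + s) - f x) / s @[s --> 0^'+] --> p^`().[x].
Proof.
move=> xb fp.
(* The difference quotient at x is the value of [q] at x + s, a polynomial in s, and q(x) =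
   p'(x). *)
have [q pq] : exists q : {poly R}, p - (p.[x])%:P = q * ('X - x%:P).
  by apply/factor_theorem; rewrite /root !hornerE subrr.
have -> : p^`().[x] = q.[x].
  have : (p - (p.[x])%:P)^`() = (q * ('X - x%:P))^`() by rewrite pq.
  by rewrite derivB derivC subr0 derivM derivXsubC => ->; rewrite !hornerE subrr mulr0 add0r.
apply: (@cvg_at0r (fun s => q.[x + s]) _ (b - x)).
- by rewrite subr_gt0.
- exact: cont_hornerD.
- by rewrite /= addr0.
- move=> s /andP[s0 sa]; rewrite !fp; [|by apply/andP; split; lra..].
  have -> : p.[x + s] - p.[x] = (p - (p.[x])%:P).[x + s] by rewrite !hornerE.
  by rewrite pq !hornerE [x + s]addrC addrK mulfK// gt_eqF.
Qed.

Lemma glue_left_cvg M p j : (j < M)%N ->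
  glue M p (node M j.+1 - s) @[s --> 0^'+] --> (p j).[node M j.+1].
Proof.
move=> jM; have M0 : (0 < M)%N by rewrite (leq_ltn_trans _ jM).
by apply: poly_left_cvg (node_lt M0 (ltnSn j)) _ => y; exact: glueE.
Qed.

(** Because the cells are half-open, the function is a polynomial just to the right of every point,
    the zero polynomial outside [0, 1). Right limits and right derivatives then exist everywhere. *)
Lemma glue_local M p x : (0 < M)%N ->
  exists2 q : {poly R}, glue M (fun j => (p j)^`()) x = q^`().[x] &
  exists2 b, x < b & forall y, x <= y < b -> glue M p y = q.[y].
Proof.
move=> M0; have [x01|x01] := boolP (0 <= x < 1).
  have [j jM /andP[jx xj]] := node_cell M0 x01.
  exists (p j); first by rewrite (glueE _ jM) ?jx.
  exists (node M j.+1) => // y /andP[xy yj]; rewrite (glueE _ jM)// yj andbT.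
  exact: le_trans xy.
exists 0; first by rewrite glue_out// deriv0 horner0.
exists (if x < 0 then 0 else x + 1) => [|y].
  by case: (ltP x 0) => // _; lra.
move: x01; rewrite negb_and -ltNge -leNgt; case: (ltP x 0) => x0 /= x1 /andP[xy yb].
  by rewrite horner0 glue_out// leNgt yb.
by rewrite horner0 glue_out// negb_and -!leNgt (le_trans x1 xy) orbT.
Qed.

Lemma glue_right_cvg M p x : (0 < M)%N ->
  glue M p (x + s) @[s --> 0^'+] --> glue M p x.
Proof.
move=> M0; have [q _ [b xb pq]] := glue_local p x M0.
by rewrite (pq x) ?lexx ?xb//; exact: poly_right_cvg pq.
Qed.

Lemma glue_right_derive M p x : (0 < M)%N ->
  (glue M p (x + s) - glue M p x) / s @[s --> 0^'+] -->
  glue M (fun j => (p j)^`()) x.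
Proof.
move=> M0; have [q -> [b xb pq]] := glue_local p x M0.
exact: poly_right_derive pq.
Qed.

Lemma ppoly_left_cvg k M f j : ppoly k M f -> (j < M)%N ->
  cvg (f (node M j.+1 - s) @[s --> 0^'+]).
Proof. by move=> [p _ ->] jM; apply/cvg_ex; eexists; exact: glue_left_cvg. Qed.

(** For right-continuous representatives this amounts to continuity at [x]. *)
Definition left_continuous f x := f (x - s) @[s --> 0^'+] --> f x.

Lemma left_cvg_lin f g c x a b :
  f (x - s) @[s --> 0^'+] --> a -> g (x - s) @[s --> 0^'+] --> b ->
  f (x - s) + c * g (x - s) @[s --> 0^'+] --> a + c * b.
Proof.
by move=> fa gb; apply: cvgD => //; apply: cvgM => //; exact: cvg_cst.
Qed.

Lemma left_continuous_poly f (p : {poly R}) a x b : a < x < b ->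
  (forall y, a <= y < b -> f y = p.[y]) -> left_continuous f x.
Proof.
move=> /andP[ax xb] fp; rewrite /left_continuous (fp x) ?(ltW ax)//.
apply: (poly_left_cvg ax) => y /andP[ay yx]; rewrite fp// ay/=.
exact: lt_trans xb.
Qed.

End piecewise_polynomials.

(** * Integration by parts on an interval, cell by cell *)

Section one_dim_integration.
Context {R : realType}.
Local Notation mu := (@lebesgue_measure R).
Implicit Types (a b : R -> R) (p q : nat -> {poly R}).

Lemma Rintegral_FTC2 (F f : R -> R) (x y : R) : x < y ->
  (forall s : R, x <= s <= y -> is_derive s 1 F (f s)) ->
  (forall s : R, x <= s <= y -> {for s, continuous f}) ->
  \int[mu]_(s in `[x, y]) f s = F y - F x.
Proof.
move=> xy dF cf.
have cF s : x <= s <= y -> {for s, continuous F}.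
  move=> /dF dFs; apply: differentiable_continuous; apply/derivable1_diffP.
  exact: ex_derive.
rewrite /Rintegral (@continuous_FTC2 _ f F)//.
- apply: continuous_in_subspaceT => s /set_mem; rewrite /= in_itv/=; exact: cf.
- split.
  + by move=> s; rewrite in_itv/= => /andP[xs sy]; apply: (@ex_derive _ _ _ _ _ _ (f s));
      apply: dF; rewrite (ltW xs) ltW.
  + by apply: cvg_at_right_filter; apply: cF; rewrite lexx ltW.
  + by apply: cvg_at_left_filter; apply: cF; rewrite lexx ltW.
- move=> s; rewrite in_itv/= => /andP[xs sy]; rewrite derive1E.
  by apply: (@derive_val _ _ _ _ _ _ (f s)); apply: dF; rewrite (ltW xs) ltW.
Qed.

Lemma Rintegral_nodes M (f : R -> R) m : (0 < M)%N -> (m <= M)%N ->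
  mu.-integrable `[0, 1] (EFin \o f) ->
  \int[mu]_(s in `[0, node M m]) f s =
  \sum_(j < m) \int[mu]_(s in `[node M j, node M j.+1]) f s.
Proof.
move=> M0 + iF; elim: m => [|m IHm] mM.
  by rewrite big_ord0 node0 set_itv1 Rintegral_set1.
have nS n : (n <= M)%N -> mu.-integrable `[0, node M n] (EFin \o f).
  move=> nM; apply: integrableS iF => //.
  by apply: subset_itvl; rewrite bnd_simp -(nodeM M0) node_le.
rewrite big_ord_recr -(IHm (ltnW mM)).
rewrite -[LHS](subrK (\int[mu]_(s in `[0, node M m]) f s)) Rintegral_itvB.
- rewrite addrC; congr (_ + _).
  apply: Rintegral_itv_obnd_cbnd; apply: integrableS (nS _ mM) => //.
  by apply: subset_itvr; rewrite bnd_simp divr_ge0.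
- exact: nS.
- by rewrite bnd_simp divr_ge0.
- by rewrite bnd_simp ltW// node_lt.
Qed.

Lemma eq_Rintegral_cell (f g : R -> R) (x y : R) :
  mu.-integrable `[x, y[ (EFin \o f) -> (forall s, x <= s < y -> f s = g s) ->
  \int[mu]_(s in `[x, y]) f s = \int[mu]_(s in `[x, y]) g s.
Proof.
move=> iF fg.
have iG : mu.-integrable `[x, y[ (EFin \o g).
  by apply: eq_integrable iF => // s /set_mem; rewrite /= in_itv /= => /fg ->.
rewrite -!Rintegral_itv_bndo_bndc//; apply: eq_Rintegral => s /set_mem.
by rewrite /= in_itv; exact: fg.
Qed.

(** On cell j the integrand is the derivative of a p_j q_j. Each cell contributes with its own
    polynomials, so both one-sided traces occur at every interior node. *)
Lemma glue_integration_by_parts M p q a b : (0 < M)%N ->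
  (forall s : R, 0 <= s <= 1 -> is_derive s 1 a (b s)) ->
  (forall s : R, 0 <= s <= 1 -> {for s, continuous b}) ->
  \int[mu]_(s in `[0, 1]) (a s *
     (glue M (fun j => (p j)^`()) s * glue M q s +
      glue M p s * glue M (fun j => (q j)^`()) s)
     + b s * (glue M p s * glue M q s)) =
  \sum_(j < M) (a (node M j.+1) * ((p j).[node M j.+1] * (q j).[node M j.+1])
     - a (node M j) * ((p j).[node M j] * (q j).[node M j])).
Proof.
move=> M0 da cb.
have bmfc (f : R -> R) : (forall s : R, 0 <= s <= 1 -> {for s, continuous f}) ->
    bmf (`[0, 1]%classic : set R) f.
  move=> cf; have cw : {within `[0, 1], continuous f}.
    by apply: continuous_in_subspaceT => s /set_mem; rewrite /= in_itv; exact: cf.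
  split; first exact: subspace_continuous_measurable_fun.
  have /compact_bounded [B [_ HB]] :=
    continuous_compact cw (@segment_compact R 0 1).
  exists (B + 1) => s Ds.
  by apply: (HB (B + 1)); [rewrite ltrDl|exists s].
have ca s : 0 <= s <= 1 -> {for s, continuous a}.
  move=> /da das; apply: differentiable_continuous; apply/derivable1_diffP.
  exact: ex_derive.
set f := (X in Rintegral _ _ X).
have bf : bmf (`[0, 1]%classic : set R) f.
  rewrite /f; apply: bmfD; apply: bmfM; [exact: bmfc| |exact: bmfc|].
    by apply: bmfD; apply: bmfM; exact: bmf_glue.
  by apply: bmfM; exact: bmf_glue.
have iF : mu.-integrable `[0, 1] (EFin \o f).
  apply: bmf_integrable => //=.
  by rewrite lebesgue_measure_itv/= lte01 oppr0 adde0 ltry.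
have := Rintegral_nodes M0 (leqnn M) iF; rewrite nodeM// => ->.
apply: eq_bigr => j _; have jM := ltn_ord j.
have j0 : 0 <= node M j :> R by rewrite divr_ge0.
have j1 : node M j.+1 <= 1 :> R by rewrite -(nodeM M0) node_le.
pose g s := a s * ((p j)^`().[s] * (q j).[s] + (p j).[s] * (q j)^`().[s]) +
  b s * ((p j).[s] * (q j).[s]).
rewrite (@eq_Rintegral_cell f g); first last.
- by move=> s js; rewrite /f /g !(glueE _ jM js).
- apply: integrableS iF => // s /=; rewrite !in_itv/= => /andP[js sj].
  by rewrite (le_trans j0 js) (le_trans (ltW sj) j1).
apply: (@Rintegral_FTC2 (fun s => a s * ((p j).[s] * (q j).[s])) g).
- exact: node_lt.
- move=> s /andP[js sj]; have /da das : 0 <= s <= 1.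
    by rewrite (le_trans j0 js) (le_trans sj j1).
  have dpq := is_deriveM (is_derive_poly (p j) s) (is_derive_poly (q j) s).
  have H := is_deriveM das dpq.
  apply: (@is_derive_eq _ _ _ (a * (horner (p j) * horner (q j))) _ _ _ _ H).
  rewrite -[LHS]/(a s * ((p j).[s] * (q j)^`().[s] + (q j).[s] * (p j)^`().[s]) +
    ((p j).[s] * (q j).[s]) * b s) /g; ring.
- move=> s /andP[js sj]; have s01 : 0 <= s <= 1.
    by rewrite (le_trans j0 js) (le_trans sj j1).
  have ch (r : {poly R}) : {for s, continuous (horner r)} by exact: continuous_horner.
  apply: cvgD; apply: cvgM => //; [exact: ca| |exact: cb|].
    by apply: cvgD; apply: cvgM; exact: ch.
  by apply: cvgM; exact: ch.
Qed.

End one_dim_integration.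

(** * Inverse trace inequality for polynomials *)

Section trace_inequality.
Context {R : realType}.
Local Notation mu := (@lebesgue_measure R).

(* The k-th finite difference annihilates polynomials of degree less than k. *)
Lemma finite_difference_eq0 k (p : {poly R}) (c e : R) : (size p <= k)%N ->
  \sum_(m < k.+1) (-1) ^+ m * 'C(k, m)%:R * p.[c + m%:R * e] = 0.
Proof.
elim: k p => [|k IHk] p ps.
  move: ps; rewrite leqn0 size_poly_eq0 => /eqP ->.
  by rewrite big1// => i _; rewrite horner0 mulr0.
(* One difference lowers the degree, and Pascal's rule turns the difference of order [k] of [q] into
   that of order [k.+1] of [p]. *)
pose q := p - (p \Po ('X + e%:P)).
have qs : (size q <= k)%N.
  have sX : size ('X + e%:P : {poly R}) = 2%N by rewrite size_XaddC.
  apply/leq_sizeP => j; rewrite leq_eqVlt => /predU1P[<-|kj]; last first.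
    by rewrite /q coefB !nth_default ?subrr// ?size_comp_poly2// (leq_trans ps).
  have [pk|pk] := leqP (size p) k.
    by rewrite /q coefB !nth_default ?subrr// size_comp_poly2.
  have szp : size p = k.+1 by apply/eqP; rewrite eqn_leq ps.
  rewrite /q coefB; have -> : p`_k = lead_coef p by rewrite lead_coefE szp.
  have -> : (p \Po ('X + e%:P))`_k = lead_coef (p \Po ('X + e%:P)).
    by rewrite lead_coefE size_comp_poly2// szp.
  rewrite lead_coef_comp ?sX// lead_coefDl ?size_polyX ?size_polyC; last first.
    by case: (e == 0).
  by rewrite lead_coefX expr1n mulr1 subrr.
have qE m : q.[c + m%:R * e] = p.[c + m%:R * e] - p.[c + m.+1%:R * e].
  rewrite /q !hornerE horner_comp !hornerE; congr (_ - p.[_]).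
  by rewrite -natr1; ring.
have := IHk q qs.
under eq_bigr do rewrite qE mulrBr.
rewrite sumrB => /eqP; rewrite subr_eq0 => /eqP H.
rewrite big_ord_recl expr0 bin0 mul1r.
under eq_bigr => m _.
  rewrite lift0 binS natrD mulrDr mulrDl.
  rewrite [X in _ + X](_ : _ =
    - ((-1) ^+ m * 'C(k, m)%:R * p.[c + m.+1%:R * e])); last first.
    by rewrite exprS; ring.
  over.
rewrite sumrB -H.
pose S := \sum_(m < k) (-1) ^+ m.+1 * 'C(k, m.+1)%:R * p.[c + m.+1%:R * e].
have E1 : \sum_(m < k.+1) (-1) ^+ m.+1 * 'C(k, m.+1)%:R * p.[c + m.+1%:R * e] = S.
  by rewrite big_ord_recr /= bin_small// mulr0 mul0r addr0.
have E2 : \sum_(m < k.+1) (-1) ^+ m * 'C(k, m)%:R * p.[c + m%:R * e] =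
    p.[c + 0%:R * e] + S.
  by rewrite big_ord_recl expr0 bin0 !mul1r; congr (_ + _);
    apply: eq_bigr => m _; rewrite lift0.
by rewrite E1 E2 mul1r; ring.
Qed.

(** The crude factor 2^n comes from iterating (S + a)^2 <= 2 S^2 + 2 a^2. *)
Lemma sqr_sum_le (n : nat) (a : nat -> R) :
  (\sum_(m < n) a m) ^+ 2 <= 2 ^+ n * \sum_(m < n) a m ^+ 2.
Proof.
elim: n => [|n IHn]; first by rewrite !big_ord0 expr0n mulr0.
rewrite !big_ord_recr /=; set S := \sum_(_ < _) a _ in IHn *.
set Q := \sum_(_ < _) _ in IHn *; rewrite [2 ^+ n.+1]exprS.
have p1 : 1 <= 2 ^+ n :> R by rewrite exprn_ege1// ler1n.
have : 0 <= (2 ^+ n - 1) * a n ^+ 2 by rewrite mulr_ge0 ?subr_ge0 ?sqr_ge0.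
have := sqr_ge0 (S - a n).
move: {p1} (2 ^+ n) (a n) S Q IHn => x y S Q *; nra.
Qed.

Lemma poly_antiderivative (q : {poly R}) : exists P : {poly R}, P^`() = q.
Proof.
exists (\poly_(i < (size q).+1) (q`_i.-1 / i%:R)); apply/polyP => i.
rewrite coef_deriv coef_poly ltnS /=; case: ltnP => iq.
  by rewrite -[LHS]mulr_natr divfK// pnatr_eq0.
by rewrite mul0rn nth_default.
Qed.

Lemma Rintegral_deriv (P : {poly R}) (x y : R) : x < y ->
  \int[mu]_(s in `[x, y]) (P^`()).[s] = P.[y] - P.[x].
Proof.
move=> xy; apply: (@Rintegral_FTC2 _ (horner P) (horner P^`())) => // s _.
exact: continuous_horner.
Qed.

Lemma deriv_ge0_le (P : {poly R}) (x y : R) : x <= y ->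
  (forall s, x <= s <= y -> 0 <= P^`().[s]) -> P.[x] <= P.[y].
Proof.
rewrite le_eqVlt => /predU1P[->//|xy] P0.
rewrite -subr_ge0 -Rintegral_deriv//; apply: Rintegral_ge0 => s.
by rewrite /= in_itv; exact: P0.
Qed.

(** With K = k + 1: the binomials are the coefficients of the finite difference of order K, 2^K is
    the price of squaring a sum of K terms, and the outer factor K comes from integrating over steps
    of length at most l/K. *)
Definition trace_cst (k : nat) : R :=
  k.+1%:R * \sum_(m < k.+1) 2 ^+ k.+1 * 'C(k.+1, m.+1)%:R ^+ 2.

Lemma trace_cst_gt0 k : 0 < trace_cst k.
Proof.
rewrite mulr_gt0// ?ltr0n// big_ord_recl ltr_pwDl//.
  by rewrite mulr_gt0 ?exprn_gt0// ltr0n bin_gt0.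
by rewrite sumr_ge0// => m _; rewrite mulr_ge0 ?exprn_ge0.
Qed.

(** The vanishing finite difference of order K = k + 1 expresses p(c) by the values at c + e, ..., c
    + K e. Squaring and integrating over 0 <= e <= l/K keeps all these points in [c, c + l]. Working
    with an antiderivative P of p^2 replaces the integrals by values of P. *)
Lemma poly_trace_antiderivative k (p P : {poly R}) (c l : R) :
  (size p <= k.+1)%N -> 0 < l -> P^`() = p ^+ 2 ->
  l * p.[c] ^+ 2 <= trace_cst k * (P.[c + l] - P.[c]).
Proof.
move=> ps l0 PE; set K := k.+1.
have K0 : 0 < K%:R :> R by rewrite ltr0n.
pose B m : R := 2 ^+ K * 'C(K, m.+1)%:R ^+ 2.
have B0 m : 0 <= B m by rewrite mulr_ge0 ?exprn_ge0.
have pc (e : R) : p.[c] ^+ 2 <= \sum_(m < K) B m * p.[c + m.+1%:R * e] ^+ 2.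
  have := finite_difference_eq0 c e ps; rewrite big_ord_recl.
  rewrite expr0 bin0 mul0r addr0 !mul1r => /eqP; rewrite addr_eq0 => /eqP ->.
  rewrite sqrrN (le_trans (sqr_sum_le _ (fun m =>
    (-1) ^+ m.+1 * 'C(K, m.+1)%:R * p.[c + m.+1%:R * e])))//.
  rewrite mulr_sumr ler_sum// => m _.
  by rewrite /B !exprMn sqrr_sign mul1r mulrA.
(* [G] is an antiderivative in [e] of the defect of the inequality [pc], hence nondecreasing; the
   denominators come from the change of variable s = c + (m + 1) e. *)
pose G := \sum_(m < K) (B m / m.+1%:R) *: (P \Po (c%:P + m.+1%:R *: 'X))
  - (p.[c] ^+ 2) *: 'X.
have G' e : G^`().[e] = \sum_(m < K) B m * p.[c + m.+1%:R * e] ^+ 2 - p.[c] ^+ 2.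
  rewrite derivB derivZ derivX hornerE hornerN hornerZ hornerC mulr1.
  rewrite raddf_sum horner_sum; congr (_ - _); apply: eq_bigr => m _ /=.
  rewrite derivZ deriv_comp PE derivD derivC derivZ derivX add0r.
  rewrite hornerZ hornerM horner_comp hornerD hornerC !hornerZ hornerX horner_exp.
  rewrite hornerC mulr1 mulrCA divfK ?pnatr_eq0// mulrC //.
have GE e : G.[e] = \sum_(m < K) (B m / m.+1%:R) * P.[c + m.+1%:R * e]
    - p.[c] ^+ 2 * e.
  rewrite /G !hornerE horner_sum; congr (_ - _); apply: eq_bigr => m _.
  by rewrite hornerZ horner_comp !hornerE.
have L0 : 0 <= l / K%:R by rewrite divr_ge0 ?ltW.
have : G.[0] <= G.[l / K%:R].
  by apply: deriv_ge0_le => // s _; rewrite G' subr_ge0.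
rewrite !GE mulr0 subr0 lerBrDl -lerBrDr -sumrB => H.
rewrite /trace_cst -/K.
have -> : l * p.[c] ^+ 2 = K%:R * (p.[c] ^+ 2 * (l / K%:R)).
  by field; rewrite gt_eqF.
rewrite -mulrA ler_pM2l// (le_trans H)// mulr_suml ler_sum// => m _.
rewrite mulr0 addr0 -mulrBr -[leRHS]/(B m * (P.[c + l] - P.[c])) -mulrA.
rewrite ler_wpM2l ?B0// mulrC.
have Pmono x y : x <= y -> P.[x] <= P.[y].
  by move=> xy; apply: deriv_ge0_le => // s _; rewrite PE horner_exp sqr_ge0.
have mK : m.+1%:R * (l / K%:R) <= l.
  by rewrite mulrCA ger_pMr// ler_pdivrMr// mul1r ler_nat.
rewrite ler_pdivrMr ?ltr0n// (le_trans (_ : _ <= P.[c + l] - P.[c]))//.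
  by rewrite lerB// Pmono// lerD2l.
by rewrite ler_peMr ?ler1n// subr_ge0 Pmono// lerDl ltW.
Qed.

Lemma poly_trace_left k (p : {poly R}) (c l : R) : (size p <= k.+1)%N -> 0 < l ->
  l * p.[c] ^+ 2 <= trace_cst k * \int[mu]_(s in `[c, c + l]) (p.[s] ^+ 2).
Proof.
move=> ps l0; have [P PE] := poly_antiderivative (p ^+ 2).
rewrite (le_trans (poly_trace_antiderivative c ps l0 PE))// -Rintegral_deriv ?ltrDl//.
by under eq_Rintegral do rewrite PE horner_exp.
Qed.

(** Reflection of the previous case: -P(-x) is an antiderivative of p(-x)^2. *)
Lemma poly_trace_right k (p : {poly R}) (c l : R) : (size p <= k.+1)%N -> 0 < l ->
  l * p.[c] ^+ 2 <= trace_cst k * \int[mu]_(s in `[c - l, c]) (p.[s] ^+ 2).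
Proof.
move=> ps l0; have [P PE] := poly_antiderivative (p ^+ 2).
have ps' : (size (p \Po (- 'X)) <= k.+1)%N.
  by rewrite size_comp_poly2// size_polyN size_polyX.
have PE' : (- (P \Po (- 'X)))^`() = (p \Po (- 'X)) ^+ 2.
  by rewrite derivN deriv_comp PE derivN derivX mulrN1 opprK !expr2 comp_polyM.
have := poly_trace_antiderivative (- c) ps' l0 PE'.
have hE x : (- (P \Po (- 'X))).[x] = - P.[- x].
  by rewrite hornerN horner_comp hornerN hornerX.
rewrite !hE horner_comp hornerN hornerX !opprK opprD opprK addrC => H.
rewrite (le_trans H)// -Rintegral_deriv ?ltrBlDr ?ltrDl//.
by under eq_Rintegral do rewrite PE horner_exp.
Qed.

End trace_inequality.

(** * Continuity of the one-dimensional spaces across nodes *)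

Section one_dim_spaces.
Context {R : realType}.
Variables (k N : nat).
Implicit Types f : R -> R.
Local Notation M := (2 ^ N.+1)%N.

Let M0 : (0 < M)%N. Proof. by rewrite expn_gt0. Qed.

Definition odd_continuous : set (R -> R) := [set f | ppoly k M f /\
  forall j, odd j -> (j < M)%N -> left_continuous f (node M j)].

Definition even_continuous : set (R -> R) := [set f | ppoly k M f /\
  forall j, ~~ odd j -> (0 < j < M)%N -> left_continuous f (node M j)].

(** On the circle node 0 is one more even node, identified with node M; the second condition is
    continuity there. *)
Definition circle_continuous : set (R -> R) :=
  [set f | even_continuous f /\ f (1 - s) @[s --> 0^'+] --> f 0].

Definition lin_closed (S : set (R -> R)) :=
  forall f g c, S f -> S g -> S (fun x => f x + c * g x).

Lemma odd_continuous_lin : lin_closed odd_continuous.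
Proof.
move=> f g c [fp fc] [gp gc]; split; first exact: ppoly_lin.
by move=> j oj jM; apply: left_cvg_lin; [exact: fc|exact: gc].
Qed.

Lemma even_continuous_lin : lin_closed even_continuous.
Proof.
move=> f g c [fp fc] [gp gc]; split; first exact: ppoly_lin.
by move=> j oj jM; apply: left_cvg_lin; [exact: fc|exact: gc].
Qed.

Lemma circle_continuous_lin : lin_closed circle_continuous.
Proof.
move=> f g c [fp fc] [gp gc]; split; first exact: even_continuous_lin.
exact: left_cvg_lin.
Qed.

Lemma nth_ugrid n (a b : R) i : (i <= 2 ^ n)%N ->
  nth 0 (ugrid n a b) i = a + i%:R * ((b - a) / 2 ^+ n).
Proof. by move=> i2; rewrite (nth_map 0%N) ?size_iota// nth_iota. Qed.

Lemma size_ugrid n (a b : R) : size (ugrid n a b) = (2 ^ n).+1.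
Proof. by rewrite size_map size_iota. Qed.

(** One statement for both families: e = 0 is the primal grid and e = 1 the grid shifted to the left
    by one half cell. A cell of level l <= N consists of an even number of half cells, so a node j
    with j + e odd lies strictly inside such a cell, and [f] is a single polynomial around it. *)
Lemma Vspace_cell l (a b : R) e j f : (l <= N)%N -> b - a = 1 ->
  a = - node M e -> (j + e < M)%N -> Vspace k l a b f ->
  exists2 p : {poly R}, (size p <= k.+1)%N & exists x y : R,
    [/\ x <= node M j, odd (j + e) -> x < node M j, node M j.+1 <= y &
        forall z, x <= z < y -> f z = p.[z]].
Proof.
move=> lN ba ae jeM [fV _]; pose q := (2 ^ (N.+1 - l))%N.
have q0 : (0 < q)%N by rewrite expn_gt0.
have qM : (2 ^ l * q)%N = M by rewrite -expnD subnKC// leqW.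
pose i := ((j + e) %/ q)%N.
have il : (i < 2 ^ l)%N by rewrite ltn_divLR// qM.
have sE n : (n <= 2 ^ l)%N -> nth 0 (ugrid l a b) n = (n * q)%:R / M%:R - e%:R / M%:R.
  move=> nl; rewrite nth_ugrid// ba ae addrC /node; congr (_ - _).
  rewrite -qM natrM !natrM natrX mul1r invfM mulrACA divff ?mulr1//.
  by rewrite pnatr_eq0 -lt0n.
have [|p ps pf] := fV i; first by rewrite size_ugrid ltnS.
have Mr : 0 < M%:R :> R by rewrite ltr0n.
exists p => //; exists (nth 0 (ugrid l a b) i), (nth 0 (ugrid l a b) i.+1); split=> //.
- rewrite (sE _ (ltnW il)).
  rewrite -mulrBl.
  rewrite ler_pM2r ?invr_gt0//.
  rewrite lerBlDr.
  rewrite -natrD.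
  rewrite ler_nat.
  exact: leq_trunc_div.
- move=> oje; rewrite (sE _ (ltnW il)) -mulrBl ltr_pM2r ?invr_gt0// ltrBlDr -natrD ltr_nat.
  rewrite ltn_neqAle leq_trunc_div andbT; apply: contraTneq oje => <-.
  by rewrite oddM /q subSn// oddX /= andbF.
- rewrite sE// -mulrBl ler_pM2r ?invr_gt0// lerBrDr -natrD ler_nat addSn.
  exact: ltn_ceil.
Qed.

Lemma Wspace_Vspace l (a b : R) : Wspace k l a b `<=` Vspace k l a b.
Proof. by case: l => [|l] // f []. Qed.

Lemma Vspace_out l (a b : R) f x : Vspace k l a b f -> ~~ (a <= x < b) -> f x = 0.
Proof.
move=> [_ f0] xab; apply: f0; rewrite -nth_last size_ugrid -nth0 !nth_ugrid//=.
by rewrite mul0r addr0 natrX mulrCA divff ?expf_neq0// mulr1 subrKC.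
Qed.

Lemma Wspace_odd_continuous l : (l <= N)%N -> Wspace k l 0 1 `<=` odd_continuous.
Proof.
move=> lN f /Wspace_Vspace fV.
have e0 : 0 = - node M 0 :> R by rewrite node0 oppr0.
have cell j (jM : (j + 0 < M)%N) := Vspace_cell lN (subr0 1) e0 jM fV.
split.
  apply: ppolyP => // [j jM|x]; last exact: Vspace_out fV.
  have [|p ps [x [y [xj _ jy pf]]]] := cell j; first by rewrite addn0.
  exists p => // z /andP[jz zj].
  by rewrite pf// (le_trans xj jz) (lt_le_trans zj jy).
move=> j oj jM; have [|p _ [x [y [_ xj jy pf]]]] := cell j; first by rewrite addn0.
apply: left_continuous_poly pf; rewrite xj ?addn0//=.
by apply: lt_le_trans jy; exact: node_lt.
Qed.

Let half_node : meshsize N / 2 = node M 1 :> R.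
Proof. by rewrite /meshsize /node natrX exprSr invfM mul1r. Qed.

(** Common to the two dual spaces, which differ only on the last half cell: there [g] is zero, an
    independent polynomial, or the part wrapped around the circle. *)
Lemma shift_even_continuous l (a b : R) f g : (l <= N)%N -> b - a = 1 ->
  a = - (meshsize N / 2) -> Vspace k l a b f ->
  (forall x, 0 <= x < 1 - meshsize N / 2 -> g x = f x) ->
  (exists2 p : {poly R}, (size p <= k.+1)%N &
    forall x, 1 - meshsize N / 2 <= x < 1 -> g x = p.[x]) ->
  (forall x, ~~ (0 <= x < 1) -> g x = 0) -> even_continuous g.
Proof.
move=> lN ba ae fV gf [r rs gr] g0; rewrite half_node in ae gf gr.
have M1 : (M.-1.+1 = M)%N by rewrite prednK.
have nM1 : 1 - node M 1 = node M M.-1 :> R.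
  rewrite -(nodeM M0) /node -mulrBl -natrB//.
  by rewrite subn1.
rewrite nM1 in gf gr.
have cell j (jM : (j + 1 < M)%N) := Vspace_cell lN ba ae jM fV.
split.
  apply: ppolyP => // j jM; have [jM1|jM1] := ltnP j M.-1; last first.
    exists r => // x; have -> : j = M.-1 by lia.
    by rewrite M1 nodeM//; exact: gr.
  have [|p ps [x [y [xj _ jy pf]]]] := cell j; first by rewrite addn1 -M1 ltnS.
  exists p => // z /andP[jz zj]; rewrite gf; last first.
    by rewrite (le_trans _ jz) ?divr_ge0//= (lt_le_trans zj)// node_le.
  by rewrite pf// (le_trans xj jz) (lt_le_trans zj jy).
(* The last half cell starts at node M - 1, which is odd, so a break there does not affect
   continuity at even nodes. *)
move=> j ej /andP[j0 jM]; have jM1 : (j < M.-1)%N.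
  rewrite ltn_neqAle -ltnS M1 jM andbT; apply: contraNneq ej => ->.
  by rewrite -subn1 oddB// oddX.
have [|p _ [x [y [_ xj jy pf]]]] := cell j; first by rewrite addn1 -M1 ltnS.
have xj' : x < node M j by apply: xj; rewrite addn1 /= ej.
have j0' : 0 < node M j :> R by rewrite -(node0 M) node_lt.
apply: (@left_continuous_poly _ g p (Num.max 0 x) _ (node M j.+1)).
  by rewrite gt_max j0' xj' /= node_lt.
move=> z /andP[]; rewrite ge_max => /andP[z0 xz] zj.
rewrite gf ?pf// ?xz ?(lt_le_trans zj jy)//.
by rewrite z0 /= (lt_le_trans zj)// node_le.
Qed.

Lemma Vspace0 (a b : R) (p : {poly R}) : (size p <= k.+1)%N ->
  Vspace k 0 a b (fun x => if a <= x < b then p.[x] else 0).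
Proof.
move=> ps; have sE i : (i <= 1)%N -> nth 0 (ugrid 0 a b) i = a + i%:R * (b - a).
  by move=> i1; rewrite nth_ugrid ?expn0// expr0 divr1.
split=> [i|x].
  rewrite size_ugrid expn0 !ltnS leqn0 => /eqP ->; exists p => // x.
  by rewrite !sE// mul0r addr0 mul1r subrKC => ->.
rewrite -nth_last size_ugrid -nth0 !sE//= mul0r addr0 mul1r subrKC.
by move=> /negbTE ->.
Qed.

Let half_itv : 0 < (meshsize N / 2 : R) < 1.
Proof.
rewrite half_node /node divr_gt0 ?ltr0n//= ltr_pdivrMr ?ltr0n// mul1r ltr_nat.
by rewrite -[1%N](expn0 2) ltn_exp2l.
Qed.

Lemma WspaceD_even_continuous l : (l <= N)%N -> WspaceD k N l `<=` even_continuous.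
Proof.
have /andP[h0 h1] := half_itv.
case: l => [_ f [fV f0]|l lN _ [f /Wspace_Vspace fV ->]]; last first.
  apply: (shift_even_continuous lN _ _ fV) => //.
  - by rewrite opprK subrK.
  - move=> x /andP[x0 x1]; rewrite x0 (lt_trans x1)//.
    by rewrite gtrBl.
  - exists 0; first by rewrite size_poly0.
    move=> x /andP[h2 h3]; rewrite horner0; case: ifP => // _.
    by apply: (Vspace_out fV); rewrite negb_and -!leNgt h2 orbT.
  - by move=> x /negbTE ->.
(* Level 0 has the two cells [0, 1 - h_N/2) and [1 - h_N/2, 1), with independent polynomials [p] and
   [r]. *)
have [//|p ps pf] := fV 0%N; have [//|r rs rf] := fV 1%N.
rewrite /= /meshsize expr0 invr1 mulr1 -/(meshsize N) in pf rf f0.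
apply: (shift_even_continuous (leq0n N) _ _ (Vspace0 (- (meshsize N / 2)) (1 - meshsize N / 2) ps)) => //.
- by rewrite opprK subrK.
- move=> x /andP[x0 x1]; rewrite pf ?x0//= ifT// x1 andbT.
  by rewrite (le_trans _ x0)// oppr_le0 ltW.
- by exists r.
Qed.

(** The first cell has length at least h_N and so contains [-h_N/2, h_N/2). One polynomial [q]
    therefore describes the function just after 0 and, shifted by 1, on the last half cell, which
    gives the match between 1 and 0. *)
Lemma perext_circle_continuous l f : (l <= N)%N ->
  let a := - (meshsize N / 2) in Vspace k l a (a + 1) f ->
  circle_continuous
    (fun x => if 0 <= x < 1 then f (x - (Num.floor (x - a))%:~R) else 0).
Proof.
have /andP[h0 h1] := half_itv.
move=> lN a fV; have a1 : a + 1 - a = 1 by rewrite addrC addKr.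
have [q qs qf] : exists2 q : {poly R}, (size q <= k.+1)%N &
    forall z, a <= z < - a -> f z = q.[z].
  have [|q qs qf] := fV.1 0%N; first by rewrite size_ugrid ltnS expn_gt0.
  exists q => // z /andP[az za]; apply: qf.
  rewrite !nth_ugrid ?expn_gt0// mul0r addr0 az mul1r a1 mul1r.
  apply: (lt_le_trans za); rewrite /a.
  have : meshsize N <= 2 ^- l :> R by rewrite lef_pV2 ?posrE ?exprn_gt0// ler_weXn2l ?ler1n.
  lra.
set g := (fun x => _).
have gl x0 : 0 <= x0 < 1 + a -> g x0 = f x0.
  move=> /andP[z0 z1]; rewrite /g z0 /= ifT; last by rewrite /a in z1 *; lra.
  rewrite (_ : Num.floor _ = 0) ?subr0//; apply: floor_def; rewrite /a in z1 *.
  by rewrite add0r subr_ge0; apply/andP; split; lra.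
have gr x0 : 1 + a <= x0 < 1 -> g x0 = q.[x0 - 1].
  move=> /andP[z0 z1]; rewrite /g ifT; last by rewrite /a in z0 *; lra.
  rewrite (_ : Num.floor _ = 1) ?qf//; first by rewrite /a in z0 *; lra.
  by apply: floor_def; rewrite /a in z0 *; apply/andP; split; lra.
split.
  apply: (shift_even_continuous lN a1 _ fV) => //.
  - exists (q \Po ('X - 1%:P)).
      by rewrite size_comp_poly2// size_XsubC.
    by move=> z /gr ->; rewrite horner_comp !hornerE.
  - by move=> z /negbTE; rewrite /g => ->.
rewrite (gl 0) ?qf; last 2 first.
- by rewrite /a; lra.
- by rewrite /a; lra.
have -> : q.[0] = (q \Po ('X - 1%:P)).[1] by rewrite horner_comp !hornerE subrr.
apply: (@poly_left_cvg _ g _ (1 + a)); first by rewrite /a; lra.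
by move=> z /gr ->; rewrite horner_comp !hornerE.
Qed.

End one_dim_spaces.

(** * Spans of tensor products *)

Section tensor_spans.
Context {R : realType}.
Implicit Types (S : set (R -> R)) (n : nat).

Definition tspan n S : set ('rV[R]_n -> R) :=
  lin_span [set F | exists2 f : 'I_n -> R -> R, (forall i, S (f i)) & F = tensor f].
Arguments tspan : clear implicits.

Lemma sparse_space_tspan n N (W : nat -> set (R -> R)) S :
  (forall l, (l <= N)%N -> W l `<=` S) ->
  sparse_space N W `<=` tspan n S.
Proof.
move=> WS F [m [c [s [sW ->]]]]; exists m, c, s; split => // j.
have [l [lN [f [fW ->]]]] := sW j; exists f => // i.
apply: (WS (l i)) => //; apply: leq_trans lN.
by rewrite (bigD1 i) //= leq_addr.
Qed.

Lemma restrict_perext_tspan n N (a : R) (W : nat -> set (R -> R)) S :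
  (forall l f, (l <= N)%N -> W l f ->
     S (fun x => if 0 <= x < 1 then f (x - (Num.floor (x - a))%:~R) else 0)) ->
  forall F : 'rV[R]_n -> R, sparse_space N W F ->
    tspan n S (restrict_cube (perext a F)).
Proof.
move=> WS F [m [c [s [sW ->]]]].
have /choice[f fP] : forall j, exists f : 'I_n -> R -> R,
    (forall i, S (fun x => if 0 <= x < 1 then f i (x - (Num.floor (x - a))%:~R) else 0))
    /\ s j = tensor f.
  move=> j; have [l [lN [f [fW ->]]]] := sW j; exists f; split=> // i.
  apply: (WS (l i)) => //; apply: leq_trans lN.
  by rewrite (bigD1 i) //= leq_addr.
pose g j i x := if 0 <= x < 1 then f j i (x - (Num.floor (x - a))%:~R) else 0.
exists m, c, (fun j => tensor (g j)); split.
  by move=> j; exists (g j) => // i; exact: (fP j).1.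
apply/funext => x; rewrite /restrict_cube; case: ifPn => [/forallP x01|].
  apply: eq_bigr => j _; rewrite (fP j).2 /perext /tensor; congr (_ * _).
  by apply: eq_bigr => i _; rewrite mxE /g x01.
rewrite negb_forall => /existsP[i xi].
rewrite big1// => j _; rewrite /tensor (bigD1 i)//= /g (negbTE xi) mul0r mulr0 //.
Qed.

(** Linearity is asked on [S] only: the functionals in view are limits, which add up where they
    exist. *)
Definition linear_on S (La : (R -> R) -> R) :=
  forall m (c : 'I_m -> R) (f : 'I_m -> R -> R), (forall j, S (f j)) ->
    La (fun s => \sum_(j < m) c j * f j s) = \sum_(j < m) c j * La (f j).

Lemma lim_linear_on S (ev : (R -> R) -> R -> R) (Fi : set_system R)
    {PF : ProperFilter Fi} :
  (forall f g c s, ev (fun x => f x + c * g x) s = ev f s + c * ev g s) ->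
  (forall f, S f -> cvg (ev f s @[s --> Fi])) ->
  linear_on S (fun f => lim (ev f s @[s --> Fi])).
Proof.
move=> evl evc m c f Sf; apply/cvg_lim => //.
have ev0 s : ev (fun=> 0) s = 0.
  transitivity (ev (fun=> 0) s + -1 * ev (fun=> 0) s); last by rewrite mulN1r subrr.
  by rewrite -evl; congr ev; apply/funext => x; rewrite mulr0 addr0.
have evE s : ev (fun x => \sum_(j < m) c j * f j x) s = \sum_(j < m) c j * ev (f j) s.
  elim: m c f {Sf} => [|m IHm] c f.
    by rewrite big_ord0 -[RHS](ev0 s); congr ev; apply/funext => x; rewrite big_ord0.
  rewrite big_ord_recr /= -IHm -evl; congr ev; apply/funext => x.
  by rewrite big_ord_recr /=.
rewrite (_ : (fun s => ev _ s) = fun s => \sum_(j < m) c j * ev (f j) s); last first.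
  exact/funext.
apply: cvg_big; first exact: add_continuous.
move=> j _; apply: cvgM; first exact: cvg_cst.
exact/evc.
Qed.

Lemma tensor_insx n (i : 'I_n.+1) (f : 'I_n.+1 -> R -> R) s (y : 'rV[R]_n) :
  tensor f (insx i s y) = (\prod_(m < n) f (lift i m) (y ord0 m)) * f i s.
Proof.
rewrite /tensor (bigD1_ord i)//= mulrC insxE_same; congr (_ * _).
by apply: eq_bigr => m _; rewrite insxE_lift.
Qed.

(** On a line in direction [i] the other factors of each tensor are constants, so the slice is a
    linear combination of the i-th factors. *)
Lemma tspan_slice n S (i : 'I_n.+1) F y : S (fun=> 0) -> lin_closed S ->
  tspan n.+1 S F -> S (fun s => F (insx i s y)).
Proof.
move=> S0 Slin [m [c [s [sS ->]]]]; elim: m c s sS => [|m IHm] c s sS.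
  by rewrite (_ : (fun _ => _) = fun=> 0)//; apply/funext => x; rewrite big_ord0.
rewrite (_ : (fun _ => _) = fun x =>
    \sum_(j < m) c (widen_ord (leqnSn m) j) * s (widen_ord (leqnSn m) j) (insx i x y) +
    c ord_max * s ord_max (insx i x y)); last first.
  by apply/funext => x; rewrite big_ord_recr.
have [f fS ->] := sS ord_max.
rewrite (_ : (fun _ => _) = fun x =>
    \sum_(j < m) c (widen_ord (leqnSn m) j) * s (widen_ord (leqnSn m) j) (insx i x y) +
    (c ord_max * \prod_(m < n) f (lift i m) (y ord0 m)) * f i x); last first.
  by apply/funext => x; rewrite tensor_insx mulrA.
apply: Slin => //.
exact: (IHm (fun j => c (widen_ord (leqnSn m) j)) (fun j => s (widen_ord (leqnSn m) j))).
Qed.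

(** A functional acting along the line, such as a one-sided limit or a derivative, leaves a finite
    sum of products of functions of the other coordinates. Measurability of traces and gradients
    comes from here. *)
Lemma tspan_linear_on n S (i : 'I_n.+1) F : tspan n.+1 S F ->
  exists m (c : 'I_m -> R) (f : 'I_m -> 'I_n.+1 -> R -> R),
    (forall j l, S (f j l)) /\
    forall La, linear_on S La -> forall y, La (fun s => F (insx i s y)) =
      \sum_(j < m) (c j * \prod_(l < n) f j (lift i l) (y ord0 l)) * La (f j i).
Proof.
move=> [m [c [s [sS ->]]]].
have /choice[f fP] : forall j, exists f : 'I_n.+1 -> R -> R,
    (forall l, S (f l)) /\ s j = tensor f.
  by move=> j; have [f fS ->] := sS j; exists f.
exists m, c, f; split => [j l|La Llin y]; first exact: (fP j).1.
rewrite -Llin; last by move=> j; exact: (fP j).1.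
congr La; apply/funext => x; apply: eq_bigr => j _.
by rewrite (fP j).2 tensor_insx mulrA.
Qed.

Variable (S : set (R -> R)).
Hypothesis Sbmf : forall f, S f -> bmf setT f.

Lemma bmf_coord n (D : set 'rV[R]_n) (i : 'I_n) (f : R -> R) : bmf setT f ->
  bmf D (fun x => f (x ord0 i)).
Proof.
move=> bf; apply: (bmf_comp (E := setT) (h := fun x : 'rV[R]_n => x ord0 i)) => //.
exact: measurable_funTS (measurable_coord i).
Qed.

Lemma bmf_slice n (i : 'I_n.+1) F La (D : set 'rV[R]_n) : tspan n.+1 S F ->
  linear_on S La -> bmf D (fun y => La (fun s => F (insx i s y))).
Proof.
move=> /(tspan_linear_on i)[m [c [f [fS H]]]] Llin.
apply: eq_bmf (fun y _ => esym (H _ Llin y)) _.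
apply: bmf_sum => j _; apply: bmfM; last exact: bmf_cst.
apply: bmfZ; apply: bmf_prod => l _.
exact: (bmf_coord _ l (Sbmf (fS j (lift i l)))).
Qed.

Lemma bmf_slice_coord n (i : 'I_n.+1) F La (D : set 'rV[R]_n.+1) :
  tspan n.+1 S F -> (forall s, linear_on S (La s)) ->
  (forall f, S f -> bmf setT (fun s => La s f)) ->
  bmf D (fun x => La (x ord0 i)
    (fun s => F (insx i s (\row_l x ord0 (lift i l))))).
Proof.
move=> /(tspan_linear_on i)[m [c [f [fS H]]]] Llin Lb.
apply: eq_bmf (fun x _ => esym (H _ (Llin _) _)) _.
apply: bmf_sum => j _; apply: bmfM; last exact: (bmf_coord _ i (Lb _ (fS j i))).
apply: bmfZ; apply: bmf_prod => l _.
apply: (@eq_bmf _ _ _ _ (fun x : 'rV[R]_n.+1 => f j (lift i l) (x ord0 (lift i l)))).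
  by move=> x _; rewrite mxE.
exact: (bmf_coord _ (lift i l) (Sbmf (fS j (lift i l)))).
Qed.

Lemma bmf_tspan n F (D : set 'rV[R]_n) : tspan n S F -> bmf D F.
Proof.
move=> [m [c [s [sS ->]]]]; apply: bmf_sum => j _; apply: bmfZ.
have [f fS ->] := sS j; apply: bmf_prod => i _.
exact: (bmf_coord _ i (Sbmf (fS i))).
Qed.

End tensor_spans.
Arguments tspan {R} n S _.

(** * Point values as coordinates of a finite-dimensional space *)

Section interpolation.
Context {R : realType}.

(** Greedy elimination: a point [w] where the next function differs from its interpolant becomes a
    new node, the normalised error is its basis function, and the earlier ones are corrected to
    vanish at [w]. If there is no such point, the old nodes suffice. *)
Lemma finite_interpolation d (X : measurableType d) (D : set X) n
    (s : 'I_n -> X -> R) : (forall j, bmf D (s j)) ->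
  exists r (x : 'I_r -> X) (L : 'I_r -> X -> R), (forall m, bmf D (L m)) /\
    forall j z, s j z = \sum_(m < r) s j (x m) * L m z.
Proof.
elim: n s => [|n IHn] s sb.
  have x0 : 'I_0 -> X by case.
  by exists 0%N, x0, (fun _ _ => 0); split; case.
have [r [x [L [Lb LE]]]] := IHn (fun j => s (lift ord0 j)) (fun j => sb _).
pose e z := s ord0 z - \sum_(m < r) s ord0 (x m) * L m z.
have eb : bmf D e by apply: bmfB => //; apply: bmf_sum => m _; exact: bmfZ.
have [[w ew]|e0] := pselect (exists w, e w != 0); last first.
  exists r, x, L; split => // j z; case: (unliftP ord0 j) => [j'|] ->.
    exact: LE.
  apply/eqP; rewrite -subr_eq0; apply: contrapT => /negP ez.
  by apply: e0; exists z.
pose L0 z := e z / e w.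
exists r.+1, (fun i => oapp x w (unlift ord0 i)),
  (fun i => oapp (fun m z => L m z - L m w * L0 z) L0 (unlift ord0 i)); split.
  have L0b : bmf D L0 by apply: bmfM => //; exact: bmf_cst.
  by move=> m; case: unliftP => [m'|] _ //=; apply: bmfB => //; exact: bmfZ.
have key f z : f w * L0 z + \sum_(m < r) f (x m) * (L m z - L m w * L0 z) =
    \sum_(m < r) f (x m) * L m z + (f w - \sum_(m < r) f (x m) * L m w) * L0 z.
  under [X in _ + X = _]eq_bigr do rewrite mulrBr mulrA.
  by rewrite sumrB -mulr_suml; ring.
move=> j z; rewrite big_ord_recl unlift_none /=.
under eq_bigr do rewrite liftK /=.
rewrite key; case: (unliftP ord0 j) => [j'|] ->.
  by rewrite -!LE subrr mul0r addr0.
by rewrite -/(e w) /L0 mulrCA divff// mulr1 /e addrC subrK.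
Qed.

Lemma ppoly_basis k M (f : R -> R) : ppoly k M f ->
  exists c : 'I_M * 'I_k.+1 -> R, forall x, f x = \sum_e c e *
    (if node M e.1 <= x < node M e.1.+1 then x ^+ e.2 else 0).
Proof.
move=> [p ps ->]; exists (fun e : 'I_M * 'I_k.+1 => (p e.1)`_e.2) => x.
rewrite /glue -(pair_bigA _ (fun (j : 'I_M) (i : 'I_k.+1) => (p j)`_i *
  (if node M j <= x < node M j.+1 then x ^+ i else 0))) /=.
apply: eq_bigr => j _; case: ifPn => _.
  by rewrite (horner_coef_wide _ (ps j)).
by rewrite big1// => i _; rewrite mulr0.
Qed.

(** Products of truncated monomials are a finite spanning family. The nodes and the functions [L]
    are the same for all [F], hence for a solution at all times. *)
Lemma tspan_interpolation k M n (D : set 'rV[R]_n) :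
  exists r (x : 'I_r -> 'rV[R]_n) (L : 'I_r -> 'rV[R]_n -> R),
    (forall m, bmf D (L m)) /\
    forall F, tspan n (ppoly k M) F -> forall z, F z = \sum_(m < r) F (x m) * L m z.
Proof.
pose b (e : 'I_M * 'I_k.+1) (x : R) : R :=
  if node M e.1 <= x < node M e.1.+1 then x ^+ e.2 else 0.
have bb e : bmf setT (b e).
  apply: eq_bmf (bmf_glue M (fun j => if j == e.1 :> nat then 'X^(e.2) else 0) setT).
  move=> x _; rewrite /glue (bigD1 e.1)//= eqxx hornerXn big1 ?addr0// => j je.
  by rewrite ifN_eq // horner0 if_same.
pose E : finType := {ffun 'I_n -> 'I_M * 'I_k.+1}.
pose B (phi : E) := tensor (fun i => b (phi i)).
have [|r [x [L [Lb LE]]]] :=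
    @finite_interpolation _ 'rV[R]_n D #|E| (fun j => B (enum_val j)).
  move=> j; apply: bmf_prod => i _.
  exact: (bmf_coord _ i (bb (enum_val j i))).
exists r, x, L; split => // F [m [c [s [sP ->]]]] z.
have LB phi y : B phi y = \sum_(m < r) B phi (x m) * L m y.
  by have := LE (enum_rank phi) y; rewrite enum_rankK.
transitivity (\sum_(j < m) c j * \sum_(l < r) s j (x l) * L l z); last first.
  under [RHS]eq_bigr do rewrite mulr_suml.
  rewrite exchange_big; apply: eq_bigr => j _.
  by rewrite mulr_sumr; apply: eq_bigr => l _; rewrite mulrA.
apply: eq_bigr => j _; congr (_ * _); have [f fP ->] := sP j.
have /choice[a aP] : forall i, exists a : 'I_M * 'I_k.+1 -> R,
    forall y, f i y = \sum_e a e * b e y by move=> i; exact: ppoly_basis.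
have tE y : tensor f y = \sum_(phi : E) (\prod_i a i (phi i)) * B phi y.
  rewrite /tensor (eq_bigr (fun i => \sum_e a i e * b e (y ord0 i))); last first.
    by move=> i _; rewrite aP.
  rewrite bigA_distr_bigA; apply: eq_bigr => phi _.
  by rewrite /B /tensor -big_split.
rewrite tE; under [RHS]eq_bigr do rewrite tE mulr_suml.
rewrite exchange_big; apply: eq_bigr => phi _.
by rewrite LB mulr_sumr; apply: eq_bigr => l _; rewrite mulrA.
Qed.

End interpolation.

(** * Energy in time and the Gronwall lemma *)

Section time_derivative.
Context {R : realType}.
Local Notation mu := (@lebesgue_measure R).

(** The differential inequality fails on a null set of times, so it is integrated: continuity of
    [E'] makes e^(-K t) E(t) the integral of its derivative, and the integral does not see null
    sets. *)
Lemma gronwall_ae (T K : R) (E E' D : R -> R) : 0 < T -> 0 <= K -> 0 <= E 0 ->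
  {within `[0, T], continuous E} -> {within `[0, T], continuous E'} ->
  (forall t : R, 0 < t < T -> is_derive t 1 E (E' t)) ->
  (forall t, 0 <= D t) -> mu.-integrable `[0, T] (EFin \o D) ->
  {ae mu, forall t, `[0, T]%classic t -> E' t <= K * E t + D t} ->
  forall t : R, 0 <= t <= T ->
    E t <= expR (K * T) * (E 0 + \int[mu]_(s in `[0, T]) D s).
Proof.
move=> T0 K0 E0 cE cE' dE D0 iD aeE t /andP[t0 tT].
have ID0 : 0 <= \int[mu]_(s in `[0, T]) D s by apply: Rintegral_ge0.
have KT1 : 1 <= expR (K * T).
  by rewrite -expR0 ler_expR mulr_ge0// ltW.
move: t0; rewrite le_eqVlt => /predU1P[<-|t0].
  by rewrite -[leLHS]mul1r ler_pM// lerDl.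
have sub0t : `[0, t] `<=` `[0, T].
  by apply: subset_itvl; rewrite bnd_simp.
pose w (s : R) := expR (- (K * s)).
have w01 (s : R) : 0 <= s -> 0 < w s <= 1.
  by move=> s0; rewrite expR_gt0 -[leRHS]expR0 ler_expR oppr_le0 mulr_ge0.
have dw (s : R) : is_derive s 1 w (- K * w s).
  have dl : is_derive s 1 (fun s : R => - (K * s)) (- K).
    have := is_deriveN (is_deriveZ K (is_derive_id s (1 : R))).
    by rewrite /GRing.scale /= mulr1.
  have H := @is_derive1_comp _ expR (fun s : R => - (K * s)) s _ _
    (is_derive_expR (- (K * s))) dl.
  by rewrite mulrC; exact: H.
have cw : continuous w.
  move=> s; apply: differentiable_continuous; apply/derivable1_diffP.
  exact: (@ex_derive _ _ _ _ _ _ _ (dw s)).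
pose F s := w s * E s; pose f s := w s * (E' s - K * E s).
have cEt : {within `[0, t], continuous E} by exact: continuous_subspaceW cE.
have cE't : {within `[0, t], continuous E'} by exact: continuous_subspaceW cE'.
have cwt : {within `[0, t], continuous w} by exact: continuous_subspaceT.
have cF : {within `[0, t], continuous F}.
  by move=> s; apply: cvgM; [exact: cwt|exact: cEt].
have cf : {within `[0, t], continuous f}.
  move=> s; apply: cvgM; first exact: cwt.
  by apply: cvgB; [exact: cE't|apply: cvgM; [exact: cvg_cst|exact: cEt]].
have dF (s : R) : 0 < s < t -> is_derive s 1 F (f s).
  move=> /andP[s0 st]; have dEs : is_derive s 1 E (E' s).
    by apply: dE; rewrite s0 (lt_le_trans st).
  have H := is_deriveM (dw s) dEs; apply: (@is_derive_eq _ _ _ (w * E) _ _ _ _ H).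
  by rewrite /f /GRing.scale /=; ring.
have FTC : (\int[mu]_(s in `[0%R, t]) (f s)%:E = (F t)%:E - (F 0)%:E)%E.
  apply: continuous_FTC2 => //.
  - have [_ c0 c1] := (continuous_within_itvP F t0).1 cF; split => // s.
    rewrite in_itv => /dF dFs; exact: (@ex_derive _ _ _ _ _ _ _ dFs).
  - move=> s; rewrite in_itv => /dF dFs; rewrite derive1E.
    exact: (@derive_val _ _ _ _ _ _ _ dFs).
have compt := @segment_compact R 0 t.
have intf := continuous_compact_integrable compt cf.
have mf : measurable_fun (`[0, t]%classic : set R) f.
  by apply/measurable_EFinP; exact: measurable_int intf.
(* The almost-everywhere comparison is made between nonnegative functions; since [D] is nonnegative,
   the positive part of [f] stays below [D]. *)
pose g s := Num.max (f s) 0.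
have mg : measurable_fun (`[0, t]%classic : set R) g.
  exact: measurable_maxr.
have intD : mu.-integrable `[0, t] (EFin \o D) by apply: integrableS iD.
have FD : (F t - F 0)%:E%E = (\int[mu]_(s in `[0%R, t]) (f s)%:E)%E by rewrite FTC.
have H1 : (\int[mu]_(s in `[0%R, t]) (f s)%:E <= \int[mu]_(s in `[0%R, t]) (g s)%:E)%E.
  have intg : mu.-integrable `[0, t] (EFin \o g) by exact: integrable_funrpos.
  apply: le_integral => // s _.
  by rewrite lee_fin le_max lexx.
have H2 : (\int[mu]_(s in `[0%R, t]) (g s)%:E <= \int[mu]_(s in `[0%R, t]) (D s)%:E)%E.
  apply: ae_ge0_le_integral => //.
  - by move=> s _; rewrite lee_fin le_max lexx orbT.
  - exact/measurable_EFinP.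
  - by move=> s _; rewrite lee_fin.
  - exact: measurable_int intD.
  - have [Z [mZ Z0 ZP]] := aeE; exists Z; split=> //; apply: subset_trans ZP.
    apply: subsetC => s Es st; have := Es (sub0t _ st).
    move: st; rewrite /= in_itv/= => /andP[s0 _] ED; rewrite lee_fin ge_max D0 andbT.
    have /andP[w0 w1] := w01 s s0.
    rewrite /f (@le_trans _ _ (w s * D s))//.
      by rewrite ler_wpM2l ?(ltW w0)// lerBlDl.
    by rewrite ler_piMl.
have H3 : (\int[mu]_(s in `[0%R, t]) (D s)%:E <= \int[mu]_(s in `[0%R, T]) (D s)%:E)%E.
  apply: ge0_subset_integral => //.
  - exact: measurable_int iD.
  - by move=> s _; rewrite lee_fin.
have Ft : F t <= E 0 + \int[mu]_(s in `[0, T]) D s.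
  have F0 : F 0 = E 0 by rewrite /F /w mulr0 oppr0 expR0 mul1r.
  rewrite -F0 -lerBlDl -lee_fin FD (le_trans H1)// (le_trans H2)// (le_trans H3)//.
  by rewrite /Rintegral fineK//; exact: integrable_fin_num.
have -> : E t = expR (K * t) * F t.
  by rewrite /F /w mulrA -expRD subrr expR0 mul1r.
rewrite (@le_trans _ _ (expR (K * t) * (E 0 + \int[mu]_(s in `[0, T]) D s)))//.
  by rewrite ler_wpM2l// expR_ge0.
by rewrite ler_wpM2r ?addr_ge0// ler_expR ler_wpM2l.
Qed.

Section within_derivative.
Variables (T : R) (c c' : R -> R).
Hypothesis T0 : 0 < T.
Hypothesis dc : forall t, t \in `[0, T] ->
  (c s - c t) / (s - t) @[s --> within `[0, T] t^'] --> c' t.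

Let quotient_near t e : t \in `[0, T] -> 0 < e ->
  exists2 r, 0 < r & forall s, `|s - t| < r -> s \in `[0, T] -> s != t ->
    `|c' t - (c s - c t) / (s - t)| < e.
Proof.
move=> tT e0; have /cvgrPdist_lt/(_ e e0) := dc tT.
move=> [r /= r0 H]; exists r => // s sr sT st.
by apply: H => //=; rewrite distrC.
Qed.

Lemma within_quotient_derive t : 0 < t < T -> is_derive t 1 c (c' t).
Proof.
move=> /andP[t0 tT]; have tT' : t \in `[0, T] by rewrite in_itv/= !ltW.
have H : (fun h : R => h^-1 *: ((c \o shift t) (h *: 1) - c t)) @ 0^' --> c' t.
  apply/cvgrPdist_lt => e e0; have [r r0 Hr] := quotient_near tT' e0.
  pose m := Num.min r (Num.min t (T - t)).
  have m0 : 0 < m by rewrite !lt_min r0 t0 subr_gt0.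
  exists m => //= h /=; rewrite sub0r normrN !lt_min => /and3P[hr ht hT] h0.
  have hE : h = h + t - t by rewrite addrK.
  have := Hr (h + t); rewrite addrK => /(_ hr); rewrite /shift /= [h%:A]mulr1.
  rewrite mulrC; apply.
    by move: ht hT; rewrite !ltr_norml in_itv/= => /andP[? ?] /andP[? ?]; apply/andP; split; lra.
  by apply: contra_neq h0 => /eqP; rewrite -subr_eq0 addrK => /eqP.
by split; [apply/cvg_ex; eexists; exact: H|exact/cvg_lim].
Qed.

Lemma within_quotient_continuous : {within `[0, T], continuous c}.
Proof.
apply/subspace_continuousP => t tT; apply/cvgrPdist_lt => e e0.
have tT' : t \in `[0, T] by exact: tT.
have [r r0 Hr] := quotient_near tT' ltr01.
pose b := `|c' t| + 1; have b0 : 0 < b by rewrite ltr_wpDl.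
pose m := Num.min r (e / b).
have m0 : 0 < m by rewrite lt_min r0 divr_gt0.
exists m => //= s /=; rewrite lt_min => /andP[sr se] sT.
have [->|st] := eqVneq s t; first by rewrite subrr normr0.
have st0 : s - t != 0 by rewrite subr_eq0.
have := Hr s _ sT st; rewrite distrC => /(_ sr) Hq.
have -> : c t - c s = - ((c s - c t) / (s - t)) * (s - t) by rewrite mulNr divfK// opprB.
have qb : `|(c s - c t) / (s - t)| < b.
  rewrite /b -ltrBlDl (le_lt_trans _ Hq)// distrC.
  exact: lerB_dist.
rewrite mulNr normrN normrM; rewrite distrC ltr_pdivlMr// in se.
rewrite (le_lt_trans _ se)// mulrC ler_wpM2l// ltW//.
Qed.

End within_derivative.

(** No point of [0, T] is isolated in it, endpoints included; this makes the limits defining time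
    derivatives unique. *)
Lemma within_itv_dnbhs_proper (T t : R) : 0 < T -> t \in `[0, T] ->
  ProperFilter (within `[0, T] t^').
Proof.
move=> T0; rewrite in_itv /= => /andP[t0 tT].
split; last exact: within_filter.
move=> [r /= r0 H].
have [tT'|Tt] := ltP t T.
  pose m := Num.min (r / 2) (T - t).
  have m0 : 0 < m by rewrite lt_min divr_gt0//= subr_gt0.
  have mr : m <= r / 2 by rewrite ge_min lexx.
  have mT : m <= T - t by rewrite ge_min lexx orbT.
  apply: (H (t + m)) => /=.
  - by rewrite opprD addNKr normrN gtr0_norm//; lra.
  - by rewrite gt_eqF// ltrDl.
  - by rewrite in_itv/=; apply/andP; split; lra.
pose m := Num.min (r / 2) T.
have m0 : 0 < m by rewrite lt_min divr_gt0.
have mr : m <= r / 2 by rewrite ge_min lexx.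
have mT : m <= T by rewrite ge_min lexx orbT.
apply: (H (t - m)) => /=.
- by rewrite subKr gtr0_norm//; lra.
- by rewrite lt_eqF// gtrBl.
- by rewrite in_itv/=; apply/andP; split; lra.
Qed.

End time_derivative.

Section energy_in_time.
Context {R : realType} (n k M : nat) (T : R) (u ut : R -> 'rV[R]_n -> R).
Hypothesis T0 : 0 < T.
Hypothesis u_span : forall t, t \in `[0, T] -> tspan n (ppoly k M) (u t).
Hypothesis u_C1 : C1_in_time T u ut.

(** In the coordinates given by finitely many point values, the squared norm is a quadratic form
    with constant Gram matrix [G]; it inherits differentiability from the point values. *)
Lemma energy_in_time : (forall t, t \in `[0, T] -> bmf (cube R n) (ut t)) /\
  exists E E' : R -> R,
    [/\ {within `[0, T], continuous E}, {within `[0, T], continuous E'},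
        forall t : R, 0 < t < T -> is_derive t 1 E (E' t) &
        forall t, t \in `[0, T] -> E t = L2sq (u t) /\
          E' t = 2 * int_cube (fun x => ut t x * u t x)].
Proof.
have [r [x [L [Lb uL]]]] := @tspan_interpolation R k M n (cube R n).
(* The interpolation formula holds for difference quotients and passes to the limit. *)
have utL t z : t \in `[0, T] -> ut t z = \sum_(m < r) ut t (x m) * L m z.
  move=> tT; have PF := within_itv_dnbhs_proper T0 tT.
  have H1 := (u_C1 z).1 t tT.
  have H2 : \sum_(m < r) ((u s (x m) - u t (x m)) / (s - t)) * L m z
      @[s --> within `[0, T] t^'] --> \sum_(m < r) ut t (x m) * L m z.
    apply: cvg_big; first exact: add_continuous.
    move=> m _; apply: cvgM; last exact: cvg_cst.
    exact: (u_C1 (x m)).1.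
  suff H3 : (u s z - u t z) / (s - t) @[s --> within `[0, T] t^'] -->
      \sum_(m < r) ut t (x m) * L m z.
    by rewrite -(cvg_lim (@Rhausdorff R) H1) -(cvg_lim (@Rhausdorff R) H3).
  apply: cvg_trans H2.
  have W : within `[0, T] t^' `[0, T]%classic.
    exact: withinT.
  apply: near_eq_cvg; apply: filterS W => s; rewrite /= => sT.
  rewrite (uL _ (u_span sT) z) (uL _ (u_span tT) z) -sumrB mulr_suml.
  by apply: eq_bigr => m _; rewrite -mulrBl mulrAC.
split.
  move=> t tT; apply: eq_bmf (fun z _ => esym (utL t z tT)) _.
  by apply: bmf_sum => m _; exact: bmfZ.
pose G m l := int_cube (fun z => L m z * L l z).
have Gsym m l : G m l = G l m.
  by rewrite /G; congr int_cube; apply/funext => z; rewrite mulrC.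
have mC := @measurable_cube R n.
have intLL m l c : (lebesgue_rV R n).-integrable (cube R n)
    (EFin \o (fun z => c * (L m z * L l z))).
  by apply: bmf_integrable => //; [exact: lebesgue_cube_lty|apply/bmfZ/bmfM].
have GE (a b : 'I_r -> R) :
    int_cube (fun z => (\sum_(m < r) a m * L m z) * (\sum_(l < r) b l * L l z)) =
    \sum_(m < r) \sum_(l < r) a m * b l * G m l.
  rewrite /int_cube.
  rewrite (@eq_Rintegral _ _ _ _ _ (fun z => \sum_(m < r) \sum_(l < r) a m * b l * (L m z * L l z))).
    rewrite Rintegral_sum//.
      apply: eq_bigr => m _; rewrite Rintegral_sum//.
      apply: eq_bigr => l _; rewrite RintegralZl//.
      by apply: bmf_integrable => //; [exact: lebesgue_cube_lty|exact: bmfM].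
    move=> m _; apply: bmf_integrable => //; first exact: lebesgue_cube_lty.
    by apply: bmf_sum => l _; apply/bmfZ/bmfM.
  move=> z _; rewrite mulr_suml; apply: eq_bigr => m _.
  by rewrite mulr_sumr; apply: eq_bigr => l _; rewrite mulrACA.
pose c m t := u t (x m); pose c' m t := ut t (x m).
have dc m t : t \in `[0, T] ->
    (c m s - c m t) / (s - t) @[s --> within `[0, T] t^'] --> c' m t.
  exact: (u_C1 (x m)).1.
have cc m := within_quotient_continuous (dc m).
have cc' m : {within `[0, T], continuous (c' m)} by exact: (u_C1 (x m)).2.
exists (fun t => \sum_(m < r) \sum_(l < r) c m t * c l t * G m l).
exists (fun t => 2 * \sum_(m < r) \sum_(l < r) c' m t * c l t * G m l).
split.
- move=> t; apply: cvg_big; first exact: add_continuous.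
  move=> m _; apply: cvg_big; first exact: add_continuous.
  move=> l _; apply: cvgM; last exact: cvg_cst.
  by apply: cvgM; exact: cc.
- move=> t; apply: cvgM; first exact: cvg_cst.
  apply: cvg_big; first exact: add_continuous.
  move=> m _; apply: cvg_big; first exact: add_continuous.
  move=> l _; apply: cvgM; last exact: cvg_cst.
  by apply: cvgM; [exact: cc'|exact: cc].
- move=> t t0T.
  have dd m := within_quotient_derive (dc m) t0T.
  have -> : (fun t => \sum_(m < r) \sum_(l < r) c m t * c l t * G m l) =
      \sum_(m < r) \sum_(l < r) (G m l *: (c m * c l)).
    apply/funext => s; rewrite fct_sumE; apply: eq_bigr => m _.
    by rewrite fct_sumE; apply: eq_bigr => l _; rewrite mulrC.
  have H : is_derive t 1 (\sum_(m < r) \sum_(l < r) (G m l *: (c m * c l)))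
     (\sum_(m < r) \sum_(l < r) (G m l *: (c m t *: c' l t + c l t *: c' m t))).
    have d2 m l := is_deriveZ (G m l) (is_deriveM (dd m) (dd l)).
    have d1 m := is_derive_sum (fun l => d2 m l).
    exact: (is_derive_sum d1).
  apply: (is_derive_eq H).
  rewrite mulr2n mulrDl mul1r.
  transitivity (\sum_(m < r) \sum_(l < r) c' l t * c m t * G l m +
      \sum_(m < r) \sum_(l < r) c' m t * c l t * G m l).
    rewrite -big_split; apply: eq_bigr => m _ /=; rewrite -big_split.
    apply: eq_bigr => l _ /=; rewrite /GRing.scale /= (Gsym l m); ring.
  by rewrite exchange_big.
- move=> t tT; have uE := uL _ (u_span tT); split.
  + rewrite -GE /L2sq; congr int_cube; apply/funext => z.
    by rewrite uE expr2.
  + rewrite -GE; congr (_ * int_cube _); apply/funext => z.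
    by rewrite -uE -utL.
Qed.

End energy_in_time.

(** * Integration by parts along a coordinate direction *)

Section line_integration.
Context {R : realType}.

Definition llim (f : R -> R) (x : R) : R := lim (f (x - s) @[s --> 0^'+]).
Definition rlim (f : R -> R) (x : R) : R := lim (f (x + s) @[s --> 0^'+]).
Definition rderiv (f : R -> R) (x : R) : R :=
  lim ((f (x + s) - f x) / s @[s --> 0^'+]).

Lemma llim_glue M p j : (j < M)%N ->
  llim (glue M p) (node M j.+1) = (p j).[node M j.+1].
Proof. by move=> jM; apply/cvg_lim => //; exact: glue_left_cvg. Qed.

Lemma rlim_glue M p x : (0 < M)%N -> rlim (glue M p) x = glue M p x.
Proof. by move=> M0; apply/cvg_lim => //; exact: glue_right_cvg. Qed.

Lemma rderiv_glue M p x : (0 < M)%N ->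
  rderiv (glue M p) x = glue M (fun j => (p j)^`()) x.
Proof. by move=> M0; apply/cvg_lim => //; exact: glue_right_derive. Qed.

Section ppoly_functionals.
Variables (k M : nat).
Hypothesis M0 : (0 < M)%N.

Lemma ppoly0 : ppoly k M (fun=> 0 : R).
Proof.
exists (fun=> 0); first by move=> j; rewrite size_poly0.
by apply/funext => x; rewrite /glue big1// => j _; rewrite horner0 if_same.
Qed.

Lemma bmf_ppoly (f : R -> R) : ppoly k M f -> bmf setT f.
Proof. by move=> [p _ ->]; exact: bmf_glue. Qed.

Lemma linear_on_llim j : (j < M)%N ->
  linear_on (ppoly k M) (fun f => llim f (node M j.+1)).
Proof.
move=> jM; apply: (@lim_linear_on _ _ (fun f s => f (node M j.+1 - s)) 0^'+) => // f.
by move=> fP; exact: ppoly_left_cvg fP jM.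
Qed.

Lemma linear_on_rderiv (x : R) : linear_on (ppoly k M) (fun f => rderiv f x).
Proof.
apply: (@lim_linear_on _ _ (fun f s => (f (x + s) - f x) / s) 0^'+).
  move=> f g c s; ring.
by move=> f [p _ ->]; apply/cvg_ex; eexists; exact: glue_right_derive.
Qed.

Lemma bmf_rderiv (f : R -> R) : ppoly k M f -> bmf setT (rderiv f).
Proof.
move=> [p _ ->]; apply: eq_bmf (bmf_glue M (fun j => (p j)^`()) setT).
by move=> x _; rewrite rderiv_glue.
Qed.

Lemma tspan_out n (F : 'rV[R]_n -> R) (x : 'rV[R]_n) i : tspan n (ppoly k M) F ->
  ~~ (0 <= x ord0 i < 1) -> F x = 0.
Proof.
move=> [m [c [s [sP ->]]]] xi; rewrite big1// => j _; have [f fP ->] := sP j.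
rewrite /tensor (bigD1 i)//=; have [p _ ->] := fP i.
by rewrite glue_out// mul0r mulr0.
Qed.

Lemma insx_addv n (i : 'I_n.+1) (s h : R) (y : 'rV[R]_n) :
  insx i s y + h *: dirv i = insx (n := n.+1) i (s + h) y.
Proof.
apply/rowP => j; case: (unliftP i j) => [m|] ->.
  rewrite mxE [in LHS]insxE_lift [RHS]insxE_lift !mxE eqxx eq_sym.
  by rewrite (negbTE (neq_lift i m)) mulr0 addr0.
by rewrite mxE [in LHS]insxE_same [RHS]insxE_same !mxE !eqxx mulr1.
Qed.

Lemma cell_grad_insx n (i : 'I_n.+1) F s (y : 'rV[R]_n) :
  cell_grad F (insx i s y) ord0 i = rderiv (fun z => F (insx i z y)) s.
Proof.
rewrite mxE; under eq_fun do rewrite insx_addv.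
by [].
Qed.

Lemma trace_lo_insx n (i : 'I_n.+1) F s (y : 'rV[R]_n) :
  trace_lo i F (insx i s y) = llim (fun z => F (insx i z y)) s.
Proof.
by rewrite /trace_lo; under eq_fun do rewrite -scaleNr insx_addv.
Qed.

Lemma trace_hi_insx n (i : 'I_n.+1) F s (y : 'rV[R]_n) :
  trace_hi i F (insx i s y) = rlim (fun z => F (insx i z y)) s.
Proof.
by rewrite /trace_hi; under eq_fun do rewrite insx_addv.
Qed.

Lemma dotv_jump n (i : 'I_n) (v : 'rV[R]_n) q x :
  dotv v (jump i q x) = v ord0 i * (trace_lo i q x - trace_hi i q x).
Proof.
rewrite /dotv (bigD1 i)//= !mxE !eqxx mulr1 mulrN mulr1 big1 ?addr0// => j ji.
by rewrite !mxE eqxx /= (negbTE ji) mulrN !mulr0 subrr mulr0.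
Qed.

Lemma dotv_dirv n (i : 'I_n) (v : 'rV[R]_n) c : dotv v (c *: dirv i) = v ord0 i * c.
Proof.
rewrite /dotv (bigD1 i)//= !mxE !eqxx mulr1 big1 ?addr0// => j ji.
by rewrite !mxE eqxx /= (negbTE ji) !mulr0.
Qed.

Lemma bmf_cell_grad n (i : 'I_n.+1) F (D : set 'rV[R]_n.+1) :
  tspan n.+1 (ppoly k M) F -> bmf D (fun x => cell_grad F x ord0 i).
Proof.
move=> FP; apply: eq_bmf (bmf_slice_coord (La := fun s f => rderiv f s) bmf_ppoly i D FP
  linear_on_rderiv bmf_rderiv).
by move=> x _; rewrite -cell_grad_insx insxP.
Qed.

End ppoly_functionals.

Lemma bmf_insx_at n (i : 'I_n.+1) (F : 'rV[R]_n.+1 -> R) (s : R) : 0 <= s <= 1 ->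
  bmf (cube R n.+1) F -> bmf (cube R n) (fun y => F (insx i s y)).
Proof.
move=> s01; apply: bmf_comp; first exact: measurable_cube.
  apply: measurable_funTS.
  exact: (measurableT_comp (measurable_insx i) (pair1_measurable (s : measurableTypeR R))).
by move=> y Cy; apply/cubeE; split => //=; rewrite in_itv.
Qed.

Section directional_integration.
Variables (n k M : nat) (i : 'I_n.+1) (a b : 'rV[R]_n.+1 -> R).
Hypothesis M0 : (0 < M)%N.
Hypotheses (ba : bmf (cube R n.+1) a) (bb : bmf (cube R n.+1) b).
Hypothesis da : forall (s : R) y, 0 <= s <= 1 -> cube R n y ->
  is_derive s 1 (fun s : R => a (insx i s y)) (b (insx i s y)).
Hypothesis cb : forall (s : R) y, 0 <= s <= 1 -> cube R n y ->
  {for s, continuous (fun s : R => b (insx i s y))}.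
Variables (U V : 'rV[R]_n.+1 -> R).
Hypotheses (UP : tspan n.+1 (ppoly k M) U) (VP : tspan n.+1 (ppoly k M) V).
Local Notation line F y := (fun s : R => F (insx i s y)).

(** The flux at the upper end of the cell below node [j], formed with left traces. [lower_flux]
    belongs to the cell above the node; its right traces are the values themselves. *)
Definition upper_flux j y : R :=
  a (insx i (node M j) y) *
  (llim (line U y) (node M j) * llim (line V y) (node M j)).
Definition lower_flux j y : R :=
  a (insx i (node M j) y) * (U (insx i (node M j) y) * V (insx i (node M j) y)).

Lemma node01 j : (j <= M)%N -> 0 <= (node M j : R) <= 1.
Proof. by move=> jM; rewrite divr_ge0//= -(nodeM M0) node_le. Qed.

Lemma bmf_upper_flux j : (j < M)%N -> bmf (cube R n) (upper_flux j.+1).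
Proof.
move=> jM; apply: bmfM; first by apply: bmf_insx_at; rewrite ?node01.
apply: bmfM.
  exact: (bmf_slice (La := fun f => llim f (node M j.+1)) (@bmf_ppoly k M) i _ UP (linear_on_llim jM)).
exact: (bmf_slice (La := fun f => llim f (node M j.+1)) (@bmf_ppoly k M) i _ VP (linear_on_llim jM)).
Qed.

Lemma bmf_lower_flux j : (j <= M)%N -> bmf (cube R n) (lower_flux j).
Proof.
move=> jM.
apply: (bmf_insx_at i (F := fun x => a x * (U x * V x)) (node01 jM)).
by apply: bmfM => //; apply: bmfM; apply: (bmf_tspan (@bmf_ppoly k M)).
Qed.

(** [a] times the cellwise derivative of U V in direction [i]: the i-th parts of the two transport
    terms of the scheme combined. *)
Definition advection x : R := a x *
  (cell_grad U x ord0 i * V x + U x * cell_grad V x ord0 i).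

Lemma bmf_advection : bmf (cube R n.+1) advection.
Proof.
have gF F (FP : tspan n.+1 (ppoly k M) F) := bmf_cell_grad M0 i (cube R n.+1) FP.
have tF F (FP : tspan n.+1 (ppoly k M) F) := bmf_tspan (@bmf_ppoly k M) (cube R n.+1) FP.
apply: bmfM => //; apply: bmfD.
  exact: bmfM (gF _ UP) (tF _ VP).
exact: bmfM (tF _ UP) (gF _ VP).
Qed.

Lemma directional_integration_by_parts :
  int_cube (fun x => advection x + b x * (U x * V x)) =
  \int[lebesgue_rV R n]_(y in cube R n)
    \sum_(j < M) (upper_flux j.+1 y - lower_flux j y).
Proof.
rewrite (Rintegral_cube_insx i); last first.
  apply: bmfD; first exact: bmf_advection.
  by apply: bmfM => //; apply: bmfM; apply: (bmf_tspan (@bmf_ppoly k M)).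
apply: eq_Rintegral => y /set_mem Cy.
have line_ppoly F : tspan n.+1 (ppoly k M) F -> ppoly k M (line F y).
  by apply: tspan_slice; [exact: ppoly0|move=> f g c; exact: ppoly_lin].
have [p _ Up] := line_ppoly U UP; have [q _ Vq] := line_ppoly V VP.
have := glue_integration_by_parts p q M0 (fun s s01 => da s01 Cy) (fun s s01 => cb s01 Cy).
rewrite /advection => H.
transitivity (\int[lebesgue_measure]_(s in `[0, 1]) (a (insx i s y) *
     (glue M (fun j => (p j)^`()) s * glue M q s +
      glue M p s * glue M (fun j => (q j)^`()) s)
     + b (insx i s y) * (glue M p s * glue M q s))).
  apply: eq_Rintegral => s _.
  have UE : U (insx i s y) = glue M p s by rewrite -Up.
  have VE : V (insx i s y) = glue M q s by rewrite -Vq.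
  by rewrite !cell_grad_insx Up Vq !rderiv_glue// UE VE.
rewrite H; apply: eq_bigr => j _; have jM := ltn_ord j.
have UE : U (insx i (node M j) y) = (p j).[node M j].
  by rewrite -[LHS]/(line U y (node M j)) Up (glueE _ jM)// lexx node_lt.
have VE : V (insx i (node M j) y) = (q j).[node M j].
  by rewrite -[LHS]/(line V y (node M j)) Vq (glueE _ jM)// lexx node_lt.
by rewrite /upper_flux /lower_flux Up Vq !llim_glue// UE VE.
Qed.

End directional_integration.
End line_integration.

(** * Face sums as sums over nodes *)

Section fluxes.
Context {R : realType} (n k N : nat).
Local Notation M := (2 ^ N.+1)%N.
Variables (T t : R) (A : R -> 'rV[R]_n.+1 -> 'rV[R]_n.+1).
Hypothesis bA : forall i, bmf (cube R n.+1) (fun x => A t x ord0 i).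
Implicit Types (F G : 'rV[R]_n.+1 -> R) (i : 'I_n.+1) (y : 'rV[R]_n).
Local Notation line F i y := (fun s : R => F (insx i s y)).
Local Notation PP := (ppoly k M).

Let M0 : (0 < M)%N. Proof. by rewrite expn_gt0. Qed.
Let M2 : M = (2 * 2 ^ N)%N. Proof. by rewrite expnS. Qed.

Lemma line_ppoly F i y : tspan n.+1 PP F -> PP (line F i y).
Proof. by apply: tspan_slice; [exact: ppoly0|move=> f g c; exact: ppoly_lin]. Qed.

Lemma llim_line_cvg F i y m : tspan n.+1 PP F -> (0 < m <= M)%N ->
  line F i y (node M m - s) @[s --> 0^'+] --> llim (line F i y) (node M m).
Proof.
move=> FP /andP[m0 mM]; rewrite -(prednK m0) in mM *.
exact: (ppoly_left_cvg (line_ppoly i y FP) mM).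
Qed.

Lemma rlim_line F i y s : tspan n.+1 PP F -> rlim (line F i y) s = F (insx i s y).
Proof.
move=> /(line_ppoly i y)[p _ Fp]; rewrite Fp rlim_glue//.
by rewrite -[RHS]/(line F i y s) Fp.
Qed.

(** The left trace has its own index because on the torus the face at node 0 takes its left trace at
    node M; elsewhere m' = m. *)
Definition jump_flux i F G (m m' : nat) y : R :=
  F (insx i (node M m) y) * (A t (insx i (node M m) y) ord0 i *
    (llim (line G i y) (node M m') - G (insx i (node M m) y))).

Lemma bmf_llim_line i F m : tspan n.+1 PP F -> (0 < m <= M)%N ->
  bmf (cube R n) (fun y => llim (line F i y) (node M m)).
Proof.
move=> FP /andP[m0 mM]; rewrite -(prednK m0) in mM *.
exact: (bmf_slice (La := fun f => llim f (node M m.-1.+1)) (@bmf_ppoly _ k M) i _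
  FP (linear_on_llim mM)).
Qed.

Lemma bmf_tspan_insx i F m : tspan n.+1 PP F -> (m <= M)%N ->
  bmf (cube R n) (fun y => F (insx i (node M m) y)).
Proof.
move=> FP mM; apply: (bmf_insx_at i (node01 M0 mM)).
exact: (bmf_tspan (@bmf_ppoly _ k M)).
Qed.

Lemma bmf_jump_flux i F G m m' : tspan n.+1 PP F -> tspan n.+1 PP G ->
  (m <= M)%N -> (0 < m' <= M)%N -> bmf (cube R n) (jump_flux i F G m m').
Proof.
move=> FP GP mM m'M; apply: bmfM; first exact: bmf_tspan_insx.
apply: bmfM; first exact: (bmf_insx_at i (node01 M0 mM) (bA i)).
by apply: bmfB; [exact: bmf_llim_line|exact: bmf_tspan_insx].
Qed.

Lemma integrable_cube (f : 'rV[R]_n -> R) : bmf (cube R n) f ->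
  (lebesgue_rV R n).-integrable (cube R n) (EFin \o f).
Proof.
by apply: bmf_integrable; [exact: measurable_cube|exact: lebesgue_cube_lty].
Qed.

Lemma interior_fluxE F G i m y : tspan n.+1 PP G ->
  F (insx i (node M m) y) *
    dotv (A t (insx i (node M m) y)) (jump i G (insx i (node M m) y)) =
  jump_flux i F G m m y.
Proof.
by move=> GP; rewrite dotv_jump trace_lo_insx trace_hi_insx (rlim_line _ _ _ GP).
Qed.

Lemma torus_fluxE F G i m y : tspan n.+1 PP F -> tspan n.+1 PP G -> (m < M)%N ->
  torus_flux A t F G i (node M m) y =
  jump_flux i F G m (if m == 0%N then M else m) y.
Proof.
move=> FP GP mM; rewrite /torus_flux dotv_jump trace_lo_insx trace_hi_insx /jump_flux.
(* On the rim of the face, where the periodic extension would wrap a transverse coordinate, [F]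
   vanishes and so do both sides. *)
have [/forallP y01|] := boolP [forall l, 0 <= y ord0 l < 1]; last first.
  rewrite negb_forall => /existsP[l yl].
  by rewrite (tspan_out (i := lift i l) FP) ?insxE_lift// !mul0r.
have pE z : 0 <= z < 1 -> perext 0 G (insx i z y) = G (insx i z y).
  move=> z01; rewrite /perext; congr G; apply/rowP => j; rewrite mxE subr0.
  have z0 (x : R) : 0 <= x < 1 -> Num.floor x = 0.
    by move=> x01; apply: floor_def; rewrite add0r.
  case: (unliftP i j) => [l|] ->.
    by rewrite insxE_lift z0 ?subr0.
  by rewrite insxE_same z0 ?subr0.
(* Just below 0 the extension reads [G] just below 1, so the left trace at node 0 becomes the one at
   node M. *)
have pEN z : -1 <= z < 0 -> perext 0 G (insx i z y) = G (insx i (1 + z) y).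
  move=> /andP[z1 z0]; rewrite /perext; congr G; apply/rowP => j; rewrite mxE subr0.
  case: (unliftP i j) => [l|] ->.
    rewrite !insxE_lift (_ : Num.floor _ = 0) ?subr0//; apply: floor_def.
    by rewrite add0r.
  rewrite !insxE_same (_ : Num.floor _ = -1) ?opprK 1?addrC//; apply: floor_def.
  by rewrite addNr z1.
have mr : node M m < 1 :> R by rewrite -[ltRHS](nodeM M0) node_lt.
have m0r : 0 <= node M m :> R by rewrite divr_ge0.
have -> : rlim (fun z => perext 0 G (insx i z y)) (node M m) = G (insx i (node M m) y).
  rewrite -(rlim_line i y (node M m) GP); apply/cvg_lim => //.
  have [p _ Gp] := line_ppoly i y GP.
  have GpE z : G (insx i z y) = glue M p z by rewrite -Gp.
  rewrite Gp rlim_glue//; have := @glue_right_cvg R M p (node M m) M0.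
  apply: cvg_trans.
  apply: near_eq_cvg; near=> s; rewrite pE ?GpE//.
  have s0 : 0 < s by near: s; exact: nbhs_right_gt.
  have s1 : s < 1 - node M m by near: s; apply: nbhs_right_lt; rewrite subr_gt0.
  by apply/andP; split; lra.
have -> : llim (fun z => perext 0 G (insx i z y)) (node M m) =
    llim (line G i y) (node M (if m == 0%N then M else m)).
  apply/cvg_lim => //; case: eqVneq => [m0|m0].
    have := @llim_line_cvg G i y M GP; rewrite M0 leqnn nodeM// => /(_ isT).
    apply: cvg_trans; apply: near_eq_cvg; near=> s; rewrite m0 node0 pEN ?add0r//.
    have s0 : 0 < s by near: s; exact: nbhs_right_gt.
    have s1 : s < 1 by near: s; exact: nbhs_right_lt.
    by apply/andP; split; lra.
  have m0' : 0 < node M m :> R by rewrite -[ltLHS](node0 M) node_lt// lt0n.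
  have := @llim_line_cvg G i y m GP; rewrite lt0n m0 ltnW// => /(_ isT).
  apply: cvg_trans; apply: near_eq_cvg; near=> s; rewrite pE//.
  have s0 : 0 < s by near: s; exact: nbhs_right_gt.
  have s1 : s < node M m by near: s; exact: nbhs_right_lt.
  by apply/andP; split; lra.
by [].
Unshelve. all: by end_near. Qed.

Lemma meshsize_node j : j%:R * meshsize N = node M (2 * j) :> R.
Proof.
by rewrite /meshsize /node expnS !natrM natrX invfM mulrACA divff ?mul1r// pnatr_eq0.
Qed.

Lemma half_meshsize_node : meshsize N / 2 = node M 1 :> R.
Proof. by rewrite /meshsize /node natrX exprSr invfM mul1r. Qed.

Lemma nodeD (i j : nat) : node M (i + j)%N = node M i + node M j :> R.
Proof. by rewrite /node natrD mulrDl. Qed.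

Lemma sum_iota0 K (f : nat -> R) : \sum_(j <- iota 0 K) f j = \sum_(j < K) f j.
Proof. by rewrite -(big_mkord xpredT f) /index_iota subn0. Qed.

(** [e = 0] is the primal mesh, with even nodes, and [e = 1] the dual mesh, with odd nodes. *)
Lemma torus_face_sum F G (e : nat) : tspan n.+1 PP F -> tspan n.+1 PP G ->
  (e <= 1)%N ->
  face_sum (torus_mesh N (node M e)) (torus_flux A t F G) =
  \sum_(i < n.+1) \sum_(j < 2 ^ N) \int[lebesgue_rV R n]_(y in cube R n)
    jump_flux i F G (2 * j + e) (if (2 * j + e == 0)%N then M else (2 * j + e)%N) y.
Proof.
move=> FP GP e1; have nodeE j : node M e + j%:R * meshsize N = node M (2 * j + e) :> R.
  by rewrite meshsize_node (nodeD (2 * j) e) addrC.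
have jM j : (j < 2 ^ N)%N -> (2 * j + e < M)%N by rewrite M2; lia.
have planesE : planes (torus_mesh N (node M e)) =
   [seq node M (2 * j + e) | j <- iota 0 (2 ^ N)] :> seq R.
  by apply: eq_map => j; rewrite nodeE.
rewrite (face_sumE (B := [:: 1])); last 2 first.
- apply: torus_mesh_unit_cells; have [//|e0 e1'] := andP (@node01 R M M0 e _).
    by rewrite (leq_trans e1).
  rewrite e0 -[ltRHS](nodeM M0) node_lt//; apply: leq_ltn_trans e1 _.
  by rewrite -[1%N](expn0 2) ltn_exp2l.
- move=> i s; rewrite planesE => /mapP[j]; rewrite mem_iota add0n => jN ->.
  apply: integrable_cube.
  apply: eq_bmf (fun y _ => esym (torus_fluxE i y FP GP (jM j jN))) _.
  apply: bmf_jump_flux => //; first exact: ltnW (jM j jN).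
  by case: eqP => [|/eqP]; rewrite ?M0 ?leqnn// -lt0n => ->; rewrite ltnW ?jM.
apply: eq_bigr => i _; rewrite planesE big_map sum_iota0.
apply: eq_bigr => j _; apply: eq_Rintegral => y _.
by rewrite torus_fluxE// jM.
Qed.

(** Contributions of cells are regrouped by node, odd and even nodes apart; [al 0] is inserted to
    start the even sum at 0 and removed again at the end. *)
Lemma sum_parity (al be : nat -> R) K : \sum_(j < 2 * K) (al j.+1 - be j) =
  \sum_(j < K) (al (2 * j + 1)%N - be (2 * j + 1)%N) +
  \sum_(j < K) (al (2 * j)%N - be (2 * j)%N) + al (2 * K)%N - al 0%N.
Proof.
elim: K => [|K IHK]; first by rewrite muln0 !big_ord0 addr0 add0r subrr.
rewrite mulnS add2n !big_ord_recr /= IHK addn1; ring.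
Qed.

End fluxes.

(** * The energy balance *)

Section energy_balance.
Context {R : realType} (n k N : nat).
Local Notation M := (2 ^ N.+1)%N.
Variables (T : R) (A : R -> 'rV[R]_n.+1 -> 'rV[R]_n.+1).
Hypothesis A_smooth : smooth_field T A.
Local Notation line F i y := (fun s : R => F (insx i s y)).
Local Notation PP := (ppoly k M).
Local Notation Q := (cube R n.+1).

Let M0 : (0 < M)%N. Proof. by rewrite expn_gt0. Qed.
Let M2 : M = (2 * 2 ^ N)%N. Proof. by rewrite expnS. Qed.

Lemma tspanS m (S S' : set (R -> R)) : S `<=` S' -> tspan m S `<=` tspan m S'.
Proof.
move=> SS' F [r [c [s [sS ->]]]]; exists r, c, s; split => // j.
by have [f fS ->] := sS j; exists f => // i; exact/SS'.
Qed.

Lemma left_continuous_cst (c x : R) : left_continuous (fun=> c) x.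
Proof. exact: cvg_cst. Qed.

Lemma odd_continuous0 : odd_continuous k N (fun=> 0 : R).
Proof. by split; [exact: ppoly0|move=> j _ _; exact: left_continuous_cst]. Qed.

Lemma even_continuous0 : even_continuous k N (fun=> 0 : R).
Proof. by split; [exact: ppoly0|move=> j _ _; exact: left_continuous_cst]. Qed.

Lemma circle_continuous0 : circle_continuous k N (fun=> 0 : R).
Proof. by split; [exact: even_continuous0|exact: cvg_cst]. Qed.

Lemma bmf_section (F : R * 'rV[R]_n.+1 -> R) t : t \in `[0, T] ->
  bmf (spacetime T n.+1) F -> bmf Q (fun x => F (t, x)).
Proof.
move=> tT; apply: bmf_comp; first exact: measurable_spacetime.
  exact: measurable_funTS (pair1_measurable (t : measurableTypeR R)).
by move=> x Qx; split.
Qed.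

Definition partial_comp t (i : 'I_n.+1) x := dcomp A i (t, x).

Section fixed_time.
Variable t : R.
Hypothesis tT : t \in `[0, T].

Lemma bmf_comp_at (i : 'I_n.+1) : bmf Q (fun x => A t x ord0 i).
Proof. exact: (bmf_section tT (bmf_comp_field A_smooth i)). Qed.

Lemma bmf_partial_comp (i : 'I_n.+1) : bmf Q (partial_comp t i).
Proof. exact: (bmf_section tT (bmf_dcomp A_smooth i)). Qed.

Lemma spacetime_insx (i : 'I_n.+1) (s : R) (y : 'rV[R]_n) : 0 <= s <= 1 -> cube R n y ->
  spacetime T n.+1 (t, insx i s y).
Proof. by move=> s01 Cy; split => //; apply/cubeE; split => //=; rewrite in_itv. Qed.

Lemma comp_derive_line (i : 'I_n.+1) (s : R) (y : 'rV[R]_n) : 0 <= s <= 1 -> cube R n y ->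
  is_derive s 1 (fun s => A t (insx i s y) ord0 i) (partial_comp t i (insx i s y)).
Proof. by move=> s01 Cy; exact: (comp_derive A_smooth (spacetime_insx i s01 Cy)). Qed.

Lemma partial_comp_line_continuous (i : 'I_n.+1) (s : R) (y : 'rV[R]_n) :
  0 <= s <= 1 -> cube R n y ->
  {for s, continuous (fun s : R => partial_comp t i (insx i s y))}.
Proof.
move=> s01 Cy; have D := @dcomp_continuous _ _ _ _ A_smooth i _ (spacetime_insx i s01 Cy).
have H1 : insx i h y @[h --> s] --> insx i s y.
  have -> : (fun h : R => insx i h y) = fun h => insx i s y + (h - s) *: dirv i.
    by apply/funext => h; rewrite insx_addv subrKC.
  have E : insx i s y = insx i s y + (s - s) *: dirv i by rewrite subrr scale0r addr0.
  rewrite [X in _ --> X]E.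
  apply: cvgD; first exact: cvg_cst.
  by apply: cvgZr_tmp; apply: cvgB; [exact: cvg_id|exact: cvg_cst].
have H2 : (t, insx i h y) @[h --> s] --> (t, insx i s y).
  exact: (cvg_pair (cvg_cst t) H1).
exact: (@cvg_comp _ _ _ (fun h : R => (t, insx i h y) : R * 'rV[R]_n.+1)
  (dcomp A i) _ _ _ H2 D).
Qed.

Variables (U V : 'rV[R]_n.+1 -> R).
Hypothesis UO : tspan n.+1 (odd_continuous k N) U.
Hypothesis VE : tspan n.+1 (even_continuous k N) V.

Let UP : tspan n.+1 PP U. Proof. by apply: tspanS UO => f []. Qed.
Let VP : tspan n.+1 PP V. Proof. by apply: tspanS VE => f []. Qed.
Let bU : bmf Q U. Proof. exact: (bmf_tspan (@bmf_ppoly _ k M)). Qed.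
Let bV : bmf Q V. Proof. exact: (bmf_tspan (@bmf_ppoly _ k M)). Qed.

Local Notation up i := (upper_flux M i (fun x => A t x ord0 i) U V).
Local Notation lo i := (lower_flux M i (fun x => A t x ord0 i) U V).

Definition net_flux (i : 'I_n.+1) (y : 'rV[R]_n) : R := \sum_(j < M) (up i j.+1 y - lo i j y).

Let intQ f : bmf Q f -> (lebesgue_rV R n.+1).-integrable Q (EFin \o f).
Proof. exact: integrable_cube. Qed.

Let mQ : measurable Q. Proof. exact: measurable_cube. Qed.

(** The relaxation terms add up by (V - U) U + (U - V) V = -(U - V)^2. The transport terms form A .
    grad(U V), which is integrated by parts in one direction at a time. *)
Lemma volume_terms_sum tau :
  volume_terms A tau t U V U + volume_terms A tau t V U V =
  - (tau^-1 * L2sq (fun x => U x - V x)) +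
  \sum_(i < n.+1) (\int[lebesgue_rV R n]_(y in cube R n) net_flux i y -
     int_cube (fun x => partial_comp t i x * (U x * V x))).
Proof.
have bg F (FP : tspan n.+1 PP F) i := bmf_cell_grad M0 i Q FP.
rewrite /volume_terms.
have -> : forall a b c d : R, a + b + (c + d) = (a + c) + (b + d) by move=> *; ring.
rewrite -mulrDr /int_cube -!RintegralD//; last 4 first.
- apply: intQ; apply: bmfM => //; apply: bmf_sum => i _; apply: bmfM; first exact: bmf_comp_at.
  exact: bg.
- apply: intQ; apply: bmfM => //; apply: bmf_sum => i _; apply: bmfM; first exact: bmf_comp_at.
  exact: bg.
- by apply: intQ; apply: bmfM => //; exact: bmfB.
- by apply: intQ; apply: bmfM => //; exact: bmfB.
congr (_ + _).
  rewrite -mulrN; congr (_ * _).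
  rewrite /L2sq /int_cube -mulN1r -RintegralZl//; last by apply: intQ; apply: bmfX; exact: bmfB.
  by apply: eq_Rintegral => x _; ring.
transitivity (\sum_(i < n.+1) \int[lebesgue_rV R n.+1]_(x in Q)
   advection i (fun x => A t x ord0 i) U V x).
  rewrite -Rintegral_sum//; last first.
    by move=> i _; exact: (intQ (bmf_advection i M0 (bmf_comp_at i) UP VP)).
  apply: eq_Rintegral => x _; rewrite /dotv !mulr_sumr -big_split /=.
  by apply: eq_bigr => i _; rewrite /advection; ring.
apply: eq_bigr => i _.
have <- := directional_integration_by_parts M0 (bmf_comp_at i) (bmf_partial_comp i)
  (@comp_derive_line i) (@partial_comp_line_continuous i) UP VP.
rewrite /int_cube RintegralD ?addrK//.
- exact: (intQ (bmf_advection i M0 (bmf_comp_at i) UP VP)).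
- by apply: intQ; apply: bmfM; [exact: bmf_partial_comp|exact: bmfM].
Qed.

Lemma source_bound (i : 'I_n.+1) B : (forall x, Q x -> `|partial_comp t i x| <= B) ->
  - int_cube (fun x => partial_comp t i x * (U x * V x)) <=
  B / 2 * (L2sq U + L2sq V).
Proof.
move=> bB; rewrite /L2sq /int_cube -RintegralD//; last 2 first.
- by apply: intQ; exact: bmfX.
- by apply: intQ; exact: bmfX.
rewrite -RintegralZl//; last by apply: intQ; apply: bmfD; exact: bmfX.
rewrite -[leLHS]mulN1r -RintegralZl//; last first.
  by apply: intQ; apply: bmfM; [exact: bmf_partial_comp|exact: bmfM].
apply: le_Rintegral => //.
- by apply: intQ; apply: bmfZ; apply: bmfM; [exact: bmf_partial_comp|exact: bmfM].
- by apply: intQ; apply: bmfZ; apply: bmfD; exact: bmfX.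
move=> x Qx; rewrite mulN1r; apply: (le_trans (ler_norm _)); rewrite normrN normrM.
rewrite (@le_trans _ _ (B * `|U x * V x|))// ?ler_wpM2r ?bB//.
have B0 : 0 <= B by rewrite (le_trans _ (bB x Qx)).
rewrite -mulrA ler_wpM2l// normrM.
rewrite -[U x ^+ 2]real_normK ?num_real// -[V x ^+ 2]real_normK ?num_real//.
have := sqr_ge0 (`|U x| - `|V x|); nra.
Qed.

(** At an odd node, a face of the dual mesh, [U] has equal traces. The jump of U V is then U times
    the jump of V, which is the flux of the second equation. *)
Lemma flux_jump_odd (i : 'I_n.+1) j (y : 'rV[R]_n) : (j < 2 ^ N)%N ->
  up i (2 * j + 1)%N y - lo i (2 * j + 1)%N y =
  jump_flux N t A i U V (2 * j + 1) (2 * j + 1) y.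
Proof.
move=> jN; have jM : (2 * j + 1 < M)%N by rewrite M2; lia.
have [_ Uc] : odd_continuous k N (line U i y).
  by apply: tspan_slice UO; [exact: odd_continuous0|exact: odd_continuous_lin].
have Ul : llim (line U i y) (node M (2 * j + 1)) = U (insx i (node M (2 * j + 1)) y).
  by apply/cvg_lim => //; apply: Uc => //; rewrite addn1 /= mul2n odd_double.
by rewrite /upper_flux /lower_flux /jump_flux Ul; ring.
Qed.

Lemma flux_jump_even (i : 'I_n.+1) j (y : 'rV[R]_n) : (0 < j < 2 ^ N)%N ->
  up i (2 * j)%N y - lo i (2 * j)%N y =
  jump_flux N t A i V U (2 * j) (2 * j) y.
Proof.
move=> /andP[j0 jN]; have jM : (2 * j < M)%N by rewrite M2; lia.
have [_ Vc] : even_continuous k N (line V i y).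
  by apply: tspan_slice VE; [exact: even_continuous0|exact: even_continuous_lin].
have Vl : llim (line V i y) (node M (2 * j)) = V (insx i (node M (2 * j)) y).
  apply/cvg_lim => //; apply: Vc; first by rewrite mul2n odd_double.
  by rewrite jM muln_gt0 j0.
by rewrite /upper_flux /lower_flux /jump_flux Vl; ring.
Qed.

(* In the sum over nodes the meaningless upper flux at node 0 cancels. *)
Lemma net_fluxE (i : 'I_n.+1) (y : 'rV[R]_n) : net_flux i y =
  \sum_(j < 2 ^ N) jump_flux N t A i U V (2 * j + 1) (2 * j + 1) y +
  \sum_(1 <= j < 2 ^ N) jump_flux N t A i V U (2 * j) (2 * j) y +
  (up i M y - lo i 0%N y).
Proof.
have H := sum_parity (fun j => up i j y) (fun j => lo i j y) (2 ^ N).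
rewrite -M2 in H; rewrite [LHS]H.
rewrite (eq_bigr (fun j : 'I_(2 ^ N) => jump_flux N t A i U V (2 * j + 1) (2 * j + 1) y)); last first.
  by move=> j _; exact: flux_jump_odd.
rewrite -(big_mkord xpredT (fun j => up i (2 * j)%N y - lo i (2 * j)%N y)).
rewrite big_ltn ?expn_gt0// muln0.
rewrite [in LHS](@eq_big_nat _ _ _ 1 (2 ^ N) _ (fun j => jump_flux N t A i V U (2 * j) (2 * j) y)).
  ring.
by move=> j jN; exact: flux_jump_even.
Qed.

End fixed_time.
End energy_balance.

(** * The periodic scheme *)

Section stability.
Context {R : realType} (n k : nat).
Variables (T : R) (A : R -> 'rV[R]_n.+1 -> 'rV[R]_n.+1).
Local Notation mu := (@lebesgue_measure R).

Lemma L2sq_ge0 (f : 'rV[R]_n.+1 -> R) : 0 <= L2sq f.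
Proof. by apply: Rintegral_ge0 => x _; exact: sqr_ge0. Qed.

Lemma stability_of_energy M (K : R) (D : R -> R) (u v ut vt : R -> 'rV[R]_n.+1 -> R) :
  0 < T -> 0 <= K ->
  (forall t, t \in `[0, T] -> tspan n.+1 (ppoly k M) (u t)) ->
  (forall t, t \in `[0, T] -> tspan n.+1 (ppoly k M) (v t)) ->
  C1_in_time T u ut -> C1_in_time T v vt ->
  (forall t, 0 <= D t) -> mu.-integrable `[0, T] (EFin \o D) ->
  {ae mu, forall t, `[0, T]%classic t ->
    2 * (int_cube (fun x => ut t x * u t x) + int_cube (fun x => vt t x * v t x)) <=
    K * (L2sq (u t) + L2sq (v t)) + D t} ->
  forall t, t \in `[0, T] -> L2sq (u t) + L2sq (v t) <=
    expR (K * T) * (L2sq (u 0) + L2sq (v 0) + \int[mu]_(s in `[0, T]) D s).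
Proof.
move=> T0 K0 uP vP uC vC D0 iD ae_le t tT.
have [_ [Eu [Eu' [cEu cEu' dEu EuE]]]] := energy_in_time T0 uP uC.
have [_ [Ev [Ev' [cEv cEv' dEv EvE]]]] := energy_in_time T0 vP vC.
have zT : 0 \in `[0, T] by rewrite in_itv/= lexx ltW.
have := @gronwall_ae R T K (fun s => Eu s + Ev s) (fun s => Eu' s + Ev' s) D T0 K0.
rewrite (EuE _ zT).1 (EvE _ zT).1 => /(_ _ _ _ _ D0 iD _ t).
rewrite (EuE _ tT).1 (EvE _ tT).1; apply.
- by rewrite addr_ge0 ?L2sq_ge0.
- by move=> s; apply: cvgD; [exact: cEu|exact: cEv].
- by move=> s; apply: cvgD; [exact: cEu'|exact: cEv'].
- by move=> s sT; exact: (is_deriveD (dEu s sT) (dEv s sT)).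
- have [Z [mZ Z0 ZP]] := ae_le; exists Z; split=> //; apply: subset_trans ZP.
  apply: subsetC => s Es sT; have := Es sT.
  by rewrite (EuE _ sT).1 (EvE _ sT).1 (EuE _ sT).2 (EvE _ sT).2 mulrDr.
- by move: tT; rewrite in_itv.
Qed.

Section fixed_level.
Variable N : nat.
Local Notation M := (2 ^ N.+1)%N.
Let M0 : (0 < M)%N. Proof. by rewrite expn_gt0. Qed.
Let M2 : M = (2 * 2 ^ N)%N. Proof. by rewrite expnS. Qed.
Hypothesis A_smooth : smooth_field T A.

Lemma primal_space_tspan : @primal_space R n.+1 k N `<=` tspan n.+1 (odd_continuous k N).
Proof. by apply: sparse_space_tspan => l lN; exact: Wspace_odd_continuous. Qed.

Lemma dual_space_tspan : @dual_space R n.+1 k N `<=` tspan n.+1 (even_continuous k N).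
Proof. by apply: sparse_space_tspan => l lN; exact: WspaceD_even_continuous. Qed.

Lemma periodic_dual_space_tspan :
  @periodic_dual_space R n.+1 k N `<=` tspan n.+1 (circle_continuous k N).
Proof.
move=> v [F FS ->]; apply: restrict_perext_tspan FS => l f lN fW.
by apply: perext_circle_continuous lN _; exact: Wspace_Vspace.
Qed.

Section fixed_time.
Variables (t : R) (U V : 'rV[R]_n.+1 -> R).
Hypothesis tT : t \in `[0, T].
Hypothesis UO : tspan n.+1 (odd_continuous k N) U.

(** After the interior nodes, the terms at nodes M and 0 remain. [V] matches across them and A takes
    equal values on opposite faces, so they combine into V times the jump of U on the identified
    face, which completes the primal face sum. *)
Lemma periodic_net_flux : periodic_field T A ->
  tspan n.+1 (circle_continuous k N) V ->
  \sum_(i < n.+1) \int[lebesgue_rV R n]_(y in cube R n) net_flux N A t U V i y =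
  face_sum (torus_mesh N 0) (torus_flux A t V U) +
  face_sum (torus_mesh N (meshsize N / 2)) (torus_flux A t U V).
Proof.
move=> A_per VC; have VE : tspan n.+1 (even_continuous k N) V by apply: tspanS VC => f [].
have UP : tspan n.+1 (ppoly k M) U by apply: tspanS UO => f [].
have VP : tspan n.+1 (ppoly k M) V by apply: tspanS VE => f [].
have bA := bmf_comp_at A_smooth tT.
rewrite -[X in torus_mesh N X](node0 M) half_meshsize_node.
rewrite !(torus_face_sum (k := k))// -big_split /=; apply: eq_bigr => i _.
have jM j : (j < 2 ^ N)%N -> (2 * j + 1 < M)%N by rewrite M2; lia.
have bP j : (j < 2 ^ N)%N -> bmf (cube R n)
    (jump_flux N t A i V U (2 * j + 0) (if (2 * j + 0 == 0)%N then M else (2 * j + 0)%N)).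
  move=> jN; apply: (bmf_jump_flux (k := k)) => //; rewrite addn0.
    by rewrite ltnW// (leq_ltn_trans _ (jM j jN))// leq_addr.
  case: eqP => [|/eqP]; rewrite ?M0 ?leqnn// -lt0n => -> /=.
  by rewrite ltnW// (leq_ltn_trans _ (jM j jN))// leq_addr.
have bD j : (j < 2 ^ N)%N -> bmf (cube R n)
    (jump_flux N t A i U V (2 * j + 1) (if (2 * j + 1 == 0)%N then M else (2 * j + 1)%N)).
  move=> jN; apply: (bmf_jump_flux (k := k)) => //; first exact: ltnW (jM j jN).
  by rewrite addn1 /= -addn1 ltnW// jM.
have mC := @measurable_cube R n.
rewrite -!Rintegral_sum//; last 2 first.
- by move=> j _; apply: integrable_cube; exact: bD.
- by move=> j _; apply: integrable_cube; exact: bP.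
rewrite -RintegralD//; last 2 first.
- by apply: integrable_cube; apply: bmf_sum => j _; exact: bP.
- by apply: integrable_cube; apply: bmf_sum => j _; exact: bD.
apply: eq_Rintegral => y /set_mem Cy.
rewrite (net_fluxE A tT UO VE)// -(big_mkord xpredT (fun j => jump_flux N t A i V U (2 * j + 0)
  (if (2 * j + 0 == 0)%N then M else (2 * j + 0)%N) y)).
rewrite big_ltn ?expn_gt0// muln0 add0n /=.
have [_ Vc] : circle_continuous k N (fun s => V (insx i s y)).
  by apply: tspan_slice VC; [exact: circle_continuous0|exact: circle_continuous_lin].
have Vl : llim (fun s => V (insx i s y)) 1 = V (insx i 0 y).
  by apply/cvg_lim.
have -> : upper_flux M i (fun x => A t x ord0 i) U V M y -
    lower_flux M i (fun x => A t x ord0 i) U V 0 y = jump_flux N t A i V U 0 M y.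
  rewrite /upper_flux /lower_flux /jump_flux (nodeM M0) node0 Vl.
  by rewrite -(A_per t i y tT Cy); ring.
rewrite (@eq_big_nat _ _ _ 1 (2 ^ N) (fun j => jump_flux N t A i V U (2 * j + 0) _ y)
   (fun j => jump_flux N t A i V U (2 * j) (2 * j) y)); last first.
  by move=> j /andP[j0 _]; rewrite addn0 muln_eq0 /= eqn0Ngt j0.
have -> : \sum_(j < 2 ^ N) jump_flux N t A i U V (2 * j + 1)
    (if (2 * j + 1 == 0)%N then M else (2 * j + 1)%N) y =
    \sum_(j < 2 ^ N) jump_flux N t A i U V (2 * j + 1) (2 * j + 1) y.
  by apply: eq_bigr => j _; rewrite addn1.
ring.
Qed.

End fixed_time.

(** The fluxes cancel exactly against the face sums, and the penalty has the favourable sign for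
    every positive [tau], so it is simply dropped. *)
Lemma periodic_energy tau (B : 'I_n.+1 -> R) t U V Ut Vt : t \in `[0, T] ->
  0 < tau -> periodic_field T A ->
  (forall i z, spacetime T n.+1 z -> `|dcomp A i z| <= B i) ->
  primal_space k N U -> periodic_dual_space k N V ->
  (int_cube (fun x => Ut x * U x) = volume_terms A tau t U V U
         - face_sum (torus_mesh N 0) (torus_flux A t V U)) ->
  (int_cube (fun x => Vt x * V x) = volume_terms A tau t V U V
         - face_sum (torus_mesh N (meshsize N / 2)) (torus_flux A t U V)) ->
  2 * (int_cube (fun x => Ut x * U x) + int_cube (fun x => Vt x * V x)) <=
  (\sum_i B i) * (L2sq U + L2sq V).
Proof.
move=> tT tau0 A_per BP /primal_space_tspan UO /periodic_dual_space_tspan VC -> ->.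
have VE : tspan n.+1 (even_continuous k N) V by apply: tspanS VC => f [].
have -> : forall a b c d : R, a - b + (c - d) = (a + c) - (b + d) by move=> *; ring.
rewrite -(periodic_net_flux tT UO A_per VC) (volume_terms_sum A_smooth tT UO VE).
rewrite sumrB.
have L0 : 0 <= tau^-1 * L2sq (fun x => U x - V x).
  by rewrite mulr_ge0 ?L2sq_ge0// invr_ge0 ltW.
have Y0 : - \sum_(i < n.+1) int_cube (fun x => partial_comp A t i x * (U x * V x)) <=
    (\sum_i B i) / 2 * (L2sq U + L2sq V).
  rewrite -sumrN !mulr_suml ler_sum// => i _.
  by apply: (source_bound A_smooth tT UO VE) => x Qx; apply: BP; split.
set X := \sum_(i < n.+1) _ in L0 Y0 *; set Y := \sum_(i < n.+1) int_cube _ in Y0 *.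
by move: L0 Y0; set a := tau^-1 * _; nra.
Qed.

End fixed_level.
End stability.

(** * The non-periodic scheme *)

Section nonperiodic.
Context {R : realType} (n k : nat).
Variables (T : R) (A : R -> 'rV[R]_n.+1 -> 'rV[R]_n.+1).
Hypothesis A_smooth : smooth_field T A.
Local Notation mu := (@lebesgue_measure R).
Local Notation Q := (cube R n.+1).
Local Notation q := (cube R n).

Lemma bmf_mul_integrable (b f : 'rV[R]_n -> R) : bmf q b ->
  (lebesgue_rV R n).-integrable q (EFin \o f) ->
  (lebesgue_rV R n).-integrable q (EFin \o (fun y => b y * f y)).
Proof.
move=> [mb [B bB]] iF; have mC := @measurable_cube R n.
have mf : measurable_fun q f by apply/measurable_EFinP; exact: measurable_int iF.
apply: (le_integrable mC _ _ (integrableZl mC `|B| iF)).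
  by apply/measurable_EFinP; exact: measurable_funM.
move=> y Cy /=; rewrite lee_fin !normrM ler_wpM2r//.
by rewrite (le_trans (bB y Cy))// normr_id ler_norm.
Qed.

(** |f| <= f^2 + 1, on a set of finite measure. *)
Lemma sqr_integrable_integrable (f : 'rV[R]_n -> R) : measurable_fun q f ->
  (lebesgue_rV R n).-integrable q (EFin \o (fun y => f y ^+ 2)) ->
  (lebesgue_rV R n).-integrable q (EFin \o f).
Proof.
move=> mf iF; have mC := @measurable_cube R n.
have i1 := @integrable_cube R n _ (bmf_cst q 1).
apply: (le_integrable mC _ _ (integrableD mC iF i1)); first exact/measurable_EFinP.
move=> y Cy /=; rewrite lee_fin [leRHS]ger0_norm ?addr_ge0 ?sqr_ge0//.
rewrite -[f y ^+ 2]real_normK ?num_real//.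
have := sqr_ge0 (`|f y| - 1); nra.
Qed.

Section fixed_level.
Variable N : nat.
Local Notation M := (2 ^ N.+1)%N.
Let M0 : (0 < M)%N. Proof. by rewrite expn_gt0. Qed.
Let M2 : M = (2 * 2 ^ N)%N. Proof. by rewrite expnS. Qed.

Lemma Rintegral_subset_le (D1 D2 : set (measurableTypeR R)) (f : R -> R) :
  measurable D1 -> measurable D2 -> D1 `<=` D2 ->
  mu.-integrable D2 (EFin \o f) -> (forall x, 0 <= f x) ->
  \int[mu]_(s in D1) f s <= \int[mu]_(s in D2) f s.
Proof.
move=> mD1 mD2 D12 iF f0; apply: fine_le.
- exact: (integrable_fin_num mD1 (integrableS mD2 mD1 D12 iF)).
- exact: integrable_fin_num.
- apply: ge0_subset_integral => //; first exact: measurable_int iF.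
  by move=> x _; rewrite lee_fin.
Qed.

Lemma ppoly_sqr_integrable (w : R -> R) (D : set (measurableTypeR R)) : ppoly k M w ->
  measurable D -> D `<=` `[0, 1]%classic ->
  mu.-integrable D (EFin \o (fun s => w s ^+ 2)).
Proof.
move=> [p _ ->] mD D01; apply: (integrableS _ mD D01) => //.
apply: bmf_integrable => //; last by apply: bmfX; exact: bmf_glue.
by rewrite /= lebesgue_measure_itv/= lte01 oppr0 adde0 ltry.
Qed.

(** The trace inequality on the first half cell, of length 1/M. Half cells are the common refinement
    of both meshes, so this applies to slices of u - v. *)
Lemma ppoly_trace0 (w : R -> R) : ppoly k M w ->
  w 0 ^+ 2 <= trace_cst k * M%:R * \int[mu]_(s in `[0, 1]) (w s ^+ 2).
Proof.
move=> wP; have [p ps wE] := wP; have Mr : 0 < M%:R :> R by rewrite ltr0n.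
have w0 : w 0 = (p 0%N).[0].
  by rewrite wE (@glueE _ M p 0%N) ?node0// lexx -[ltLHS](node0 M) node_lt.
have n1 : node M 1 = M%:R^-1 :> R by rewrite /node mul1r.
have n10 : 0 < node M 1 :> R by rewrite -[ltLHS](node0 M) node_lt.
have n11 : node M 1 <= 1 :> R by rewrite -(nodeM M0) node_le.
have := poly_trace_left 0 (ps 0%N) n10.
rewrite add0r {1}n1 ler_pdivrMl// -w0 => H; rewrite (le_trans H)// mulrA [M%:R * _]mulrC.
rewrite (ler_wpM2l (mulr_ge0 (ltW (trace_cst_gt0 k)) (ltW Mr)))//.
have -> : \int[mu]_(s in `[0, node M 1]) ((p 0%N).[s] ^+ 2) =
    \int[mu]_(s in `[0, node M 1]) (w s ^+ 2).
  apply/esym/eq_Rintegral_cell => [|s s01].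
    apply: ppoly_sqr_integrable => // x /=; rewrite !in_itv/= => /andP[-> x1].
    by rewrite ltW// (lt_le_trans x1).
  by rewrite wE (@glueE _ M p 0%N)// node0.
apply: Rintegral_subset_le => //.
- by move=> x /=; rewrite !in_itv/= => /andP[-> x1]; rewrite (le_trans x1).
- exact: ppoly_sqr_integrable.
- by move=> x; exact: sqr_ge0.
Qed.

Lemma ppoly_trace1 (w : R -> R) : ppoly k M w ->
  llim w 1 ^+ 2 <= trace_cst k * M%:R * \int[mu]_(s in `[0, 1]) (w s ^+ 2).
Proof.
move=> wP; have [p ps wE] := wP; have Mr : 0 < M%:R :> R by rewrite ltr0n.
have M1 : (M.-1.+1 = M)%N by rewrite prednK.
have w1 : llim w 1 = (p M.-1).[1].
  by have := @llim_glue R M p M.-1; rewrite M1 nodeM// -wE; apply.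
have nE : 1 - M%:R^-1 = node M M.-1 :> R.
  by rewrite /node -subn1 natrB// mulrBl divff ?gt_eqF// mul1r.
have i0 : 0 < M%:R^-1 :> R by rewrite invr_gt0.
have n0 : 0 <= node M M.-1 :> R by rewrite divr_ge0.
have n1 : node M M.-1 <= 1 :> R by rewrite -[leRHS](nodeM M0) node_le// leq_pred.
have := poly_trace_right 1 (ps M.-1) i0.
rewrite ler_pdivrMl// -w1 => H; rewrite (le_trans H)// mulrA [M%:R * _]mulrC.
rewrite (ler_wpM2l (mulr_ge0 (ltW (trace_cst_gt0 k)) (ltW Mr)))// nE.
have -> : \int[mu]_(s in `[node M M.-1, 1]) ((p M.-1).[s] ^+ 2) =
    \int[mu]_(s in `[node M M.-1, 1]) (w s ^+ 2).
  apply/esym/eq_Rintegral_cell => [|s s01].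
    apply: ppoly_sqr_integrable => // x /=; rewrite !in_itv/= => /andP[x0 /ltW ->].
    by rewrite (le_trans n0).
  rewrite wE (@glueE _ M p M.-1) ?M1 ?nodeM//.
apply: Rintegral_subset_le => //.
- by move=> x /=; rewrite !in_itv/= => /andP[x0 ->]; rewrite (le_trans n0).
- exact: ppoly_sqr_integrable.
- by move=> x; exact: sqr_ge0.
Qed.

Section fixed_time.
Variables (t : R) (g : 'I_n.+1 -> R -> 'rV[R]_n -> R).
Hypothesis tT : t \in `[0, T].
Hypothesis mg : forall i, measurable_fun q (g i t).
Hypothesis ig : forall i,
  (lebesgue_rV R n).-integrable q (EFin \o (fun y => g i t y ^+ 2)).
Implicit Types (F G : 'rV[R]_n.+1 -> R) (i : 'I_n.+1) (y : 'rV[R]_n).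
Local Notation line F i y := (fun s : R => F (insx i s y)).
Local Notation PP := (ppoly k M).
Local Notation bf F G := (@boundary_flux R n.+1 T A g t F G).

Let bA := bmf_comp_at A_smooth tT.

Definition low_value F i y : R :=
  if 0 == inflow T A i then g i t y else F (insx i 0 y).
Definition high_value F i y : R :=
  if 1 == inflow T A i then g i t y else llim (line F i y) 1.

Lemma boundary_flux0 F G i y : tspan n.+1 PP F -> tspan n.+1 PP G ->
  bf F G i 0 y = low_value F i y * (A t (insx i 0 y) ord0 i * - G (insx i 0 y)).
Proof.
move=> FP GP; rewrite /boundary_flux eqxx !trace_hi_insx.
rewrite (rlim_line _ _ _ FP) (rlim_line _ _ _ GP).
by rewrite scalerN -scaleNr dotv_dirv.
Qed.

Lemma boundary_flux1 F G i y :
  bf F G i 1 y = high_value F i y * (A t (insx i 1 y) ord0 i * llim (line G i y) 1).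
Proof. by rewrite /boundary_flux oner_eq0 eqxx !trace_lo_insx dotv_dirv. Qed.

Lemma boundary_flux_node F G i m y : tspan n.+1 PP G -> (0 < m < M)%N ->
  bf F G i (node M m) y = jump_flux N t A i F G m m y.
Proof.
move=> GP /andP[m0 mM]; rewrite /boundary_flux gt_eqF; last first.
  by rewrite -[ltLHS](node0 M) node_lt.
rewrite lt_eqF; last by rewrite -[ltRHS](nodeM M0) node_lt.
exact: interior_fluxE GP.
Qed.

Let unit0 : 0 <= (0 : R) <= 1. Proof. by rewrite lexx ler01. Qed.
Let unit1 : 0 <= (1 : R) <= 1. Proof. by rewrite lexx ler01. Qed.

Lemma bmf_llim1 F i : tspan n.+1 PP F -> bmf q (fun y => llim (line F i y) 1).
Proof.
move=> FP; have := bmf_llim_line i FP (m := M).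
by rewrite M0 leqnn nodeM// => /(_ isT).
Qed.

Lemma integrable_boundary_flux0 F G i : tspan n.+1 PP F -> tspan n.+1 PP G ->
  (lebesgue_rV R n).-integrable q (EFin \o bf F G i 0).
Proof.
move=> FP GP; have bF := bmf_tspan (@bmf_ppoly _ k M) Q FP.
have bG := bmf_tspan (@bmf_ppoly _ k M) Q GP.
have b : bmf q (fun y => A t (insx i 0 y) ord0 i * - G (insx i 0 y)).
  apply: bmfM; first exact: (bmf_insx_at i unit0 (bA i)).
  by apply: bmfN; exact: (bmf_insx_at i unit0 bG).
have -> : EFin \o bf F G i 0 = EFin \o (fun y =>
    (A t (insx i 0 y) ord0 i * - G (insx i 0 y)) * low_value F i y).
  by apply/funext => y /=; rewrite boundary_flux0// mulrC.
rewrite /low_value; case: (boolP (0 == inflow T A i)) => _.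
  by apply: bmf_mul_integrable => //; exact: sqr_integrable_integrable.
by apply: integrable_cube; apply: bmfM => //; exact: (bmf_insx_at i unit0 bF).
Qed.

Lemma integrable_boundary_flux1 F G i : tspan n.+1 PP F -> tspan n.+1 PP G ->
  (lebesgue_rV R n).-integrable q (EFin \o bf F G i 1).
Proof.
move=> FP GP.
have b : bmf q (fun y => A t (insx i 1 y) ord0 i * llim (line G i y) 1).
  apply: bmfM; first exact: (bmf_insx_at i unit1 (bA i)).
  exact: bmf_llim1.
have -> : EFin \o bf F G i 1 = EFin \o (fun y =>
    (A t (insx i 1 y) ord0 i * llim (line G i y) 1) * high_value F i y).
  by apply/funext => y /=; rewrite boundary_flux1// mulrC.
rewrite /high_value; case: (boolP (1 == inflow T A i)) => _.
  by apply: bmf_mul_integrable => //; exact: sqr_integrable_integrable.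
by apply: integrable_cube; apply: bmfM => //; exact: bmf_llim1.
Qed.

Lemma integrable_boundary_flux_node F G i m : tspan n.+1 PP F -> tspan n.+1 PP G ->
  (0 < m < M)%N -> (lebesgue_rV R n).-integrable q (EFin \o bf F G i (node M m)).
Proof.
move=> FP GP mM; apply: integrable_cube.
apply: eq_bmf (fun y _ => esym (boundary_flux_node F i y GP mM)) _.
case/andP: mM => m0 mM; apply: (bmf_jump_flux (k := k)) => //; first exact: ltnW.
by rewrite m0 (ltnW mM).
Qed.

Lemma ugrid_face_sum F G : tspan n.+1 PP F -> tspan n.+1 PP G ->
  face_sum (interval_mesh (ugrid N 0 1)) (bf F G) =
  \sum_(i < n.+1) \int[lebesgue_rV R n]_(y in q)
    (bf F G i 0 y + bf F G i 1 y +
     \sum_(1 <= j < 2 ^ N) jump_flux N t A i F G (2 * j) (2 * j) y).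
Proof.
move=> FP GP.
have gE : ugrid N 0 1 = [seq node M (2 * j) | j <- iota 0 (2 ^ N).+1] :> seq R.
  by apply: eq_map => j; rewrite add0r subr0 mul1r -meshsize_node.
have iF i (s : R) : s \in ugrid N 0 1 ->
    (lebesgue_rV R n).-integrable q (EFin \o bf F G i s).
  rewrite gE => /mapP[j]; rewrite mem_iota add0n => /andP[_ jN] ->.
  have [->|j0] := posnP j; first by rewrite muln0 node0; exact: integrable_boundary_flux0.
  have [->|jN'] := eqVneq j (2 ^ N)%N.
    by rewrite -M2 nodeM//; exact: integrable_boundary_flux1.
  apply: integrable_boundary_flux_node => //; rewrite M2; lia.
rewrite (face_sumE (B := ugrid N 0 1))//; last first.
  apply: interval_mesh_unit_cells; rewrite ?size_ugrid//.
  - by rewrite nth_ugrid// mul0r addr0.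
  - by rewrite nth_ugrid// add0r subr0 natrX mulrCA divff ?mulr1// expf_neq0.
  - move=> j; rewrite ltnS => jN; rewrite (nth_ugrid _ _ jN) (nth_ugrid _ _ (ltnW jN)).
    by rewrite lerD2l ler_wpM2r ?ler_nat// subr0 divr_ge0 ?exprn_ge0.
apply: eq_bigr => i _; rewrite [planes _]gE big_map sum_iota0 -(big_mkord xpredT
  (fun j => \int[lebesgue_rV R n]_(y in q) bf F G i (node M (2 * j)) y)).
have mC := @measurable_cube R n.
have iJ j : (0 < j < 2 ^ N)%N -> (lebesgue_rV R n).-integrable q
    (EFin \o jump_flux N t A i F G (2 * j) (2 * j)).
  move=> /andP[j0 jN]; apply: integrable_cube.
  by apply: (bmf_jump_flux (k := k)) => //; rewrite M2; lia.
have i0 := integrable_boundary_flux0 i FP GP.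
have i1 := integrable_boundary_flux1 i FP GP.
have K0 : (0 < 2 ^ N)%N by rewrite expn_gt0.
rewrite (big_nat_recr _ _ _ (leq0n _)) (big_ltn K0) muln0 node0 -M2 (nodeM M0).
have E1 : \sum_(1 <= j < 2 ^ N) \int[lebesgue_rV R n]_(y in q) bf F G i (node M (2 * j)) y =
    \int[lebesgue_rV R n]_(y in q)
      \sum_(1 <= j < 2 ^ N) jump_flux N t A i F G (2 * j) (2 * j) y.
  rewrite big_nat_cond; under [in RHS]eq_Rintegral do rewrite big_nat_cond.
  rewrite Rintegral_sum//; last by move=> j; rewrite andbT; exact: iJ.
  apply: eq_bigr => j; rewrite andbT => j0; apply: eq_Rintegral => y _.
  by apply: boundary_flux_node => //; rewrite M2; lia.
rewrite E1 RintegralD//; last 2 first.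
- by have := integrableD mC i0 i1; apply: eq_integrable => // y _ /=; rewrite EFinD.
- apply: integrable_cube; under eq_fun do rewrite big_nat_cond.
  apply: bmf_sum => j; rewrite andbT => j0.
  by apply: (bmf_jump_flux (k := k)) => //; rewrite M2; lia.
rewrite RintegralD; [|exact: mC|exact: i0|exact: i1].
exact: addrAC.
Qed.

Lemma dgrid_face_sum F G : tspan n.+1 PP F -> tspan n.+1 PP G ->
  face_sum (interval_mesh (dgrid N N)) (bf F G) =
  \sum_(i < n.+1) \int[lebesgue_rV R n]_(y in q)
    (bf F G i 0 y + bf F G i 1 y +
     \sum_(j < 2 ^ N) jump_flux N t A i F G (2 * j + 1) (2 * j + 1) y).
Proof.
move=> FP GP.
(* Subtracting h_N/2 from j h_N goes back one half node, from 2 j to 2 j - 1; the shift of the index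
   from 1 to 0 gives 2 j + 1. *)
have gE : @dgrid R N N = 0 :: rcons [seq node M (2 * j + 1) | j <- iota 0 (2 ^ N)] 1 :> seq R.
  rewrite /dgrid; congr (_ :: rcons _ _).
  rewrite -[in LHS](addn0 1%N) iotaDl -map_comp; apply: eq_map => j /=.
  rewrite half_meshsize_node meshsize_node (_ : (2 * (1 + j) = (2 * j + 1) + 1)%N); last by lia.
  by rewrite nodeD addrK.
have s01 : size (@dgrid R N N) = (2 ^ N).+2 by rewrite gE /= size_rcons size_map size_iota.
have nthE j : (0 < j <= 2 ^ N)%N -> (@dgrid R N N)`_j = node M (2 * j - 1) :> R.
  rewrite gE; case: j => // j /= jN; rewrite nth_rcons size_map size_iota jN.
  rewrite (nth_map 0%N) ?size_iota// nth_iota// add0n mulnS; congr (node M _); lia.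
have nthl : (@dgrid R N N)`_(2 ^ N).+1 = 1 :> R.
  by rewrite gE /= nth_rcons size_map size_iota ltnn eqxx.
have mC := @measurable_cube R n.
have i0 i := integrable_boundary_flux0 i FP GP.
have i1 i := integrable_boundary_flux1 i FP GP.
have jM j : (j < 2 ^ N)%N -> (0 < 2 * j + 1 < M)%N by rewrite M2; lia.
have iF i (s : R) : s \in dgrid N N ->
    (lebesgue_rV R n).-integrable q (EFin \o bf F G i s).
  rewrite gE in_cons mem_rcons in_cons => /or3P[/eqP ->|/eqP ->|]; [exact: i0|exact: i1|].
  move=> /mapP[j]; rewrite mem_iota add0n => /andP[_ jN] ->.
  exact: integrable_boundary_flux_node (jM j jN).
rewrite (face_sumE (B := dgrid N N))//; last first.
  apply: interval_mesh_unit_cells; rewrite ?s01//.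
  move=> j; rewrite !ltnS => jN; case: j jN => [|j] jN.
    rewrite [leLHS](_ : _ = 0)// nthE ?expn_gt0//.
    by rewrite -[leLHS](node0 M); apply: node_le.
  move: jN; rewrite leq_eqVlt => /predU1P[->|jN].
    rewrite nthl nthE ?leqnn ?expn_gt0// -[leRHS](nodeM M0); apply: node_le; rewrite M2; lia.
  rewrite !nthE ?jN ?(ltnW jN)//; apply: node_le; lia.
apply: eq_bigr => i _; rewrite [planes _]gE big_cons big_rcons big_map sum_iota0.
have E1 : \sum_(j < 2 ^ N) \int[lebesgue_rV R n]_(y in q) bf F G i (node M (2 * j + 1)) y =
    \int[lebesgue_rV R n]_(y in q)
      \sum_(j < 2 ^ N) jump_flux N t A i F G (2 * j + 1) (2 * j + 1) y.
  rewrite Rintegral_sum//; last first.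
    move=> j _; apply: integrable_cube; have /andP[j0 j1] := jM j (ltn_ord j).
    by apply: (bmf_jump_flux (k := k)); rewrite ?j0 ?(ltnW j1).
  apply: eq_bigr => j _; apply: eq_Rintegral => y _.
  exact: boundary_flux_node (jM j (ltn_ord j)).
rewrite E1 RintegralD//; last 2 first.
- by have := integrableD mC (i0 i) (i1 i); apply: eq_integrable => // y _ /=; rewrite EFinD.
- apply: integrable_cube; apply: bmf_sum => j _; have /andP[j0 j1] := jM j (ltn_ord j).
  by apply: (bmf_jump_flux (k := k)); rewrite ?j0 ?(ltnW j1).
rewrite RintegralD; [|exact: mC|exact: i0|exact: i1].
rewrite -addrA; congr (_ + _); exact: addrC.
Qed.

End fixed_time.
End fixed_level.
End nonperiodic.

(** * Boundary terms and their absorption into the penalty *)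

Section nonperiodic_energy.
Context {R : realType} (n k N : nat).
Variables (T : R) (A : R -> 'rV[R]_n.+1 -> 'rV[R]_n.+1).
Hypothesis A_smooth : smooth_field T A.
Hypothesis A_nonzero : forall t x i, t \in `[0, T] -> cube R n.+1 x ->
  A t x ord0 i != 0.
Local Notation Q := (cube R n.+1).
Local Notation q := (cube R n).
Local Notation M := (2 ^ N.+1)%N.
Local Notation PP := (ppoly k M).
Local Notation line F i y := (fun s : R => F (insx i s y)).
Let M0 : (0 < M)%N. Proof. by rewrite expn_gt0. Qed.
Let unit0 : 0 <= (0 : R) <= 1. Proof. by rewrite lexx ler01. Qed.
Let unit1 : 0 <= (1 : R) <= 1. Proof. by rewrite lexx ler01. Qed.

Lemma insx_in_cube (i : 'I_n.+1) (s : R) (y : 'rV[R]_n) : 0 <= s <= 1 -> q y -> Q (insx i s y).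
Proof. by move=> s01 qy; apply/cubeE; split => //=; rewrite in_itv. Qed.

(** A single negative value forces negativity everywhere by [comp_sign], so the default branch of
    [inflow] is exactly the case A_i < 0. *)
Lemma inflow_sign (i : 'I_n.+1) :
  (inflow T A i = 0 /\ forall t x, t \in `[0, T] -> Q x -> 0 < A t x ord0 i) \/
  (inflow T A i = 1 /\ forall t x, t \in `[0, T] -> Q x -> A t x ord0 i < 0).
Proof.
rewrite /inflow; case: asboolP => [Ap|nAp]; [by left|right; split=> //].
have [t0 [x0 [t0T Qx0 A0]]] : exists t0 x0, [/\ t0 \in `[0, T], Q x0 & A t0 x0 ord0 i < 0].
  apply: contrapT => H; apply: nAp => t x tT Qx; rewrite lt0r A_nonzero//= leNgt.
  by apply/negP => Ax; apply: H; exists t, x.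
exact: comp_sign A0.
Qed.

Lemma inflow01 (i : 'I_n.+1) : 0 <= inflow T A i <= 1.
Proof. by have [[-> _]|[-> _]] := inflow_sign i. Qed.

Section fixed_time.
Variables (t : R) (g : 'I_n.+1 -> R -> 'rV[R]_n -> R).
Hypothesis tT : t \in `[0, T].
Hypothesis mg : forall i, measurable_fun q (g i t).
Hypothesis ig : forall i,
  (lebesgue_rV R n).-integrable q (EFin \o (fun y => g i t y ^+ 2)).
Variables (nu : 'I_n.+1 -> R).
Hypothesis nuP : forall i x, Q x -> `|A t x ord0 i| <= nu i.
Local Notation bf F G := (@boundary_flux R n.+1 T A g t F G).
Let bA := bmf_comp_at A_smooth tT.
Let mC := @measurable_cube R n.

Definition inflow_energy (i : 'I_n.+1) : R := \int[lebesgue_rV R n]_(y in q)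
  (`|A t (insx i (inflow T A i) y) ord0 i| * g i t y ^+ 2).

Variables (U V : 'rV[R]_n.+1 -> R).
Hypothesis UO : tspan n.+1 (odd_continuous k N) U.
Hypothesis VE : tspan n.+1 (even_continuous k N) V.
Let UP : tspan n.+1 PP U. Proof. by apply: tspanS UO => f []. Qed.
Let VP : tspan n.+1 PP V. Proof. by apply: tspanS VE => f []. Qed.
Local Notation W := (fun x => U x - V x).
Let bU : bmf Q U. Proof. exact: (bmf_tspan (@bmf_ppoly _ k M)). Qed.
Let bV : bmf Q V. Proof. exact: (bmf_tspan (@bmf_ppoly _ k M)). Qed.
Let bW : bmf Q W. Proof. exact: bmfB. Qed.

(** What the two ends of the line contribute to the energy: the boundary terms of the integration by
    parts minus the boundary fluxes of both equations. *)
Definition boundary_excess (i : 'I_n.+1) (y : 'rV[R]_n) : R :=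
  upper_flux M i (fun x => A t x ord0 i) U V M y -
  lower_flux M i (fun x => A t x ord0 i) U V 0 y -
  (bf V U i 0 y + bf V U i 1 y) - (bf U V i 0 y + bf U V i 1 y).

Definition trace_gap (i : 'I_n.+1) (y : 'rV[R]_n) : R :=
  (U (insx i 0 y) - V (insx i 0 y)) ^+ 2 +
  (llim (line U i y) 1 - llim (line V i y) 1) ^+ 2.

(* Central fluxes: on each boundary face the excess is a cross term -|a| U V up
   to sign, i.e. |a| (U - V)^2 / 2 minus the squares that absorb the inflow
   datum. *)
Lemma boundary_excess_le (i : 'I_n.+1) (y : 'rV[R]_n) : q y -> boundary_excess i y <=
  `|A t (insx i (inflow T A i) y) ord0 i| * g i t y ^+ 2 + nu i / 2 * trace_gap i y.
Proof.
move=> qy; rewrite /boundary_excess !boundary_flux1 !(boundary_flux0 _ _ _ _ _ _ UP VP).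
rewrite !(boundary_flux0 _ _ _ _ _ _ VP UP) /upper_flux /lower_flux /low_value /high_value.
rewrite (nodeM M0) node0 /trace_gap.
have Q0 := insx_in_cube i unit0 qy; have Q1 := insx_in_cube i unit1 qy.
have := nuP i Q0; have := nuP i Q1.
set a0 := A t (insx i 0 y) ord0 i; set a1 := A t (insx i 1 y) ord0 i.
set U0 := U (insx i 0 y); set V0 := V (insx i 0 y); set G := g i t y.
set U1 := llim (line U i y) 1; set V1 := llim (line V i y) 1.
have S0 := sqr_ge0 (U0 - V0); have S1 := sqr_ge0 (U1 - V1).
have [[-> Ap]|[-> An]] := inflow_sign i.
  rewrite eqxx oner_eq0 -/a0; have A0 := Ap _ _ tT Q0; have A1 := Ap _ _ tT Q1.
  rewrite !gtr0_norm// => n1 n0.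
  (* At inflow, G (U + V) - U V = G^2 + (U - V)^2/2 - (G - U)^2/2 - (G - V)^2/2; at outflow, - U V =
     (U - V)^2/2 - U^2/2 - V^2/2. *)
  have E0 := mulr_ge0 (ltW A0) (sqr_ge0 (G - U0)).
  have E1 := mulr_ge0 (ltW A0) (sqr_ge0 (G - V0)).
  have F0 : 0 <= (nu i - a0) * (U0 - V0) ^+ 2 by rewrite mulr_ge0 ?subr_ge0.
  have F1 : 0 <= (nu i - a1) * (U1 - V1) ^+ 2 by rewrite mulr_ge0 ?subr_ge0.
  have G1 := mulr_ge0 (ltW A1) (sqr_ge0 U1).
  have G2 := mulr_ge0 (ltW A1) (sqr_ge0 V1).
  by move: E0 E1 F0 F1 G1 G2; rewrite -/a0 -/a1; lra.
rewrite eq_sym oner_eq0 eqxx -/a1; have A0 := An _ _ tT Q0; have A1 := An _ _ tT Q1.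
rewrite !ltr0_norm// => n1 n0.
have E0 : 0 <= - a1 * (G - U1) ^+ 2 by rewrite mulr_ge0 ?sqr_ge0// oppr_ge0 ltW.
have E1 : 0 <= - a1 * (G - V1) ^+ 2 by rewrite mulr_ge0 ?sqr_ge0// oppr_ge0 ltW.
have F0 : 0 <= (nu i + a0) * (U0 - V0) ^+ 2 by rewrite mulr_ge0// -[a0]opprK subr_ge0.
have F1 : 0 <= (nu i + a1) * (U1 - V1) ^+ 2 by rewrite mulr_ge0// -[a1]opprK subr_ge0.
have G1 : 0 <= - a0 * U0 ^+ 2 by rewrite mulr_ge0 ?sqr_ge0// oppr_ge0 ltW.
have G2 : 0 <= - a0 * V0 ^+ 2 by rewrite mulr_ge0 ?sqr_ge0// oppr_ge0 ltW.
by move: E0 E1 F0 F1 G1 G2; lra.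
Qed.

Let intD (f h : 'rV[R]_n -> R) : (lebesgue_rV R n).-integrable q (EFin \o f) ->
  (lebesgue_rV R n).-integrable q (EFin \o h) ->
  (lebesgue_rV R n).-integrable q (EFin \o (fun y => f y + h y)).
Proof.
by move=> If Ih; apply: eq_integrable (integrableD mC If Ih) => // y _; rewrite /= EFinD.
Qed.

Let intB (f h : 'rV[R]_n -> R) : (lebesgue_rV R n).-integrable q (EFin \o f) ->
  (lebesgue_rV R n).-integrable q (EFin \o h) ->
  (lebesgue_rV R n).-integrable q (EFin \o (fun y => f y - h y)).
Proof.
by move=> If Ih; apply: eq_integrable (integrableB mC If Ih) => // y _; rewrite /= EFinB.
Qed.

Let bN i : bmf q (net_flux N A t U V i).
Proof.
apply: bmf_sum => j _; apply: bmfB; first exact: (bmf_upper_flux i M0 (bA i) UP VP (ltn_ord j)).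
exact: (bmf_lower_flux i M0 (bA i) UP VP (ltnW (ltn_ord j))).
Qed.

Let i0 (F G : 'rV[R]_n.+1 -> R) i : tspan n.+1 PP F -> tspan n.+1 PP G ->
  (lebesgue_rV R n).-integrable q (EFin \o (fun y => bf F G i 0 y + bf F G i 1 y)).
Proof.
move=> FP GP; apply: intD.
  exact: (integrable_boundary_flux0 A_smooth tT mg ig i FP GP).
exact: (integrable_boundary_flux1 A_smooth tT mg ig i FP GP).
Qed.

Lemma integrable_boundary_excess i :
  (lebesgue_rV R n).-integrable q (EFin \o boundary_excess i).
Proof.
apply: (intB (intB _ (i0 i VP UP)) (i0 i UP VP)); apply: integrable_cube.
apply: bmfB; last exact: (bmf_lower_flux i M0 (bA i) UP VP (leq0n M)).
have jM : (M.-1 < M)%N by rewrite prednK.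
by have := bmf_upper_flux i M0 (bA i) UP VP jM; rewrite prednK.
Qed.

(** The interior jump fluxes in [net_fluxE] are those of the two face sums: even nodes for the
    primal mesh, odd nodes for the dual one. *)
Lemma net_flux_boundary : 
  \sum_(i < n.+1) \int[lebesgue_rV R n]_(y in q) net_flux N A t U V i y -
  face_sum (interval_mesh (ugrid N 0 1)) (bf V U) -
  face_sum (interval_mesh (dgrid N N)) (bf U V) =
  \sum_(i < n.+1) \int[lebesgue_rV R n]_(y in q) boundary_excess i y.
Proof.
rewrite (ugrid_face_sum A_smooth tT mg ig VP UP) (dgrid_face_sum A_smooth tT mg ig UP VP).
rewrite -!sumrB; apply: eq_bigr => i _.
have J1 : (lebesgue_rV R n).-integrable q (EFin \o (fun y =>
    \sum_(1 <= j < 2 ^ N) jump_flux N t A i V U (2 * j) (2 * j) y)).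
  apply: integrable_cube; under eq_fun do rewrite big_nat_cond.
  apply: bmf_sum => j; rewrite andbT => j0.
  by apply: (bmf_jump_flux (k := k)) => //; rewrite expnS; lia.
have J2 : (lebesgue_rV R n).-integrable q (EFin \o (fun y =>
    \sum_(j < 2 ^ N) jump_flux N t A i U V (2 * j + 1) (2 * j + 1) y)).
  apply: integrable_cube; apply: bmf_sum => j _; have := ltn_ord j => jN.
  by apply: (bmf_jump_flux (k := k)) => //; rewrite expnS; lia.
have I1 := intD (i0 i VP UP) J1; have I2 := intD (i0 i UP VP) J2.
have I3 := integrable_cube (bN i).
rewrite -(RintegralB mC I3 I1) -(RintegralB mC (intB I3 I1) I2).
apply: eq_Rintegral => y _; rewrite /boundary_excess (net_fluxE A tT UO VE).
set S1 := \sum_(j < _) _; set S2 := \sum_(1 <= j < _) _; ring.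
Qed.

Lemma bmf_trace_gap i : bmf q (trace_gap i).
Proof.
apply: bmfD; apply: bmfX; first exact: (bmf_insx_at i unit0 bW).
exact: bmfB (bmf_llim1 i UP) (bmf_llim1 i VP).
Qed.

(** The trace inequality is applied to the slice of U - V on every line, at both ends, whence the
    factor 2; integrating over the lines gives the norm on the cube. *)
Lemma trace_gap_le i : \int[lebesgue_rV R n]_(y in q) trace_gap i y <=
  2 * (trace_cst k * M%:R * L2sq W).
Proof.
have bW2 : bmf Q (fun x => W x ^+ 2) by exact: bmfX.
rewrite /L2sq (Rintegral_cube_insx i bW2) mulrA -RintegralZl//; last first.
  exact: (Rintegrable_cube_insx i bW2).
apply: le_Rintegral => //; first exact: integrable_cube (bmf_trace_gap i).
  apply: eq_integrable (integrableZl mC (2 * (trace_cst k * M%:R)) (Rintegrable_cube_insx i bW2)) => //.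
move=> y qy; have Wl : PP (line W i y).
  have := ppoly_lin (-1) (line_ppoly i y UP) (line_ppoly i y VP).
  by rewrite (_ : (fun _ => _) = line W i y)//; apply/funext => s; rewrite mulN1r.
have := ppoly_trace0 Wl; have := ppoly_trace1 Wl.
have -> : llim (line W i y) 1 = llim (line U i y) 1 - llim (line V i y) 1.
  have MM : (0 < M <= M)%N by rewrite M0 leqnn.
  have cU := @llim_line_cvg R n k N U i y M UP MM.
  have cV := @llim_line_cvg R n k N V i y M VP MM.
  by rewrite (nodeM M0) in cU cV; apply/cvg_lim => //; exact: cvgB.
rewrite /trace_gap; set J := \int[_]_(s in _) _; lra.
Qed.

Lemma nonperiodic_energy tau (B : 'I_n.+1 -> R) Ut Vt : 0 < tau ->
  (\sum_i nu i) * trace_cst k * M%:R * tau <= 1 ->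
  (forall i z, spacetime T n.+1 z -> `|dcomp A i z| <= B i) ->
  (int_cube (fun x => Ut x * U x) = volume_terms A tau t U V U
         - face_sum (interval_mesh (ugrid N 0 1)) (bf V U)) ->
  (int_cube (fun x => Vt x * V x) = volume_terms A tau t V U V
         - face_sum (interval_mesh (dgrid N N)) (bf U V)) ->
  2 * (int_cube (fun x => Ut x * U x) + int_cube (fun x => Vt x * V x)) <=
  (\sum_i B i) * (L2sq U + L2sq V) + 2 * \sum_i inflow_energy i.
Proof.
move=> tau0 tauP BP -> ->.
have -> : forall a b c d : R, a - b + (c - d) = (a + c) - b - d by move=> *; ring.
rewrite (volume_terms_sum A_smooth tT UO VE) sumrB.
have H := net_flux_boundary.
have Q00 : Q 0 by move=> i; rewrite mxE lexx ler01.
have L0 := L2sq_ge0 W.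
have Y0 : - \sum_(i < n.+1) int_cube (fun x => partial_comp A t i x * (U x * V x)) <=
    (\sum_i B i) / 2 * (L2sq U + L2sq V).
  rewrite -sumrN !mulr_suml ler_sum// => i _.
  by apply: (source_bound A_smooth tT UO VE) => x Qx; apply: BP; split.
have E0 : \sum_(i < n.+1) \int[lebesgue_rV R n]_(y in q) boundary_excess i y <=
    \sum_i inflow_energy i + tau^-1 * L2sq W.
  apply: (@le_trans _ _ (\sum_i (inflow_energy i +
      nu i / 2 * (2 * (trace_cst k * M%:R * L2sq W))))).
    apply: ler_sum => i _.
    have bAi : bmf q (fun y => `|A t (insx i (inflow T A i) y) ord0 i|).
      have [mA [B' bB]] := bmf_insx_at i (inflow01 i) (bA i).
      split; first exact: measurableT_comp.
      by exists B' => y qy; rewrite normr_id; exact: bB.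
    have iA := bmf_mul_integrable bAi (ig i).
    have iT := integrable_cube (bmfZ (nu i / 2) (bmf_trace_gap i)).
    rewrite (le_trans (le_Rintegral mC (integrable_boundary_excess i) (intD iA iT)
      (@boundary_excess_le i)))//.
    rewrite (RintegralD mC iA iT) lerD2l RintegralZl//; last first.
      exact: integrable_cube (bmf_trace_gap i).
    by rewrite ler_wpM2l ?divr_ge0 ?trace_gap_le// (le_trans _ (nuP i Q00)).
  (* Multiplied by [tau], the remaining bound is exactly the smallness hypothesis [tauP]: the
     weights nu_i/2 cancel the factor 2 from the two faces. *)
  rewrite big_split /= lerD2l ler_pdivlMl//.
  have -> : \sum_i nu i / 2 * (2 * (trace_cst k * M%:R * L2sq W)) =
      (\sum_i nu i) * trace_cst k * M%:R * L2sq W.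
    by rewrite !mulr_suml; apply: eq_bigr => i _; field.
  by rewrite mulrA [tau * _]mulrC ler_piMl.
move: H L0 Y0 E0; set X := \sum_(i < n.+1) _; set Y := \sum_(i < n.+1) int_cube _.
set Z := \sum_(i < n.+1) _; set a := tau^-1 * _; set D := \sum_i inflow_energy i.
nra.
Qed.

End fixed_time.
End nonperiodic_energy.

(** * Inflow data at almost every time *)

Section inflow_data.
Context {R : realType} (n k : nat).
Variables (T : R) (A : R -> 'rV[R]_n.+1 -> 'rV[R]_n.+1).
Hypothesis A_smooth : smooth_field T A.
Local Notation mu := (@lebesgue_measure R).
Local Notation mR := (measurableTypeR R).
Local Notation q := (cube R n).
Variable g : 'I_n.+1 -> R -> 'rV[R]_n -> R.
Hypothesis gP : square_integrable_data T g.

Lemma inflow_energy_ge0 t i : 0 <= inflow_energy T A t g i.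
Proof. by apply: Rintegral_ge0 => y _; rewrite mulr_ge0 ?normr_ge0 ?sqr_ge0. Qed.

Hypothesis A_nonzero : forall t x i, t \in `[0, T] -> cube R n.+1 x ->
  A t x ord0 i != 0.

Lemma integrable_inflow_energy i :
  mu.-integrable `[0, T] (EFin \o (fun t => inflow_energy T A t g i)).
Proof.
have mC := @measurable_cube R n; have mI : measurable (`[0, T]%classic : set mR) by [].
have [mg ig] := gP i.
apply: (@Rintegrable_fubini1 _ _ mR 'rV[R]_n R mu (lebesgue_rV R n) `[0, T]%classic q
  (fun z => `|A z.1 (insx i (inflow T A i) z.2) ord0 i| * g i z.1 z.2 ^+ 2)) => //.
have mD : measurable (`[0, T]%classic `*` q : set (mR * 'rV[R]_n)) by exact: measurableX.
have [mA [B bB]] : bmf (spacetime T n) (fun z : mR * 'rV[R]_n =>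
    A z.1 (insx i (inflow T A i) z.2) ord0 i).
  apply: (bmf_comp (E := spacetime T n.+1) (f := fun z => A z.1 z.2 ord0 i)
    (h := fun z : mR * 'rV[R]_n => (z.1, insx i (inflow T A i) z.2))).
  - exact: measurable_spacetime.
  - apply: measurable_funTS; apply: measurable_fun_pair => //=.
    have H : measurable_fun setT (fun z : mR * 'rV[R]_n => ((inflow T A i : mR), z.2)).
      exact: measurable_fun_pair.
    exact: (measurableT_comp (measurable_insx i) H).
  - move=> z [/= z1 z2]; split => //=; apply/cubeE; split => //=.
    by rewrite in_itv; exact: inflow01.
  - exact: bmf_comp_field.
have mgi := measurable_funX 2 mg.
apply: (le_integrable mD _ _ (integrableZl mD `|B| ig)).
  apply/measurable_EFinP; apply: measurable_funM; last exact: mgi.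
  exact: measurableT_comp.
move=> z Dz /=; rewrite lee_fin !normrM ler_wpM2r// !normr_id.
by rewrite (le_trans (bB z Dz))// ler_norm.
Qed.

(** All time sections are measurable, but Fubini gives square integrability of the section only for
    almost every [t]. *)
Lemma ae_inflow_data : {ae mu, forall t, `[0, T]%classic t -> forall i,
  measurable_fun q (g i t) /\
  (lebesgue_rV R n).-integrable q (EFin \o (fun y => g i t y ^+ 2))}.
Proof.
have mC := @measurable_cube R n; have mI : measurable (`[0, T]%classic : set mR) by [].
have H : {ae mu, forall t, forall i, `[0, T]%classic t ->
    (lebesgue_rV R n).-integrable q (EFin \o (fun y => g i t y ^+ 2))}.
  apply: filter_forall => i; have [mg ig] := gP i.
  exact: (@ae_integrable_fubini1 _ _ mR 'rV[R]_n R mu (lebesgue_rV R n) `[0, T]%classic q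
    (fun z => g i z.1 z.2 ^+ 2)).
apply: (@filterS _ _ (ae_filter_ringOfSetsType mu) _ _ _ H) => t Ht tT i.
split; last exact: Ht.
have [mg _] := gP i.
have mD : measurable (`[0, T]%classic `*` q : set (mR * 'rV[R]_n)) by exact: measurableX.
apply: (measurable_comp mD (f := fun z : mR * 'rV[R]_n => g i z.1 z.2 : mR)
  (g := fun y : 'rV[R]_n => ((t : mR), y)) _ mg).
  by move=> _ [y qy <-]; split.
exact: measurable_funTS (pair1_measurable (t : mR)).
Qed.

End inflow_data.

Unset Implicit Arguments.

Theorem theorem3p1 (R : realType) (d k : nat) (hd : (2 <= d)%N)
    (T : R) (hT : 0 < T) (A : R -> 'rV[R]_d -> 'rV[R]_d)
    (A_smooth : smooth_field T A)
    (A_nonzero : forall t x i, t \in `[0, T] -> cube R d x ->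
       A t x ord0 i != 0)
    (A_bounded : forall i, has_ubound (absvals T (fun t x => A t x ord0 i)))
    (divA_bounded : has_ubound (absvals T (divergence A))) :
  (periodic_field T A ->
   exists C : R, forall (tau : R) (N : nat) (u v : R -> 'rV[R]_d -> R),
     0 < tau -> (1 <= N)%N -> periodic_solution T A k N tau u v ->
     forall t, t \in `[0, T] ->
       L2sq (u t) + L2sq (v t) <= C * (L2sq (u 0) + L2sq (v 0)))
  /\
  (exists c C : R, 0 < c /\
   forall (tau : R) (N : nat) (g : 'I_d -> R -> 'rV[R]_d.-1 -> R)
          (u v : R -> 'rV[R]_d -> R),
     0 < tau -> (1 <= N)%N -> tau <= c * meshsize N / norm1 T A ->
     square_integrable_data T g ->
     nonperiodic_solution T A g k N tau u v ->
     forall t, t \in `[0, T] ->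
       L2sq (u t) + L2sq (v t) <=
       C * (L2sq (u 0) + L2sq (v 0) + data_norm T A g)).
Proof.
case: d hd A A_smooth A_nonzero A_bounded divA_bounded => // n _ A A_smooth A_nonzero
  A_bounded _.
have [B BP] : exists B : 'I_n.+1 -> R, forall i,
    0 <= B i /\ forall z, spacetime T n.+1 z -> `|dcomp A i z| <= B i.
  have H i : exists b : R, 0 <= b /\ forall z, spacetime T n.+1 z -> `|dcomp A i z| <= b.
    have [_ [b bP]] := bmf_dcomp A_smooth i; exists `|b|; split=> // z Dz.
    by rewrite (le_trans (bP z Dz))// ler_norm.
  exists (fun i => sval (cid (H i))) => i; exact: svalP (cid (H i)).
have B0 : 0 <= \sum_i B i by apply: sumr_ge0 => i _; have [] := BP i.
have BD i z : spacetime T n.+1 z -> `|dcomp A i z| <= B i by have [_] := BP i; apply.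
have UP N F : @primal_space R n.+1 k N F -> tspan n.+1 (ppoly k (2 ^ N.+1)) F.
  by move=> /primal_space_tspan; apply: tspanS => f [].
have t0T : 0 \in `[0, T] by rewrite in_itv/= lexx ltW.
split.
  move=> A_per; exists (expR ((\sum_i B i) * T)) => tau N u v tau0 _ [uvS [ut [vt [uC vC E]]]] t tT.
  have := @stability_of_energy R n k T (2 ^ N.+1) (\sum_i B i) (fun=> 0) u v ut vt hT B0.
  have -> : \int[lebesgue_measure]_(s in `[0, T]) (fun=> 0) s = 0 :> R.
    by rewrite /Rintegral integral0.
  rewrite addr0; apply=> //.
  - by move=> s sT; have [/UP] := uvS s sT.
  - move=> s sT; have [_ /periodic_dual_space_tspan] := uvS s sT.
    by apply: tspanS => f [[]].
  - exact: integrable0.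
  - apply: aeW => s sT.
    have {}sT : s \in `[0, T] by [].
    have [uS vS] := uvS s sT; have [Eu Ev] := E s sT; rewrite addr0.
    have H := periodic_energy A_smooth sT tau0 A_per BD uS vS (Eu _ uS) (Ev _ vS).
    exact: H.
pose nu i := sup (absvals T (fun t x => A t x ord0 i)).
have nuP t i x : t \in `[0, T] -> cube R n.+1 x -> `|A t x ord0 i| <= nu i.
  by move=> tT Qx; apply: ub_le_sup; [exact: A_bounded|exists t, x].
have tr0 := @trace_cst_gt0 R k.
(* There are M = 2/h_N half cells per line, so absorption requires |A|_1 [trace_cst k] (2/h_N) [tau]
   <= 1; this fixes the first constant. The factor 2 in the second accounts for the source, which is
   twice the inflow energy. *)
exists (2 * trace_cst k)^-1, (2 * expR ((\sum_i B i) * T)); split.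
  by rewrite invr_gt0 mulr_gt0.
move=> tau N g u v tau0 _ tau_le gP [uvS [ut [vt [uC vC E]]]] t tT.
have tauP : (\sum_i nu i) * trace_cst k * (2 ^ N.+1)%:R * tau <= 1.
  have nu0 i : 0 <= nu i.
    by apply: le_trans (nuP 0 i 0 t0T _) => // j; rewrite mxE lexx ler01.
  have N0 : 0 < \sum_i nu i.
    (* If the norm were 0, division by zero would make the right-hand side of [tau_le] equal to 0,
       against 0 < [tau]. *)
    rewrite lt0r sumr_ge0// andbT; apply/eqP => N0.
    by move: tau_le; rewrite /norm1 N0 invr0 mulr0 leNgt tau0.
  move: (trace_cst k) tr0 tau_le => c c0 tau_le.
  rewrite mulrC -ler_pdivlMr ?mulr_gt0//.
  apply: (le_trans tau_le); rewrite le_eqVlt; apply/orP; left; apply/eqP.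
  rewrite /norm1 -/nu /meshsize natrX exprS; field.
  by rewrite !gt_eqF// exprn_gt0.
pose D s := 2 * \sum_i inflow_energy T A s g i.
have D0 s : 0 <= D s.
  by rewrite mulr_ge0// sumr_ge0// => i _; exact: inflow_energy_ge0.
have mI : measurable (`[0, T]%classic : set (measurableTypeR R)) by [].
have iS : lebesgue_measure.-integrable `[0, T]
    (EFin \o (fun s => \sum_i inflow_energy T A s g i)).
  have -> : EFin \o (fun s => \sum_i inflow_energy T A s g i) =
      (fun s => \sum_i (inflow_energy T A s g i)%:E)%E.
    by apply/funext => s /=; rewrite sumEFin.
  by apply: integrable_sum => // i _; exact: integrable_inflow_energy.
have iD : lebesgue_measure.-integrable `[0, T] (EFin \o D).
  by apply: eq_integrable (integrableZl mI 2 iS).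
have := @stability_of_energy R n k T (2 ^ N.+1) (\sum_i B i) D u v ut vt hT B0.
have -> : \int[lebesgue_measure]_(s in `[0, T]) D s = 2 * data_norm T A g.
  by rewrite RintegralZl.
move=> /(_ _ _ uC vC D0 iD _ t tT) H.
have {}H : L2sq (u t) + L2sq (v t) <= expR ((\sum_i B i) * T) *
    (L2sq (u 0) + L2sq (v 0) + 2 * data_norm T A g).
  apply: H.
  - by move=> s sT; have [/UP] := uvS s sT.
  - move=> s sT; have [_ /dual_space_tspan] := uvS s sT.
    by apply: tspanS => f [].
  - apply: (@filterS _ _ (ae_filter_ringOfSetsType lebesgue_measure)
      _ _ _ (ae_inflow_data gP)) => s gs sT.
    have mg i := (gs sT i).1; have ig i := (gs sT i).2.
    have {}sT : s \in `[0, T] by [].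
    have [uS vS] := uvS s sT; have [Eu Ev] := E s sT.
    apply: (nonperiodic_energy A_smooth A_nonzero sT mg ig (fun i x => nuP s i x sT)
      (primal_space_tspan uS) (dual_space_tspan vS) tau0 tauP BD (Eu _ uS) (Ev _ vS)).
apply: (le_trans H); rewrite [2 * expR _]mulrC -mulrA ler_pM2l ?expR_gt0//.
have := L2sq_ge0 (u 0); have := L2sq_ge0 (v 0); lra.
Qed.
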